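(* Let $q>2$, $G_n\to_{lwc}\mu$, and consider the $q$-Potts model with $\beta,B\ge0$. Write $\Phi=\Phi_\mu$ and $\mathcal R=\mathcal R_\mu$. (a) Suppose $(\beta,B)$ is joined to $\mathcal R_\infty$ by an interpolation path contained in $\mathcal R$; that is, either there is an interpolation path in $\mathcal R$ from some $(0,B')$ to $(\beta,B)$, or there is an interpolation path in $\mathcal R$ from $(\beta,B)$ to some point $(\beta',B')$ followed by the ray $\{\beta'\}\times[B',\infty)$ contained in $\mathcal R$, or followed by the ray $[\beta',\infty)\times\{B'\}$ contained in $\mathcal R$ with $B'>0$. Then $\phi(\beta,B)=\lim_n\phi_n(\beta,B)$ exists and $\phi(\beta,B)=\Phi(\beta,B,h^{\mathrm f})=\Phi(\beta,B,h^{1})$. (b) If there is an interpolation path from $(\beta_0,B_0)$ to $(\beta_1,B_1)$ along which $h^{\mathrm f}$ is ($\mu^\uparrow$-a.s.) continuous in the interpolation parameter, then $$\liminf_{n\to\infty}[\phi_n(\beta_1,B_1)-\phi_n(\beta_0,B_0)]\ge\Phi(\beta_1,B_1,h^{\mathrm f})-\Phi(\beta_0,B_0,h^{\mathrm f}).$$ If instead $h^1$ is continuous along such a path, then $$\limsup_{n\to\infty}[\phi_n(\beta_1,B_1)-\phi_n(\beta_0,B_0)]\le\Phi(\beta_1,B_1,h^{1})-\Phi(\beta_0,B_0,h^{1}).$$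
   Context: Graphs are undirected and locally finite. For a vertex $v$, $\partial v$ is its set of neighbours, $D_v=|\partial v|$, and $B_t(v)$ is the subgraph induced by vertices at graph distance $\le t$ from $v$. $\mathcal G_*$ is the space of isomorphism classes of rooted connected locally finite graphs $(G,o)$ with metric $1/(1+R)$, $R$ the largest radius such that the rooted balls of radius $R$ are isomorphic; $\mathcal T_*\subset\mathcal G_*$ is the subspace of rooted trees $(T,o)$; $T_t=B_t(o)$. A Borel probability measure $\mu$ on $\mathcal G_*$ is unimodular if $\mathbb E_\mu[\sum_{x}f(G,o,x)]=\mathbb E_\mu[\sum_x f(G,x,o)]$ for every nonnegative Borel $f$ on doubly-rooted graphs. For random finite graphs $G_n=(V_n=[n],E_n)$ with $I_n$ uniform on $V_n$ and $\mathbb E_n$ expectation over $G_n,I_n$: ''$G_n\to_{lwc}\mu$'' means $(G_n)$ is uniformly sparse ($\lim_{L\to\infty}\limsup_n\mathbb E_n[D_{I_n}\mathbf 1\{D_{I_n}\ge L\}]=0$), $B_t(I_n)\to T_t$ in law in $\mathcal G_*$ for each $t$ where $T$ has law $\mu$ on $\mathcal T_*$ (such $\mu$ is unimodular), and $\mu(D_o=0)<1$. Factor models: for symmetric $\psi:\mathscr X^2\to[0,\infty)$ and $\bar\psi:\mathscr X\to[0,\infty)$ the factor model on finite $G=(V,E)$ is $\nu_G(\vec\sigma)=Z_G^{-1}\prod_{(ij)\in E}\psi(\sigma_i,\sigma_j)\prod_{i}\bar\psi(\sigma_i)$ and $\phi_n(\beta,B)=\frac1n\mathbb E_n[\log Z_{G_n}(\beta,B)]$.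 The $q$-Potts model: $\mathscr X=[q]$, $\psi(\sigma,\sigma')=e^{\beta\delta_{\sigma,\sigma'}}$, $\bar\psi(\sigma)=e^{B\delta_{\sigma,1}}$. Messages and Bethe functional: $\mathcal T_\to$ is the space of trees rooted at a directed edge $x\to y$; $T_{x\to y}$ is the component containing $x$ of $T$ minus edge $(x,y)$, rooted at $x$; $\mu^\uparrow$ is the law of $(T,J\to o)$ with $T\sim\mu$ conditioned on $D_o\ge1$ and $J$ uniform on $\partial o$. A message is a measurable map $(T,x\to y)\mapsto h_{x\to y}\in\Delta_{\mathscr X}$. For $T\in\mathcal T_*$, $$\Phi_T(\beta,B,h)=\log\Big\{\sum_\sigma\bar\psi(\sigma)\prod_{j\in\partial o}\sum_{\sigma_j}\psi(\sigma,\sigma_j)h_{j\to o}(\sigma_j)\Big\}-\frac12\sum_{j\in\partial o}\log\Big\{\sum_{\sigma,\sigma_j}\psi(\sigma,\sigma_j)h_{j\to o}(\sigma_j)h_{o\to j}(\sigma)\Big\},$$ and $\Phi_\mu(\beta,B,h)=\mathbb E_\mu[\Phi_T(\beta,B,h)]$. Potts messages: for $T\in\mathcal T_*$, $\bar h^{t,\mathrm f}_T$ is the law of $\sigma_o$ under the Potts model on the finite tree $T_t$, and $\bar h^{t,1}_T$ is the law of $\sigma_o$ under the Potts measure on $T_{t+1}$ conditioned on $\sigma_v=1$ for all $v$ at distance $t+1$ from $o$. The limits $\bar h^\ddagger_T=\lim_t\bar h^{t,\ddagger}_T$ exist for $\beta,B\ge0$; $h^\ddagger_{x\to y}:=\bar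 h^\ddagger_{T_{x\to y}}$, $\ddagger\in\{\mathrm f,1\}$. $\mathcal R_\mu=\{(\beta,B):\beta,B\ge0,\ h^{\mathrm f}=h^1\ \mu^\uparrow\text{-a.s.}\}$, and $\mathcal R_\infty=(\{0\}\times\mathbb R_{\ge0})\cup(\mathbb R_{\ge0}\times\{\infty\})\cup(\{\infty\}\times\mathbb R_{>0})$. An interpolation path from $(\beta_0,B_0)\le(\beta_1,B_1)$ (coordinatewise) is a piecewise-linear path, each piece parallel to a coordinate axis, that is coordinatewise nondecreasing from $(\beta_0,B_0)$ to $(\beta_1,B_1)$. *)

(* Defs.v *)
From HB Require Import structures.
From mathcomp Require Import all_boot all_order all_algebra.
From mathcomp Require Import all_classical all_reals all_analysis.
Set Implicit Arguments. Unset Strict Implicit. Unset Printing Implicit Defensive.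
Import Order.TTheory GRing.Theory Num.Theory.
Import numFieldNormedType.Exports.
Local Open Scope classical_set_scope.
Local Open Scope ring_scope.

(* ---------- Potts interaction on colours 'I_q ; colour "1" is ord 0 ---------- *)
Definition psi {R : realType} {q : nat} (beta : R) (s s' : 'I_q) : R :=
  expR (beta * (s == s')%:R).
Definition psib {R : realType} {q : nat} (B : R) (s : 'I_q) : R :=
  expR (B * ((s : nat) == 0%N)%:R).

Definition graphn (n : nat) := {set 'I_n * 'I_n}.
Definition simple_graph n (G : graphn n) : bool :=
  [forall i, forall j, ((i, j) \in G) == ((j, i) \in G)] && [forall i, (i, i) \notin G].
Definition deg n (G : graphn n) (v : 'I_n) : nat := #|[set j | (v, j) \in G]|.

(* Potts partition function: each undirected edge (i<j) counted once *)
Definition ZG {R : realType} (q n : nat) (beta B : R) (G : graphn n) : R :=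
  \sum_(sigma : {ffun 'I_n -> 'I_q})
    (\prod_(e in G | (e.1 < e.2)%N) psi beta (sigma e.1) (sigma e.2)) *
    \prod_(i : 'I_n) psib B (sigma i).

(* a random graph sequence: P n G = probability of G_n = G *)
Definition random_graphs {R : realType} (P : forall n, graphn n -> R) : Prop :=
  forall n, (forall G, 0 <= P n G) /\ \sum_(G : graphn n) P n G = 1 /\
            (forall G, P n G != 0 -> simple_graph G).

Definition En {R : realType} (P : forall n, graphn n -> R) n (f : graphn n -> 'I_n -> R) : R :=
  \sum_(G : graphn n) P n G * (n%:R^-1 * \sum_(v : 'I_n) f G v).

Definition phin {R : realType} (q : nat) (P : forall n, graphn n -> R) (beta B : R) n : R :=
  n%:R^-1 * \sum_(G : graphn n) P n G * ln (ZG q beta B G).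

Fixpoint gball n (G : graphn n) (v : 'I_n) (t : nat) : {set 'I_n} :=
  if t is t'.+1 then gball G v t' :|: [set j | [exists i in gball G v t', (i, j) \in G]]
  else [set v].

(* ---------- rooted locally finite trees, Ulam-Harris (plane) encoding ---------- *)
(* T u = number of children of vertex u; vertices = valid labels, root = [::]; labels are
   root-first, the j-th child of u is rcons u j. Every rooted locally finite tree has such
   an encoding; all quantities below are invariant under re-ordering of children. *)
Definition ptree := seq nat -> nat.
Definition shift (T : ptree) (i : nat) : ptree := fun w => T (i :: w).
Fixpoint valid (T : ptree) (u : seq nat) : bool :=
  if u is i :: w then (i < T [::])%N && valid (shift T i) w else true.
Definition is_child (u w : seq nat) : bool :=
  (size w == (size u).+1) && (take (size u) w == u).
Definition tadj (u w : seq nat) : bool := is_child u w || is_child w u.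
Definition parent (u : seq nat) : seq nat := take (size u).-1 u.
Definition remove_child (T : ptree) (j : nat) : ptree := fun u =>
  match u with
  | [::] => (T [::]).-1
  | i :: w => T ((if (i < j)%N then i else i.+1) :: w)
  end.

Definition ptree_cyl : set (set ptree) := [set A | exists u k, A = [set T | T u = k]].
Definition ptree_mt := g_sigma_algebraType ptree_cyl.

Definition rooted_iso (U V : eqType) (A : pred U) (eA : rel U) (a : U)
  (B : pred V) (eB : rel V) (b : V) : Prop :=
  exists f : U -> V, {in A &, injective f} /\ (forall y, B y <-> exists2 x, A x & f x = y)
    /\ f a = b /\ {in A &, forall x y, eB (f x) (f y) = eA x y}.

Definition tball (T : ptree) (t : nat) : pred (seq nat) := fun u => valid T u && (size u <= t)%N.

Fixpoint tlist (T : ptree) (t : nat) : seq (seq nat) :=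
  if t is t'.+1 then
    [::] :: flatten [seq [seq i :: u | u <- tlist (shift T i) t'] | i <- iota 0 (T [::])]
  else [:: [::]].

(* Potts model on the finite tree with vertex list L (positions 'I_(size L)),
   edges = parent/child pairs; bnd = set of vertices pinned to colour 1 *)
Section PottsTree.
Context {R : realType} (q : nat) (beta B : R).
Definition tweight (L : seq (seq nat)) (sigma : {ffun 'I_(size L) -> 'I_q}) : R :=
  (\prod_(p : 'I_(size L) * 'I_(size L) | is_child (nth [::] L p.1) (nth [::] L p.2))
     psi beta (sigma p.1) (sigma p.2)) *
  \prod_(k : 'I_(size L)) psib B (sigma k).
Definition pinned (L : seq (seq nat)) (d : nat) (sigma : {ffun 'I_(size L) -> 'I_q}) : bool :=
  [forall k : 'I_(size L), (size (nth [::] L k) == d) ==> ((sigma k : nat) == 0%N)].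
Definition root_is (L : seq (seq nat)) (s : 'I_q) (sigma : {ffun 'I_(size L) -> 'I_q}) : bool :=
  [forall k : 'I_(size L), (nth [::] L k == [::]) ==> (sigma k == s)].
Definition tmarg (L : seq (seq nat)) (d : nat) (s : 'I_q) : R :=
  (\sum_(sigma : {ffun 'I_(size L) -> 'I_q} | pinned d sigma && root_is s sigma) tweight sigma) /
  (\sum_(sigma : {ffun 'I_(size L) -> 'I_q} | pinned d sigma) tweight sigma).
(* free b.c. on T_t (no vertex has depth t.+1, so nothing is pinned) *)
Definition hbar_f (t : nat) (T : ptree) (s : 'I_q) : R := tmarg (tlist T t) t.+1 s.
Definition hbar_1 (t : nat) (T : ptree) (s : 'I_q) : R := tmarg (tlist T t.+1) t.+1 s.
Definition hf (T : ptree) (s : 'I_q) : R := limn (fun t => hbar_f t T s).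
Definition h1 (T : ptree) (s : 'I_q) : R := limn (fun t => hbar_1 t T s).

(* Bethe functional Phi_T(beta,B,h); h is given as a function of the tree T_{x->y}
   (rooted at x), i.e. h_{x->y} = h (T_{x->y}); for root o and child j,
   T_{j->o} = shift T j and T_{o->j} = remove_child T j *)
Definition PhiT (h : ptree -> 'I_q -> R) (T : ptree) : R :=
  ln (\sum_(s : 'I_q) psib B s *
        \prod_(j < T [::]) \sum_(s' : 'I_q) psi beta s s' * h (shift T j) s')
  - 2^-1 * \sum_(j < T [::])
       ln (\sum_(s : 'I_q) \sum_(s' : 'I_q) psi beta s s' * h (shift T j) s' *
             h (remove_child T j) s).
End PottsTree.

Definition Phimu {R : realType} (q : nat) (mu : probability ptree_mt R) (beta B : R)
  (h : ptree -> 'I_q -> R) : \bar R :=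
  (\int[mu]_T (PhiT beta B h T)%:E)%E.

(* (beta,B) in R_mu : h^f = h^1 mu^up-a.s. *)
Definition inRmu {R : realType} (q : nat) (mu : probability ptree_mt R) (p : R * R) : Prop :=
  0 <= p.1 /\ 0 <= p.2 /\
  {ae mu, forall T : ptree_mt, forall j, (j < T [::])%N ->
     forall s : 'I_q, hf p.1 p.2 (shift T j) s = h1 p.1 p.2 (shift T j) s}.

Definition istep {R : realType} (a b : R * R) : bool :=
  ((a.1 <= b.1) && (a.2 == b.2)) || ((a.1 == b.1) && (a.2 <= b.2)).
Definition ipath {R : realType} (p0 : R * R) (ps : seq (R * R)) : bool := path istep p0 ps.
Definition seg {R : realType} (a b : R * R) (s : R) : R * R :=
  (a.1 + s * (b.1 - a.1), a.2 + s * (b.2 - a.2)).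
Definition segs {R : realType} (p0 : R * R) (ps : seq (R * R)) : seq ((R * R) * (R * R)) :=
  zip (p0 :: ps) ps.
Definition path_in {R : realType} (S : R * R -> Prop) (p0 : R * R) (ps : seq (R * R)) : Prop :=
  S p0 /\ forall ab, ab \in segs p0 ps -> forall s : R, 0 <= s <= 1 -> S (seg ab.1 ab.2 s).

(* h (as a function of (beta,B)) is mu^up-a.s. continuous in the interpolation parameter *)
Definition cont_along {R : realType} (q : nat) (mu : probability ptree_mt R)
  (h : R -> R -> ptree -> 'I_q -> R) (p0 : R * R) (ps : seq (R * R)) : Prop :=
  forall ab, ab \in segs p0 ps ->
  {ae mu, forall T : ptree_mt, forall j, (j < T [::])%N -> forall c : 'I_q,
     {within [set s : R | 0 <= s <= 1],
        continuous (fun s => h (seg ab.1 ab.2 s).1 (seg ab.1 ab.2 s).2 (shift T j) c)}}.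

Definition uniformly_sparse {R : realType} (P : forall n, graphn n -> R) : Prop :=
  (fun L : nat => limn_esup (fun n : nat =>
     (@En R P n (fun G v => (deg G v)%:R * ((L <= deg G v)%N)%:R))%:E)) @ \oo --> 0%E.

Definition ball_conv {R : realType} (P : forall n, graphn n -> R) (mu : probability ptree_mt R)
  : Prop :=
  forall (t : nat) (H : ptree),
    (fun n => (@En R P n (fun G v =>
        (`[< rooted_iso (fun x => x \in gball G v t) (fun x y => (x, y) \in G) v
               (tball H t) tadj [::] >] )%:R))%:E) @ \oo -->
    mu [set T : ptree_mt | rooted_iso (tball T t) tadj [::] (tball H t) tadj [::]].

Definition lwc {R : realType} (P : forall n, graphn n -> R) (mu : probability ptree_mt R) : Prop :=
  uniformly_sparse P /\ ball_conv P mu /\ (mu [set T : ptree_mt | T [::] = 0%N] < 1)%E.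

(* Main.v *)
Require Import Defs.
From HB Require Import structures.
From mathcomp Require Import all_boot all_order all_algebra.
From mathcomp Require Import all_classical all_reals all_analysis.
From mathcomp Require Import ring lra.
From mathcomp Require all_fingroup.

(** All colours but the first play symmetric roles, so a message is determined by the mass [a] it gives to the first
    colour and belief propagation becomes a monotone scalar recursion; its iterates from the uniform and from the pinned
    boundary condition converge monotonically to h^f and h^1. Each Potts factor e^(beta delta) is 1 plus a nonnegative
    multiple of the indicator of a subgroup of (Z/q)^V, and Griffiths' inequality for such weights traps the one- and
    two-point Gibbs marginals of a finite graph between those of the free and the pinned tree ball around a vertex.
    Hence, along a step increasing beta and B, the increment of phi_n is asymptotically at least the slope computed from
    h^f at the beginning of the step and at most the slope computed from h^1 at its end.

    The Bethe functional obeys the same one-sided bounds up to errors of second order in the step: an update towards the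
    fixed point increases it (the edge term is supermodular in its two messages), while its explicit derivative in the
    parameters at fixed messages is the slope. Summing over a fine grid of an interpolation path, the lower bound for
    phi_n meets the upper bound for Phi when h^f is almost surely continuous along the path, and symmetrically for h^1.
    When h^f = h^1 the lower and upper sums telescope to within O(1/N) of each other, so closeness of phi_n and Phi
    propagates along the path. It is started at beta = 0, where everything is explicit, or at a large field B, where both
    quantities are B + beta E[D]/2 up to O(e^(-B)) uniformly in beta; on the ray beta -> oo a column of large beta
    joins the ray to the region of large B, because there the two messages differ little. *)
Set Implicit Arguments. Unset Strict Implicit. Unset Printing Implicit Defensive.
Import Order.TTheory GRing.Theory Num.Theory.
Import numFieldNormedType.Exports.
Local Open Scope classical_set_scope.
Local Open Scope ring_scope.
Local Notation shift := Defs.shift.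

(** The messages are not known to be differentiable in the parameters, so nothing is differentiated:
    every estimate is a finite-increment inequality that comes from Jensen's inequality or from
    monotonicity, and the price is an error of second order per step. Errors quadratic in the
    parameter step vanish on a fine grid. Errors that are products of two message jumps are handled
    by monotonicity: the jumps along a path sum to at most 1, so the products sum to at most the
    largest jump, which continuity makes small. Because of the factor 1/2 in front of the edge term,
    the gain from a message update holds only on average: the roles of root and child must be
    exchangeable. This is unimodularity, obtained here for the functions that occur by double
    counting edges in the finite graphs. It is applied to messages after finitely many updates,
    which read a bounded ball, and then passed to the limit by domination by the root degree. A
    boolean [up] (true for free, false for pinned) reverses every order, so that h^f along
    increasing parameters and h^1 along decreasing ones share one proof. *)

Module GroupInequality.
Local Close Scope classical_set_scope.
Import all_fingroup GroupScope.
Local Open Scope ring_scope.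

(** * A Griffiths inequality for products of subgroup factors on a finite abelian group *)

Section GroupGriffiths.
Variables (R : realFieldType) (gT : finGroupType).
Hypothesis gTab : abelian [set: gT].
Implicit Types (H K L : {group gT}) (fs : seq ({group gT} * R)).

Definition gweight fs (s : gT) : R := \prod_(f <- fs) (1 + f.2 * (s \in f.1)%:R).
Definition gsum fs (A : {set gT}) : R := \sum_(s in A) gweight fs s.

Lemma gsum_cons f fs (A : {set gT}) :
  gsum (f :: fs) A = gsum fs A + f.2 * gsum fs (A :&: f.1).
Proof.
rewrite /gsum; under [X in _ * X]eq_bigl do rewrite finset.in_setI.
rewrite [X in _ * X]big_mkcondr mulr_sumr -big_split /=; apply: eq_bigr => s _.
rewrite /gweight big_cons mulrDl mul1r; case: (s \in f.1); first by rewrite mulr1.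
by rewrite !mulr0 mul0r addr0.
Qed.

Lemma gweight_ge0 fs s : all (fun f => 0 <= f.2) fs -> 0 <= gweight fs s.
Proof.
rewrite /gweight => /allP w0; rewrite big_seq_cond; apply: prodr_ge0 => f.
by rewrite andbT => /w0 f0; rewrite addr_ge0 // mulr_ge0.
Qed.

Lemma gsum_mono fs (A B : {set gT}) : all (fun f => 0 <= f.2) fs -> A \subset B ->
  gsum fs A <= gsum fs B.
Proof.
move=> w0 AB; rewrite /gsum [leRHS](big_setID A) /= (finset.setIidPr AB) lerDl.
by apply: sumr_ge0 => s _; apply: gweight_ge0.
Qed.

Lemma gsum_ge0 fs (A : {set gT}) : all (fun f => 0 <= f.2) fs -> 0 <= gsum fs A.
Proof. by move=> w0; apply: sumr_ge0 => s _; apply: gweight_ge0. Qed.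

(** Expanding [(c - a) * (c - b) >= 0] gives [c * (a + b) <= c * c + a * b <= c * (c + d)], and [c]
    can be divided out; if [c] is 0, so are [a] and [b]. *)
Lemma add_le_of_mul (a b c d : R) : 0 <= c -> 0 <= d -> a <= c -> b <= c ->
  0 <= a -> 0 <= b -> a * b <= c * d -> a + b <= c + d.
Proof.
move=> c0 d0 ac bc a0 b0 abcd; have [c0'|c0'] := ltrP 0 c; last first.
  by lra.
have : 0 <= (c - a) * (c - b) by rewrite mulr_ge0 // subr_ge0.
have -> : (c - a) * (c - b) = c * c + a * b - (c * a + c * b) by ring.
by rewrite subr_ge0 => h; rewrite -(ler_pM2l c0') !mulrDr (le_trans h) // lerD2l.
Qed.

Lemma joingC_mul H K : H <*> K = (H * K)%g.
Proof. by apply: cent_joinEr; apply: sub_abelian_cent2 gTab (finset.subsetT _) (finset.subsetT _). Qed.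

(** Log-supermodularity on the lattice of subgroups, by induction on the factors. Without factors it
    is the product formula for [#|H| * #|K|], commutativity making the product set equal to the
    join. Splitting off a factor of strength [w] gives an inequality between quadratic polynomials
    in [w], proved coefficient by coefficient. *)
Lemma gsum_lattice fs H K : all (fun f => 0 <= f.2) fs ->
  gsum fs H * gsum fs K <= gsum fs (H :&: K) * gsum fs (H <*> K).
Proof.
elim: fs H K => [|f fs IH] H K /=.
  move=> _; rewrite joingC_mul /gsum /gweight.
  under eq_bigr do rewrite big_nil.
  under [X in _ * X <= _]eq_bigr do rewrite big_nil.
  under [X in _ <= X * _]eq_bigr do rewrite big_nil.
  under [X in _ <= _ * X]eq_bigr do rewrite big_nil.
  by rewrite !sumr_const -!natrM ler_nat mul_cardG mulnC.
move=> /andP[w0 ws]; rewrite !gsum_cons; set w := f.2 in w0 *.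
set L := f.1.
have IH' (A B : {group gT}) (C D : {set gT}) : A :&: B \subset C -> A <*> B \subset D ->
   gsum fs A * gsum fs B <= gsum fs C * gsum fs D.
  move=> sC sD; apply: le_trans (IH A B ws) _; apply: ler_pM; rewrite ?gsum_ge0 //;
  exact: gsum_mono.
set FH := gsum fs H; set FK := gsum fs K; set FHL := gsum fs (H :&: L).
set FKL := gsum fs (K :&: L); set a1 := gsum fs (H :&: K).
set a2 := gsum fs (H <*> K); set a3 := gsum fs (H :&: K :&: L).
set a4 := gsum fs ((H <*> K) :&: L).
have E1 : FH * FK <= a1 * a2 by apply: IH.
have E2 : FHL * FKL <= a3 * a4.
  apply: (IH' (H :&: L)%G (K :&: L)%G (H :&: K :&: L)%G ((H <*> K) :&: L)%G).
    by rewrite /= finset.setIACA finset.setIid.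
  rewrite /= join_subG !finset.subsetI !finset.subsetIr !andbT.
  by rewrite (fintype.subset_trans (finset.subsetIl _ _) (joing_subl _ _)) // 
     (fintype.subset_trans (finset.subsetIl _ _) (joing_subr _ _)).
have E3 : FH * FKL <= a3 * a2.
  apply: (IH' H (K :&: L)%G (H :&: K :&: L)%G (H <*> K)%G); first by rewrite /= finset.setIA.
  by rewrite /= join_subG joing_subl (fintype.subset_trans (finset.subsetIl _ _) (joing_subr _ _)).
have E4 : FHL * FK <= a3 * a2.
  apply: (IH' (H :&: L)%G K (H :&: K :&: L)%G (H <*> K)%G); first by rewrite /= finset.setIAC.
  by rewrite /= join_subG joing_subr (fintype.subset_trans (finset.subsetIl _ _) (joing_subl _ _)).
have P (A : {set gT}) : 0 <= gsum fs A by apply: gsum_ge0.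
(* The coefficient of [w]: by [E3] and [E4] each summand on the left is at most [a3 * a2], and by
   [E1] and [E2] their product is at most the product of the summands on the right. *)
have E5 : FH * FKL + FHL * FK <= a3 * a2 + a1 * a4.
  apply: add_le_of_mul; rewrite ?mulr_ge0 ?P //.
  rewrite [leLHS](_ : _ = (FH * FK) * (FHL * FKL)); last by ring.
  rewrite [leRHS](_ : _ = (a1 * a2) * (a3 * a4)); last by ring.
  by apply: ler_pM; rewrite ?mulr_ge0 ?P.
have E6 : w * (FH * FKL + FHL * FK) <= w * (a3 * a2 + a1 * a4) by apply: ler_wpM2l.
have E7 : w * w * (FHL * FKL) <= w * w * (a3 * a4) by apply: ler_wpM2l => //; apply: mulr_ge0.
lra.
Qed.

Lemma gsum_perm fs fs' A : perm_eq fs fs' -> gsum fs A = gsum fs' A.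
Proof. by move=> p; apply: eq_bigr => s _; apply: perm_big. Qed.

Lemma gsum_gt0 fs (A : {group gT}) : all (fun f => 0 <= f.2) fs -> 0 < gsum fs A.
Proof.
move=> w0; rewrite /gsum (bigD1 1%g) //= ltr_pwDl //; last first.
  by apply: sumr_ge0 => s _; apply: gweight_ge0.
rewrite /gweight big_seq_cond; apply: prodr_gt0 => f; rewrite andbT => /(allP w0) f0.
by rewrite ltr_pwDl // mulr_ge0.
Qed.

(* Conditioning on, or adding a ferromagnetic factor for, a subgroup [L] raises the probability of every subgroup [H]. *)
Lemma griffiths_cond fs H L : all (fun f => 0 <= f.2) fs ->
  gsum fs H / gsum fs [set: gT] <= gsum fs (H :&: L) / gsum fs L.
Proof.
move=> w0; have T0 : 0 < gsum fs [set: gT] by exact: (gsum_gt0 [set: gT]%G w0).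
rewrite ler_pdivrMr // mulrAC ler_pdivlMr ?gsum_gt0 //.
apply: le_trans (gsum_lattice H L w0) _; apply: ler_wpM2l; first exact: gsum_ge0.
by apply: gsum_mono => //; apply: subsetT.
Qed.

(** After a factor on [g.1] is added, the probability is a weighted mean of the old one and of the
    one conditioned on [g.1], and [griffiths_cond] says that the second is the larger. *)
Lemma griffiths_cat fs gs H : all (fun f => 0 <= f.2) fs -> all (fun f => 0 <= f.2) gs ->
  gsum fs H / gsum fs [set: gT] <= gsum (gs ++ fs) H / gsum (gs ++ fs) [set: gT].
Proof.
move=> w0; elim: gs => //= g gs IH /andP[g0 gs0].
have ws : all (fun f => 0 <= f.2) (gs ++ fs) by rewrite all_cat gs0 w0.
apply: le_trans (IH gs0) _; rewrite !gsum_cons finset.setTI.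
have T0 : 0 < gsum (gs ++ fs) [set: gT] by exact: (gsum_gt0 [set: gT]%G ws).
have L0 := gsum_gt0 g.1 ws.
rewrite ler_pdivrMr // mulrAC ler_pdivlMr; last by rewrite ltr_pwDl // mulr_ge0 // ltW.
rewrite mulrDr mulrDl lerD2l mulrCA -mulrA ler_wpM2l //.
have := griffiths_cond H g.1 ws.
by rewrite ler_pdivrMr // mulrAC ler_pdivlMr.
Qed.

End GroupGriffiths.

End GroupInequality.
Import GroupInequality.

(** * Uniform averages over colourings and independence of disjoint sets of vertices *)

Section Average.
Variables (R : realType) (V X : finType).
Hypothesis X0 : (0 < #|X|)%N.
Implicit Types (g h : {ffun V -> X} -> R) (A B : pred V).

Definition avg g : R := ((#|X| ^ #|V|)%:R)^-1 * \sum_(sigma : {ffun V -> X}) g sigma.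
Definition depends_on A g := forall sigma tau : {ffun V -> X},
  (forall v, A v -> sigma v = tau v) -> g sigma = g tau.

Lemma cardXV_neq0 : ((#|X| ^ #|V|)%:R : R) != 0.
Proof. by rewrite pnatr_eq0 -lt0n expn_gt0 X0. Qed.

Lemma eq_avg g h : g =1 h -> avg g = avg h.
Proof. by move=> gh; rewrite /avg; congr (_ * _); apply: eq_bigr => s _. Qed.

(** Exchanging, between two independent colourings, the colours outside [A] is an involution of the
    pairs. After it both [g] and [h] read the first colouring only, and the double sum collapses. *)
Lemma avgM_indep A B g h : (forall v, A v -> B v -> False) ->
  depends_on A g -> depends_on B h -> avg (fun s => g s * h s) = avg g * avg h.
Proof.
move=> AB dg dh.
pose sw (p : {ffun V -> X} * {ffun V -> X}) :=
  ([ffun v => if A v then p.1 v else p.2 v], [ffun v => if A v then p.2 v else p.1 v]).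
have swK : involutive sw.
  by case=> s t; congr pair; apply/ffunP => v; rewrite !ffunE /= ?ffunE; case: (A v).
suff E : (\sum_s g s) * (\sum_s h s) = (#|X| ^ #|V|)%:R * \sum_s g s * h s.
  by rewrite /avg mulrACA E -[RHS]mulrA mulKf ?cardXV_neq0.
rewrite big_distrlr /= pair_big /= (reindex_inj (inv_inj swK)) /=.
under eq_bigr => p _.
  rewrite (dg _ p.1); last by move=> v Av; rewrite ffunE Av.
  rewrite (dh _ p.1); last by move=> v Bv; rewrite ffunE; case: ifP => // /AB /(_ Bv).
  over.
rewrite -(pair_big xpredT xpredT (fun s (_ : {ffun V -> X}) => g s * h s)) /=.
under eq_bigr do rewrite sumr_const.
by rewrite sumrMnl card_ffun mulr_natl.
Qed.

Lemma avg_prod_indep (I : eqType) (r : seq I) (A : I -> pred V)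
    (g : I -> {ffun V -> X} -> R) : uniq r ->
  (forall i j v, i \in r -> j \in r -> A i v -> A j v -> i = j) ->
  (forall i, i \in r -> depends_on (A i) (g i)) ->
  avg (fun s => \prod_(i <- r) g i s) = \prod_(i <- r) avg (g i).
Proof.
elim: r => [|i r IH] /=.
  move=> _ _ _; rewrite /avg big_nil; under eq_bigr do rewrite big_nil.
  by rewrite sumr_const card_ffun mulVf // cardXV_neq0.
move=> /andP[ir ur] dA dg; rewrite big_cons.
rewrite (eq_avg (h := fun s => g i s * \prod_(j <- r) g j s)) => [|s]; last by rewrite big_cons.
rewrite (@avgM_indep (A i) (fun v => has (fun j => A j v) r)).
- rewrite IH // => [j k v jr kr|j jr].
    by apply: dA; rewrite inE ?jr ?kr orbT.
  by apply: dg; rewrite inE jr orbT.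
- move=> v Ai /hasP[j jr Aj]; move: ir; rewrite (dA i j v) ?jr //.
    by rewrite inE eqxx.
  by rewrite inE jr orbT.
- by apply: dg; rewrite inE eqxx.
- move=> s t st; rewrite big_seq [RHS]big_seq; apply: eq_bigr => j jr.
  apply: dg; first by rewrite inE jr orbT.
  by move=> v Aj; apply: st; apply/hasP; exists j.
Qed.

Lemma avg_ind (v : V) (s : X) : avg (fun sigma => (sigma v == s)%:R) = (#|X|%:R)^-1.
Proof.
rewrite /avg.
have -> : \sum_(sigma : {ffun V -> X}) (sigma v == s)%:R =
   \sum_(sigma : {ffun V -> X}) \prod_u (if u == v then (sigma u == s)%:R else 1 : R).
  by apply: eq_bigr => sigma _; rewrite -big_mkcond /= big_pred1_eq.
rewrite -(bigA_distr_bigA (fun u x => if u == v then (x == s)%:R else 1 : R)) /=.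
rewrite (bigD1 v) //= eqxx.
have -> : \sum_x (x == s)%:R = 1 :> R.
  by rewrite (bigD1 s) //= eqxx big1 ?addr0 // => x /negPf ->.
rewrite mul1r; under eq_bigr => u /negPf -> do rewrite sumr_const.
rewrite prodr_const cardC1 -natrX.
have V0 : (0 < #|V|)%N by apply/card_gt0P; exists v.
rewrite -[X in (X)^-1](_ : (#|X| * #|X| ^ #|V|.-1)%:R = _); last by rewrite -expnS prednK.
by rewrite natrM invfM -mulrA mulVf ?mulr1 // natrX expf_neq0 // pnatr_eq0 -lt0n.
Qed.

Lemma avg_sum (I : Type) (r : seq I) (g : I -> {ffun V -> X} -> R) :
  avg (fun s => \sum_(i <- r) g i s) = \sum_(i <- r) avg (g i).
Proof. by rewrite /avg exchange_big /= mulr_sumr. Qed.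

Lemma avgZ c g : avg (fun s => c * g s) = c * avg g.
Proof. by rewrite /avg -mulr_sumr mulrCA. Qed.

Lemma avg_star (I : eqType) (r : seq I) (v : V) (s : X) (A : I -> pred V)
    (g : I -> {ffun V -> X} -> R) : uniq r ->
  (forall i j u, i \in r -> j \in r -> A i u -> A j u -> i = j) ->
  (forall i, i \in r -> ~~ A i v) ->
  (forall i, i \in r -> depends_on (A i) (g i)) ->
  avg (fun sigma => (sigma v == s)%:R * \prod_(i <- r) g i sigma) =
    (#|X|%:R)^-1 * \prod_(i <- r) avg (g i).
Proof.
move=> ur dA vA dg.
rewrite (@avgM_indep (pred1 v) (fun u => has (fun j => A j u) r)).
- by rewrite avg_ind (@avg_prod_indep _ r A).
- by move=> u /eqP -> /hasP[j jr Aj]; move: (vA j jr); rewrite Aj.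
- by move=> x y xy; rewrite (xy v) //= eqxx.
- move=> x y xy; rewrite big_seq [RHS]big_seq; apply: eq_bigr => j jr.
  by apply: dg => // u Aj; apply: xy; apply/hasP; exists j.
Qed.
End Average.

(** * Vertex lists of finite tree balls *)

Lemma mem_tlist T t u : (u \in tlist T t) = tball T t u.
Proof.
elim: t T u => [|t IH] T [|i u] //=.
  rewrite /tball /= inE; symmetry; rewrite andbC; case: (size u) => //.
rewrite inE /=; apply/flattenP/idP => [[s /mapP[j]]|].
  rewrite mem_iota /= add0n => jT -> /mapP[w]; rewrite IH /tball => /andP[vw sw] [-> ->].
  by rewrite /= jT vw.
rewrite /tball /= => /andP[/andP[iT vu] su].
exists [seq i :: w | w <- tlist (shift T i) t].
  by apply/mapP; exists i => //; rewrite mem_iota add0n.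
by apply/mapP; exists u => //; rewrite IH /tball vu.
Qed.

Lemma tlist_nil T t : [::] \in tlist T t.
Proof. by rewrite mem_tlist. Qed.

Lemma big_tlistS (R : Type) (idx : R) (op : Monoid.com_law idx) T t
    (P : pred (seq nat)) (F : seq nat -> R) :
  \big[op/idx]_(u <- tlist T t.+1 | P u) F u =
  op (if P [::] then F [::] else idx)
    (\big[op/idx]_(i <- iota 0 (T [::]))
      \big[op/idx]_(u <- tlist (shift T i) t | P (i :: u)) F (i :: u)).
Proof.
rewrite /= big_cons big_flatten big_map.
under eq_bigr do rewrite big_map.
by case: (P [::]) => //; rewrite Monoid.mul1m.
Qed.

Lemma uniq_tlist T t : uniq (tlist T t).
Proof.
elim: t T => //= t IH T; apply/andP; split.
  by apply/flattenP => -[s /mapP[j _ ->]] /mapP[].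
move: (iota_uniq 0 (T [::])); elim: (iota 0 (T [::])) => //= i r IHr /andP[ir ur].
rewrite cat_uniq IHr // andbT map_inj_uniq ?IH; last by move=> x y [].
apply/hasPn => u /flattenP[s /mapP[j jr ->] /mapP[w _ ->]].
apply/mapP => -[w' _ [ij _]]; move: ir; by rewrite -ij jr.
Qed.

Lemma parent_cons i u : parent (i :: u) = if u is [::] then [::] else i :: parent u.
Proof. by case: u. Qed.

Lemma is_childE u w : is_child u w = (w != [::]) && (u == parent w).
Proof.
rewrite /is_child /parent; case: w => [|x w] //; rewrite eqSS /=.
apply/andP/eqP => [[/eqP sw /eqP tw]|->]; first by rewrite -[LHS]tw -sw.
by rewrite size_take /= ltnSn !eqxx.
Qed.

Lemma tball_parent T t u : tball T t u -> tball T t (parent u).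
Proof.
move=> /andP[vu su]; apply/andP; split.
  elim: u T vu {su} => [|i u IH] T //=; rewrite parent_cons => /andP[iT vu].
  by case: u IH vu => //= j u IH vu; rewrite iT; apply: IH vu.
by rewrite /parent size_take; case: ifP => _; apply: leq_trans su; rewrite ?leq_pred.
Qed.

(** * Potts weights on tree balls and their root recursion *)

Section TreeWeights.
Variables (R : realType) (q : nat) (beta B : R).
Local Notation X := 'I_q.+2.
Implicit Types (c : seq nat -> X) (T : ptree) (pin : bool).

Definition leafw pin (s : X) : R := psib B s * (pin ==> (s == ord0))%:R.

(* [pin] forces colour [0] at depth [t]. *)
Fixpoint wt pin t T c : R :=
  if t is t'.+1 then
    psib B (c [::]) * \prod_(k <- iota 0 (T [::]))
      (psi beta (c [::]) (c [:: k]) * wt pin t' (shift T k) (fun u => c (k :: u)))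
  else leafw pin (c [::]).

(** This recursion computes the uniform average of [wt] over colourings with root colour [s]
    ([avg_wt]); each [q.+2%:R^-1] is the a priori probability of the colour of one vertex. *)
Fixpoint zn pin t T (s : X) : R :=
  if t is t'.+1 then
    psib B s * (q.+2%:R^-1 * \prod_(k <- iota 0 (T [::]))
      \sum_(s' : X) psi beta s s' * zn pin t' (shift T k) s')
  else leafw pin s * q.+2%:R^-1.

Definition tree_weight t T c : R :=
  (\prod_(u <- tlist T t) psib B (c u)) *
  \prod_(u <- tlist T t | u != [::]) psi beta (c (parent u)) (c u).

Lemma wtE pin t T c : wt pin t T c =
  tree_weight t T c * \prod_(u <- tlist T t | size u == t) (pin ==> (c u == ord0))%:R.
Proof.
elim: t T c => [|t IH] T c.
  by rewrite /tree_weight /= /leafw !big_cons !big_nil /= !mulr1.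
rewrite [LHS]/= /tree_weight !big_tlistS /= !mul1r.
rewrite -!mulrA; congr (_ * _); rewrite -!big_split /=; apply: eq_bigr => i _.
rewrite IH /tree_weight.
rewrite [X in _ = _ * (X * _)](bigD1_seq [::]) ?tlist_nil ?uniq_tlist //= parent_cons.
rewrite [X in _ = _ * (_ * X * _)](eq_bigr (fun u => psi beta (c (i :: parent u)) (c (i :: u)))).
  by ring.
by case.
Qed.

Lemma eq_wt pin t T c c' : (forall u, tball T t u -> c u = c' u) ->
  wt pin t T c = wt pin t T c'.
Proof.
elim: t T c c' => [|t IH] T c c' cc' /=; first by rewrite cc'.
rewrite (cc' [::]) //; congr (_ * _); rewrite big_seq [RHS]big_seq.
apply: eq_bigr => k; rewrite mem_iota add0n /= => kT.
rewrite (cc' [:: k]); last by rewrite /tball /= kT.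
congr (_ * _); apply: IH => u /andP[vu su]; apply: cc'.
by rewrite /tball /= kT vu.
Qed.

Section Embedded.
Variables (V : finType) (f : seq nat -> V).

Lemma wt_depends pin t T (g : seq nat -> V) :
  depends_on (fun v => v \in [seq g u | u <- tlist T t])
    (fun sigma : {ffun V -> X} => wt pin t T (fun u => sigma (g u))).
Proof.
move=> s s' ss'; apply: eq_wt => u; rewrite -mem_tlist => ul.
by apply: ss'; apply/map_f.
Qed.
End Embedded.

Lemma avg_root_star (V : finType) (f : seq nat -> V) t T (s : X)
   (g : nat -> {ffun V -> X} -> R) : {in tball T t.+1 &, injective f} ->
  (forall k, (k < T [::])%N -> depends_on
     (fun v => v \in [seq f (k :: u) | u <- tlist (shift T k) t]) (g k)) ->
  avg (fun sigma => (sigma (f [::]) == s)%:R * \prod_(k <- iota 0 (T [::])) g k sigma) =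
  q.+2%:R^-1 * \prod_(k <- iota 0 (T [::])) avg (g k).
Proof.
move=> finj dg.
have mem k u : k \in iota 0 (T [::]) -> u \in tlist (shift T k) t -> tball T t.+1 (k :: u).
  rewrite mem_iota add0n mem_tlist => /= kT /andP[vu su].
  by rewrite /tball /= kT vu.
rewrite (@avg_star R V _ _ _ _ _ _
    (fun k v => v \in [seq f (k :: u) | u <- tlist (shift T k) t])) ?card_ord ?iota_uniq //.
- move=> i j v iT jT /mapP[u ul ->] /mapP[w wl] /finj.
  by move=> /(_ (mem _ _ iT ul) (mem _ _ jT wl)) [].
- move=> i iT; apply/mapP => -[u ul] /finj.
  by move=> /(_ _ (mem _ _ iT ul)); rewrite unfold_in /= => /(_ isT).
- by move=> i; rewrite mem_iota add0n /= => /dg.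
Qed.

Lemma avg_wt (V : finType) (f : seq nat -> V) pin t T (s : X) :
  {in tball T t &, injective f} ->
  avg (fun sigma : {ffun V -> X} =>
    (sigma (f [::]) == s)%:R * wt pin t T (fun u => sigma (f u))) = zn pin t T s.
Proof.
elim: t T f s => [|t IH] T f s finj /=.
  rewrite (eq_avg (h := fun sigma => leafw pin s * (sigma (f [::]) == s)%:R)).
    by rewrite avgZ avg_ind ?card_ord.
  by move=> sigma; case: eqP => [->|]; rewrite ?mul0r ?mulr0 // mulrC.
rewrite (eq_avg (h := fun sigma => psib B s * ((sigma (f [::]) == s)%:R *
   \prod_(k <- iota 0 (T [::])) \sum_(s' : X) psi beta s s' *
     ((sigma (f [:: k]) == s')%:R * wt pin t (shift T k) (fun u => sigma (f (k :: u))))))).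
  rewrite avgZ (@avg_root_star V f t T s
     (fun k sigma => \sum_(s' : X) psi beta s s' *
     ((sigma (f [:: k]) == s')%:R * wt pin t (shift T k) (fun u => sigma (f (k :: u)))))) //.
    congr (_ * (_ * _)); rewrite big_seq [RHS]big_seq; apply: eq_bigr => k.
    rewrite mem_iota add0n /= => kT; rewrite avg_sum; apply: eq_bigr => s' _.
    rewrite avgZ (IH (shift T k) (fun u => f (k :: u))) // => u w /andP[vu su] /andP[vw sw].
    by move=> /finj E; have [] : k :: u = k :: w by apply: E; rewrite unfold_in /tball /= kT ?vu ?vw.
  move=> k kT x y xy; apply: eq_bigr => s' _.
  rewrite (xy (f [:: k])); last by apply/mapP; exists [::] => //; apply: tlist_nil.
  congr (_ * (_ * _)); exact: (@wt_depends V pin t (shift T k) (fun u => f (k :: u))).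
move=> sigma /=; case: eqP => [->|]; last by rewrite !(mul0r, mulr0).
rewrite !mul1r; congr (_ * _); apply: eq_bigr => k _.
rewrite (bigD1 (sigma (f [:: k]))) //= eqxx mul1r big1 ?addr0 // => s' /negPf.
by rewrite eq_sym => ->; rewrite mul0r mulr0.
Qed.

(** As for the root colour, except that the colour of child [j] is restricted to that of the root;
    below [j] the recursion is unchanged. *)
Lemma avg_wt_edge (V : finType) (f : seq nat -> V) pin t T (j : nat) :
  {in tball T t.+1 &, injective f} -> (j < T [::])%N ->
  avg (fun sigma : {ffun V -> X} =>
    (sigma (f [::]) == sigma (f [:: j]))%:R * wt pin t.+1 T (fun u => sigma (f u))) =
  \sum_(s : X) psib B s * (q.+2%:R^-1 * \prod_(k <- iota 0 (T [::]))
      \sum_(s' : X | (k == j) ==> (s' == s)) psi beta s s' * zn pin t (shift T k) s').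
Proof.
move=> finj jT.
rewrite (eq_avg (h := fun sigma => \sum_(s : X) psib B s * ((sigma (f [::]) == s)%:R *
   \prod_(k <- iota 0 (T [::])) \sum_(s' : X | (k == j) ==> (s' == s)) psi beta s s' *
     ((sigma (f [:: k]) == s')%:R * wt pin t (shift T k) (fun u => sigma (f (k :: u))))))).
  rewrite avg_sum; apply: eq_bigr => s _.
  rewrite avgZ (@avg_root_star V f t T s
     (fun k sigma => \sum_(s' : X | (k == j) ==> (s' == s)) psi beta s s' *
     ((sigma (f [:: k]) == s')%:R * wt pin t (shift T k) (fun u => sigma (f (k :: u)))))) //.
    congr (_ * (_ * _)); rewrite big_seq [RHS]big_seq; apply: eq_bigr => k.
    rewrite mem_iota add0n /= => kT.
    rewrite /avg exchange_big /= mulr_sumr; apply: eq_bigr => s' _.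
    rewrite -/(avg _) avgZ (@avg_wt V (fun u => f (k :: u))) // => u w /andP[vu su] /andP[vw sw].
    by move=> /finj E; have [] : k :: u = k :: w by apply: E; rewrite unfold_in /tball /= kT ?vu ?vw.
  move=> k kT x y xy; apply: eq_bigr => s' _.
  rewrite (xy (f [:: k])); last by apply/mapP; exists [::] => //; apply: tlist_nil.
  congr (_ * (_ * _)); exact: (@wt_depends V pin t (shift T k) (fun u => f (k :: u))).
move=> sigma /=; rewrite [RHS](bigD1 (sigma (f [::]))) //= eqxx mul1r [X in _ + X]big1 ?addr0; last first.
  by move=> s /negPf; rewrite eq_sym => ->; rewrite mul0r mulr0.
rewrite mulrCA; congr (_ * _).
have jI : j \in iota 0 (T [::]) by rewrite mem_iota add0n.
rewrite [RHS](bigD1_seq j) ?iota_uniq //= eqxx /=.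
rewrite [X in _ * X](bigD1_seq j) ?iota_uniq //= big_pred1_eq.
rewrite mulrA; congr (_ * _).
  rewrite eq_sym; case: eqP => [->|_]; rewrite !(mul0r, mul1r) ?mulr0 //.
apply: eq_bigr => k /negPf -> /=.
rewrite (bigD1 (sigma (f [:: k]))) //= eqxx mul1r big1 ?addr0 // => s' /negPf.
by rewrite eq_sym => ->; rewrite mul0r mulr0.
Qed.

(** Each non-root vertex is the second member of exactly one parent-child pair, so the product over
    pairs becomes a product over non-root vertices; [insubd k0] turns a vertex into its position in
    the list. *)
Lemma tweightE t T (k0 : 'I_(size (tlist T t))) (sigma : {ffun 'I_(size (tlist T t)) -> X}) :
  tweight beta B sigma =
  tree_weight t T (fun u => sigma (insubd k0 (index u (tlist T t)))).
Proof.
set L := tlist T t; set c := (fun u => _).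
have cE (k : 'I_(size L)) : c (nth [::] L k) = sigma k.
  by rewrite /c index_uniq ?uniq_tlist // valKd.
have bigL (P : pred (seq nat)) (F : seq nat -> R) :
    \prod_(u <- L | P u) F u = \prod_(k < size L | P (nth [::] L k)) F (nth [::] L k).
  by rewrite (big_nth [::]) big_mkord.
rewrite /tweight /tree_weight -/L mulrC !bigL; congr (_ * _).
  by apply: eq_bigr => k _; rewrite cE.
rewrite -(pair_big_dep xpredT (fun i j : 'I_(size L) => is_child (nth [::] L i) (nth [::] L j))
   (fun i j : 'I_(size L) => psi beta (sigma i) (sigma j))) /= (exchange_big_dep xpredT) //=.
rewrite [RHS]big_mkcond; apply: eq_bigr => k _.
under eq_bigl do rewrite is_childE.
case: eqP => [->|/eqP w0] /=; first by rewrite big_pred0.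
have pL : parent (nth [::] L k) \in L.
  by rewrite mem_tlist tball_parent // -mem_tlist mem_nth.
have iL : (index (parent (nth [::] L k)) L < size L)%N by rewrite index_mem.
rewrite (big_pred1 (Ordinal iL)); last first.
  move=> i /=; rewrite -val_eqE /=; apply/eqP/eqP => [<-|->]; last by rewrite nth_index.
  by rewrite index_uniq ?uniq_tlist.
by rewrite -(cE (Ordinal iL)) /= nth_index // cE.
Qed.

(** With the free boundary the pinned depth is [t.+1], where the ball has no vertex, so nothing is
    constrained; with the pinned one it is the last level. Numerator and denominator are averages
    over colourings of the list positions, whose number cancels. *)
Lemma tmargE pin t T d s : (pin -> d = t) -> (~~ pin -> d = t.+1) ->
  tmarg beta B (tlist T t) d s = zn pin t T s / \sum_(s' : X) zn pin t T s'.
Proof.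
move=> pd npd; set L := tlist T t.
have L0 : (0 < size L)%N by rewrite /L; case: t {pd npd L}.
pose k0 : 'I_(size L) := Ordinal L0.
pose f u := insubd k0 (index u L).
have finj : {in tball T t &, injective f}.
  move=> u w uL wL /(congr1 val); rewrite !val_insubd !index_mem !mem_tlist.
  rewrite [tball _ _ _]uL [tball _ _ w]wL; by apply: (@index_inj _ [::] L); rewrite mem_tlist.
have rootE s' (sigma : {ffun 'I_(size L) -> X}) : root_is s' sigma = (sigma (f [::]) == s').
  apply/forallP/eqP => [H|<- k].
    apply/eqP; have /implyP := H (f [::]); apply.
    by rewrite /f val_insubd index_mem tlist_nil nth_index // tlist_nil.
  apply/implyP => /eqP kn; rewrite -kn /f index_uniq ?uniq_tlist // valKd.
  by [].
have pinE (sigma : {ffun 'I_(size L) -> X}) : (pinned d sigma)%:R =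
    \prod_(u <- L | size u == t) (pin ==> (sigma (f u) == ord0))%:R :> R.
  have [pn|] := boolP (pinned d sigma).
    rewrite big_seq_cond big1 // => u /andP[uL /eqP ut].
    case pinT: pin => //=; have := forallP pn (f u).
    rewrite /f val_insubd index_mem uL nth_index // pd // ut eqxx /= => /eqP h.
    by rewrite -val_eqE /= h.
  rewrite negb_forall => /existsP[k]; rewrite negb_imply => /andP[/eqP kd k0'].
  have kL : nth [::] L k \in L by rewrite mem_nth.
  have pT : pin.
    apply/negPn/negP => np; move: kL; rewrite mem_tlist /tball kd (npd np).
    by rewrite ltnn andbF.
  rewrite big_mkcond (bigD1_seq (nth [::] L k)) ?uniq_tlist //= kd pd // eqxx.
  rewrite pT /f index_uniq ?uniq_tlist // valKd /=.
  by rewrite -val_eqE /= (negPf k0') mul0r.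
have sumE s' : \sum_(sigma : {ffun 'I_(size L) -> X} | pinned d sigma && root_is s' sigma)
     tweight beta B sigma = (#|{: X}| ^ #|'I_(size L)|)%:R * zn pin t T s'.
  rewrite -(avg_wt pin s' finj) /avg mulrA mulfV ?mul1r ?cardXV_neq0 ?card_ord //.
  rewrite big_mkcond; apply: eq_bigr => sigma _.
  rewrite wtE (tweightE k0) -/L -(pinE sigma) rootE.
  case: (pinned d sigma); case: (_ == s'); rewrite /= ?mulr1 ?mulr0 ?mul1r ?mul0r //.
have sumT : \sum_(sigma : {ffun 'I_(size L) -> X} | pinned d sigma)
     tweight beta B sigma = (#|{: X}| ^ #|'I_(size L)|)%:R * \sum_s' zn pin t T s'.
  rewrite mulr_sumr; under [RHS]eq_bigr do rewrite -sumE.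
  rewrite (partition_big (fun sigma : {ffun 'I_(size L) -> X} => sigma (f [::])) xpredT) //=.
  by apply: eq_bigr => s' _; apply: eq_bigl => sigma; rewrite rootE.
rewrite /tmarg sumE sumT invfM mulrACA mulfV ?mul1r //.
by apply: (cardXV_neq0 R); rewrite card_ord.
Qed.
End TreeWeights.

(** * One-parameter messages and belief propagation *)

Module MessageAlgebra.

Section Messages.
Variables (R : realType) (q : nat).
Local Notation X := 'I_q.+2.
Local Notation k1 := (q.+1%:R : R).
Implicit Types (b beta B : R) (p : R * R) (T : ptree).

Definition wgt beta : R := expR beta - 1.
Definition bb (a : R) : R := (1 - a) / q.+1%:R.
(* The colour-symmetric probability vector with mass [a] on colour [0]. *)
Definition vecm a (s : X) : R := if s == ord0 then a else bb a.
Definition nn0 beta B (D : nat) (a : nat -> R) := expR B * \prod_(j < D) (1 + wgt beta * a j).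
Definition nn1 beta (D : nat) (a : nat -> R) := \prod_(j < D) (1 + wgt beta * bb (a j)).
Definition zz beta B D a := nn0 beta B D a + k1 * nn1 beta D a.
Definition bp p D a := nn0 p.1 p.2 D a / zz p.1 p.2 D a.
(** Chance that independent samples from two colour-symmetric messages coincide;
    [1 + wgt beta * agree a b] is then the partition function of the edge in the Bethe
    functional. *)
Definition agree a b : R := a * b + k1 * (bb a * bb b).
(** Conditional probability that a child takes the colour of its parent, when its message gives mass
    [a] to that colour. *)
Definition rr beta a : R := (1 + wgt beta) * a / (1 + wgt beta * a).
(** Probability that the ends of an edge agree, [a] being the full marginal of the root and [b] the
    message coming from the child. *)
Definition edgep beta a b : R := a * rr beta b + k1 * (bb a * rr beta (bb b)).

(** The parameters may vary with depth, the head of the list acting at the root. Mixed lists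
    describe updates at one parameter that start from messages computed at another. *)
Fixpoint msg (a0 : R) (l : seq (R * R)) T : R :=
  if l is p :: l' then bp p (T [::]) (fun j => msg a0 l' (shift T j)) else a0.

Lemma k1_gt0 : 0 < k1. Proof. by rewrite ltr0n. Qed.
Lemma k1_neq0 : k1 != 0. Proof. by rewrite lt0r_neq0 // k1_gt0. Qed.

Lemma wgt_ge0 beta : 0 <= beta -> 0 <= wgt beta.
Proof. by move=> b0; rewrite /wgt subr_ge0 -expR0 ler_expR. Qed.

Lemma sum_vecm a : \sum_(s : X) vecm a s = 1.
Proof.
rewrite (bigD1 ord0) //= /vecm eqxx.
rewrite (eq_bigr (fun=> bb a)) => [|s /negPf -> //].
rewrite sumr_const cardC1 card_ord /= -mulr_natr /bb mulfVK ?k1_neq0 //; lra.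
Qed.

Lemma sum_vecm_split (F : R -> R) a b :
  \sum_(s : X) vecm a s * F (vecm b s) = a * F b + k1 * (bb a * F (bb b)).
Proof.
rewrite (bigD1 ord0) //= /vecm eqxx; congr (_ + _).
rewrite (eq_bigr (fun=> bb a * F (bb b))) => [|s /negPf -> //].
by rewrite sumr_const cardC1 card_ord /= mulr_natl.
Qed.

Lemma psiE beta (s s' : X) : psi beta s s' = 1 + wgt beta * (s == s')%:R.
Proof.
rewrite /psi /wgt; case: eqP => _; rewrite ?mulr1 ?mulr0 ?expR0; lra.
Qed.

Lemma psibE B (s : X) : psib B s = if s == ord0 then expR B else 1.
Proof. by rewrite /psib -val_eqE /=; case: eqP => _; rewrite ?mulr1 ?mulr0 ?expR0. Qed.

Lemma sum_psi beta (s : X) (h : X -> R) :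
  \sum_(s' : X) psi beta s s' * h s' = \sum_s' h s' + wgt beta * h s.
Proof.
under eq_bigr do rewrite psiE mulrDl mul1r.
rewrite big_split /=; congr (_ + _); rewrite (bigD1 s) //= eqxx mulr1 big1 ?addr0 //.
by move=> s' /negPf; rewrite eq_sym => ->; rewrite mulr0 mul0r.
Qed.

Lemma sum_psi_vecm beta a (s : X) :
  \sum_(s' : X) psi beta s s' * vecm a s' = 1 + wgt beta * vecm a s.
Proof. by rewrite sum_psi sum_vecm. Qed.

Lemma bb_ge0 a : a <= 1 -> 0 <= bb a.
Proof. by move=> a1; rewrite divr_ge0 ?subr_ge0 // ltW // k1_gt0. Qed.

Lemma bb_sum a : a + k1 * bb a = 1.
Proof. by rewrite /bb mulrC mulfVK ?k1_neq0 //; lra. Qed.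

Lemma fac_gt0 beta a : 0 <= beta -> 0 <= a -> 0 < 1 + wgt beta * a.
Proof. by move=> b0 a0; rewrite ltr_pwDl // mulr_ge0 // wgt_ge0. Qed.

Lemma nn0_gt0 beta B D a : 0 <= beta -> (forall j, (j < D)%N -> 0 <= a j) -> 0 < nn0 beta B D a.
Proof.
move=> b0 a0; rewrite /nn0 mulr_gt0 ?expR_gt0 // prodr_gt0 // => j _.
by rewrite fac_gt0 // a0.
Qed.

Lemma nn1_gt0 beta D a : 0 <= beta -> (forall j, (j < D)%N -> a j <= 1) -> 0 < nn1 beta D a.
Proof.
by move=> b0 a0; rewrite /nn1 prodr_gt0 // => j _; rewrite fac_gt0 // bb_ge0 // a0.
Qed.

Lemma zz_gt0 beta B D a : 0 <= beta -> (forall j, (j < D)%N -> 0 <= a j <= 1) -> 0 < zz beta B D a.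
Proof.
move=> b0 a0; rewrite addr_gt0 ?nn0_gt0 ?mulr_gt0 ?k1_gt0 ?nn1_gt0 // => j /a0 /andP[] //.
Qed.

Lemma bp_itv p D a : 0 <= p.1 -> (forall j, (j < D)%N -> 0 <= a j <= 1) -> 0 <= bp p D a <= 1.
Proof.
move=> b0 a0; have z0 := zz_gt0 p.2 b0 a0.
have n0 : 0 < nn0 p.1 p.2 D a by apply: nn0_gt0 => // j /a0 /andP[].
have n1 : 0 < nn1 p.1 D a by apply: nn1_gt0 => // j /a0 /andP[].
rewrite /bp; apply/andP; split; first by rewrite divr_ge0 // ltW.
by rewrite ler_pdivrMr // mul1r /zz lerDl mulr_ge0 // ltW // k1_gt0.
Qed.

Lemma msg_itv01 a0 l T : 0 <= a0 <= 1 -> all (fun p => 0 <= p.1) l -> 0 <= msg a0 l T <= 1.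
Proof.
move=> a01; elim: l T => //= p l IH T /andP[p0 l0].
by apply: bp_itv => // j _; apply: IH.
Qed.

Lemma bb_bp p D a : 0 <= p.1 -> (forall j, (j < D)%N -> 0 <= a j <= 1) ->
  bb (bp p D a) = nn1 p.1 D a / zz p.1 p.2 D a.
Proof.
move=> b0 a0; have z0 := lt0r_neq0 (zz_gt0 p.2 b0 a0).
apply: (mulfI k1_neq0); rewrite /bb [LHS]mulrC mulfVK ?k1_neq0 // /bp.
apply: (mulIf z0); rewrite mulrBl mulfVK // mul1r -[RHS]mulrA mulfVK // /zz; ring.
Qed.

Lemma vecm_bp p D a s : 0 <= p.1 -> (forall j, (j < D)%N -> 0 <= a j <= 1) ->
  psib p.2 s * \prod_(j < D) (1 + wgt p.1 * vecm (a j) s) =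
  zz p.1 p.2 D a * vecm (bp p D a) s.
Proof.
move=> b0 a0; have z0 := lt0r_neq0 (zz_gt0 p.2 b0 a0).
rewrite psibE /vecm; case: (s == ord0).
  by rewrite /bp [RHS]mulrC mulfVK.
by rewrite bb_bp // mul1r [RHS]mulrC mulfVK.
Qed.

(** A free leaf feels the field alone. That is one update from uniform messages, whose interaction
    factors are the same for all colours and cancel; hence the extra update in the free case. A
    pinned leaf carries the message 1 directly. *)
Definition rootmsg (pin : bool) p t T : R :=
  if pin then msg 1 (nseq t p) T else msg q.+2%:R^-1 (nseq t.+1 p) T.

Lemma q2V_itv : 0 <= (q.+2%:R^-1 : R) <= 1.
Proof. by rewrite invr_ge0 ler0n /= invf_le1 ?ler1n ?ltr0n. Qed.

Lemma rootmsg_itv pin p t T : 0 <= p.1 -> 0 <= rootmsg pin p t T <= 1.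
Proof.
move=> p0; rewrite /rootmsg; case: pin; apply: msg_itv01; rewrite ?ler01 ?lexx ?q2V_itv //.
  by elim: t => //= t ->; rewrite p0.
by rewrite /= p0; elim: t => //= t ->; rewrite p0.
Qed.

Lemma bb_q2V : bb q.+2%:R^-1 = q.+2%:R^-1.
Proof.
apply: (mulfI k1_neq0); rewrite /bb [LHS]mulrC mulfVK ?k1_neq0 //.
have q0 : (q.+2%:R : R) != 0 by rewrite pnatr_eq0.
by apply: (mulIf q0); rewrite mulrBl mulVf // mul1r -mulrA mulVf // -[q.+2]addn1 natrD; lra.
Qed.

Lemma rootmsgS pin p t T :
  rootmsg pin p t.+1 T = bp p (T [::]) (fun j => rootmsg pin p t (shift T j)).
Proof. by rewrite /rootmsg; case: pin. Qed.

Lemma big_iota0 (F : nat -> R) D : \prod_(k <- iota 0 D) F k = \prod_(k < D) F k.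
Proof. by rewrite -(big_mkord xpredT F) /index_iota subn0. Qed.

Lemma zn_rootmsg pin p t T : 0 <= p.1 ->
  exists2 c, 0 < c & forall s : X, zn p.1 p.2 pin t T s = c * vecm (rootmsg pin p t T) s.
Proof.
move=> p0; elim: t T => [|t IH] T.
  exists (if pin then expR p.2 / q.+2%:R else
      (expR p.2 + k1) / q.+2%:R).
    by case: pin; rewrite divr_gt0 ?ltr0n ?expR_gt0 // addr_gt0 ?expR_gt0 ?k1_gt0.
  move=> s; rewrite /= /leafw /rootmsg; case: pin => /=.
    rewrite psibE /vecm /bb subrr mul0r; case: ifP => _; rewrite ?mulr1 ?mulr0 ?mul0r //.
  rewrite mulr1 mulrAC; congr (_ / _).
  have a0 j : (j < T [::])%N -> 0 <= (q.+2%:R^-1 : R) <= 1 by rewrite q2V_itv.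
  have z0 := lt0r_neq0 (zz_gt0 p.2 p0 a0).
  apply: (mulfI z0); rewrite mulrCA -vecm_bp //.
  have -> : zz p.1 p.2 (T [::]) (fun=> q.+2%:R^-1) =
     (expR p.2 + k1) * \prod_(j < T [::]) (1 + wgt p.1 * q.+2%:R^-1).
    by rewrite /zz /nn0 /nn1 bb_q2V; ring.
  have vq : vecm q.+2%:R^-1 s = q.+2%:R^-1 :> R by rewrite /vecm bb_q2V; case: ifP.
  by rewrite vq; ring.
have [c cP] : exists c : nat -> R, forall k, 0 < c k /\ forall s : X,
     zn p.1 p.2 pin t (shift T k) s = c k * vecm (rootmsg pin p t (shift T k)) s.
  have H k : exists c, 0 < c /\ forall s : X,
     zn p.1 p.2 pin t (shift T k) s = c * vecm (rootmsg pin p t (shift T k)) s.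
    by have [c c0 cE] := IH (shift T k); exists c.
  by exists (fun k => projT1 (cid (H k))) => k; exact: projT2 (cid (H k)).
have a0 j : (j < T [::])%N -> 0 <= rootmsg pin p t (shift T j) <= 1.
  by rewrite rootmsg_itv.
exists (q.+2%:R^-1 * (\prod_(k < T [::]) c k) *
    zz p.1 p.2 (T [::]) (fun j => rootmsg pin p t (shift T j))).
  rewrite !mulr_gt0 ?invr_gt0 ?ltr0n ?zz_gt0 // prodr_gt0 // => k _.
  by have [] := cP k.
move=> s; rewrite rootmsgS -[RHS]mulrA -vecm_bp //=.
rewrite big_iota0 (eq_bigr (fun k : 'I_(T [::]) => c k *
   (1 + wgt p.1 * vecm (rootmsg pin p t (shift T k)) s))) => [|k _]; last first.
  under eq_bigr do rewrite (proj2 (cP k)) mulrCA.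
  by rewrite -mulr_sumr sum_psi_vecm.
by rewrite big_split /=; ring.
Qed.

Lemma hbar_fE p t T (s : X) : 0 <= p.1 ->
  hbar_f p.1 p.2 t T s = vecm (msg q.+2%:R^-1 (nseq t.+1 p) T) s.
Proof.
move=> p0; rewrite /hbar_f (@tmargE R q p.1 p.2 false) //.
have [c c0 cE] := zn_rootmsg false t T p0.
under eq_bigr do rewrite cE; rewrite cE -mulr_sumr sum_vecm mulr1 mulrC mulKf //.
by rewrite lt0r_neq0.
Qed.

Lemma hbar_1E p t T (s : X) : 0 <= p.1 ->
  hbar_1 p.1 p.2 t T s = vecm (msg 1 (nseq t.+1 p) T) s.
Proof.
move=> p0; rewrite /hbar_1 (@tmargE R q p.1 p.2 true) //.
have [c c0 cE] := zn_rootmsg true t.+1 T p0.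
under eq_bigr do rewrite cE; rewrite cE -mulr_sumr sum_vecm mulr1 mulrC mulKf //.
by rewrite lt0r_neq0.
Qed.

Lemma avg_wt_total p (V : finType) (f : seq nat -> V) pin t T : 0 <= p.1 ->
  {in tball T t &, injective f} ->
  avg (fun sigma : {ffun V -> X} => wt p.1 p.2 pin t T (fun u => sigma (f u))) =
    \sum_(s : X) zn p.1 p.2 pin t T s.
Proof.
move=> p0 finj; under [RHS]eq_bigr do rewrite -(avg_wt _ _ _ _ finj).
rewrite -avg_sum; apply: eq_avg => sigma; rewrite -mulr_suml (bigD1 (sigma (f [::]))) //= eqxx.
by rewrite big1 ?addr0 ?mul1r // => s /negPf; rewrite eq_sym => ->.
Qed.

Lemma tree_root_prob p (V : finType) (f : seq nat -> V) pin t T : 0 <= p.1 ->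
  {in tball T t &, injective f} ->
  avg (fun sigma : {ffun V -> X} => (sigma (f [::]) == ord0)%:R *
     wt p.1 p.2 pin t T (fun u => sigma (f u))) /
  avg (fun sigma : {ffun V -> X} => wt p.1 p.2 pin t T (fun u => sigma (f u))) =
  rootmsg pin p t T.
Proof.
move=> p0 finj; rewrite avg_wt // avg_wt_total //.
have [c c0 cE] := zn_rootmsg pin t T p0.
under eq_bigr do rewrite cE; rewrite cE -mulr_sumr sum_vecm mulr1 mulrC mulKf //.
by rewrite lt0r_neq0.
Qed.

(** Given the root colour, forcing child [j] to agree multiplies the weight by the factor [rr] of
    its message; the mean over the root marginal is [edgep]. *)
Lemma tree_edge_prob p (V : finType) (f : seq nat -> V) pin t T (j : nat) : 0 <= p.1 ->
  {in tball T t.+1 &, injective f} -> (j < T [::])%N ->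
  avg (fun sigma : {ffun V -> X} => (sigma (f [::]) == sigma (f [:: j]))%:R *
     wt p.1 p.2 pin t.+1 T (fun u => sigma (f u))) /
  avg (fun sigma : {ffun V -> X} => wt p.1 p.2 pin t.+1 T (fun u => sigma (f u))) =
  edgep p.1 (rootmsg pin p t.+1 T) (rootmsg pin p t (shift T j)).
Proof.
move=> p0 finj jT; rewrite avg_wt_edge // avg_wt_total //.
have [c c0 cE] := zn_rootmsg pin t.+1 T p0.
set m := rootmsg pin p t (shift T j).
have m01 : 0 <= m <= 1 by apply: rootmsg_itv.
have v0 (s : X) : 0 < 1 + wgt p.1 * vecm m s.
  by apply: fac_gt0 => //; rewrite /vecm; case: ifP => _; rewrite ?bb_ge0 //; case/andP: m01.
have -> : \sum_(s : X) zn p.1 p.2 pin t.+1 T s = c.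
  by under eq_bigr do rewrite cE; rewrite -mulr_sumr sum_vecm mulr1.
rewrite /edgep -(sum_vecm_split (rr p.1)); apply: (mulIf (lt0r_neq0 c0)).
rewrite mulfVK ?lt0r_neq0 // mulr_suml; apply: eq_bigr => s _.
rewrite mulrAC [_ * c]mulrC -cE /rr mulrA; apply: (mulIf (lt0r_neq0 (v0 s))).
rewrite -[RHS]mulrA mulfVK ?lt0r_neq0 //=.
have jI : j \in iota 0 (T [::]) by rewrite mem_iota add0n.
rewrite [in LHS](bigD1_seq j) ?iota_uniq //= eqxx /= big_pred1_eq.
rewrite [X in _ * (_ * X) * _ = _](eq_bigr (fun k => \sum_(s' : X) psi p.1 s s' *
   zn p.1 p.2 pin t (shift T k) s')) => [|k /negPf -> //].
rewrite [in RHS](bigD1_seq j) ?iota_uniq //=.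
have [cj cj0 cjE] := zn_rootmsg pin t (shift T j) p0.
rewrite (_ : \sum_(s' : X) psi p.1 s s' * zn p.1 p.2 pin t (shift T j) s' =
   cj * (1 + wgt p.1 * vecm m s)); last first.
  by under eq_bigr do rewrite cjE mulrCA; rewrite -mulr_sumr sum_psi_vecm.
by rewrite cjE -/m psiE eqxx mulr1; ring.
Qed.

Definition eterm beta a b : R := ln (1 + wgt beta * agree a b).
Definition phiS p (A : ptree -> R) T : R :=
  ln (zz p.1 p.2 (T [::]) (fun j => A (shift T j))) -
  2^-1 * \sum_(j < T [::]) eterm p.1 (A (shift T j)) (A (remove_child T j)).

Lemma PhiTE p (A : ptree -> R) (h : ptree -> X -> R) T :
  (forall T s, h T s = vecm (A T) s) -> PhiT p.1 p.2 h T = phiS p A T.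
Proof.
move=> hE; rewrite /PhiT /phiS; congr (ln _ - _ * _).
  under eq_bigr => s _.
    under eq_bigr do (under eq_bigr do rewrite hE; rewrite sum_psi_vecm).
    over.
  rewrite (bigD1 ord0) //= psibE eqxx /zz /nn0; congr (_ * _ + _).
  under eq_bigr => s /negPf s0.
    rewrite psibE s0 mul1r (eq_bigr (fun j : 'I__ => 1 + wgt p.1 * bb (A (shift T j)))); last first.
      by move=> j _; rewrite /vecm s0.
    over.
  by rewrite sumr_const cardC1 card_ord /= mulr_natl.
apply: eq_bigr => j _; rewrite /eterm; congr ln.
under eq_bigr => s _ do (under eq_bigr do rewrite !hE; rewrite -mulr_suml sum_psi_vecm mulrC).
rewrite (sum_vecm_split (fun x => 1 + wgt p.1 * x)) /agree.
by have := bb_sum (A (remove_child T j)); move: (bb _) (bb _) => u v; lra.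
Qed.
End Messages.

End MessageAlgebra.
Import MessageAlgebra.

(** * Comparison of Gibbs marginals on a graph with those on tree balls *)

Module GraphComparison.
Local Close Scope classical_set_scope.
Import fingroup.
Local Open Scope ring_scope.

Section GraphBall.
Variables (n : nat) (G : graphn n) (v : 'I_n).
Implicit Types (T : ptree) (g : seq nat -> 'I_n).

(* [g] embeds the radius-[t] ball of the tree [T] in [G], and no edge leaves it below depth [t]. *)
Definition tree_ball T t g : Prop :=
  [/\ {in tball T t &, injective g}, g [::] = v,
      (forall u w, tball T t u -> tball T t w -> ((g u, g w) \in G) = tadj u w) &
      (forall u y, tball T t u -> (size u < t)%N -> (g u, y) \in G ->
         exists2 w, tball T t w & g w = y)].

Lemma tball_le T s t u : (s <= t)%N -> tball T s u -> tball T t u.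
Proof. by move=> st /andP[vu su]; rewrite /tball vu (leq_trans su). Qed.

Lemma tadj_parent w : w != [::] -> tadj (parent w) w.
Proof. by move=> w0; rewrite /tadj is_childE w0 eqxx. Qed.

Lemma tree_ball_of_iso T t : simple_graph G ->
  rooted_iso (fun x => x \in gball G v t) (fun x y => (x, y) \in G) v (tball T t) tadj [::] ->
  exists g, tree_ball T t g.
Proof.
move=> sG [f [fi [fs [f0 fa]]]].
pose g u := odflt v [pick x | (x \in gball G v t) && (f x == u)].
have gP u : tball T t u -> g u \in gball G v t /\ f (g u) = u.
  move=> ut; rewrite /g; case: pickP => [x /andP[-> /eqP ->] //|no].
  by have [x xG xu] := proj1 (fs u) ut; have := no x; rewrite xG xu eqxx.
have gf x : x \in gball G v t -> g (f x) = x.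
  move=> xG; have fx : tball T t (f x) by apply/fs; exists x.
  by have [gG] := gP _ fx; apply: fi.
have gball_self s : v \in gball G v s by elim: s => [|s IH] /=; rewrite ?inE // IH.
have gball_mono s s' : (s <= s')%N -> {subset gball G v s <= gball G v s'}.
  move=> /subnK <-; elim: (s' - s)%N => //= k IH x xs.
  by rewrite inE IH.
have ga u w : tball T t u -> tball T t w -> ((g u, g w) \in G) = tadj u w.
  by move=> /gP[uG fu] /gP[wG fw]; rewrite -fa // fu fw.
have gs u : tball T t u -> g u \in gball G v (size u).
  move: {2}(size u) (erefl (size u)) => m; elim: m u => [|m IH] u.
    by move=> /size0nil -> _ /=; rewrite -f0 gf ?f0 ?inE.
  move=> su ut; have u0 : u != [::] by case: (u) su.
  have pt := tball_parent ut.
  have sp : size (parent u) = m by rewrite /parent size_take su /= ltnSn.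
  rewrite su /= inE; apply/orP; right; rewrite inE; apply/existsP; exists (g (parent u)).
  by rewrite -{1}sp IH //= ga // tadj_parent.
exists g; split => //.
- by move=> u w /gP[_ {2}<-] /gP[_ {2}<-] ->.
- by rewrite -f0 gf.
- move=> u y ut su uy; exists (f y); last first.
    apply: gf; apply: (gball_mono (size u).+1) => //=; rewrite !inE.
    by apply/orP; right; apply/existsP; exists (g u); rewrite gs.
  apply/fs; exists y => //; apply: (gball_mono (size u).+1) => //=; rewrite !inE.
  by apply/orP; right; apply/existsP; exists (g u); rewrite gs.
Qed.
End GraphBall.

Section Gibbs.
Variables (R : realType) (q n : nat) (p : R * R) (G : graphn n).
Hypotheses (p1 : 0 <= p.1) (p2 : 0 <= p.2) (sG : simple_graph G).
Local Notation X := 'I_q.+2.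
Local Notation cfg := {ffun 'I_n -> X}.
HB.instance Definition _ := GRing.Zmodule.on {ffun 'I_n -> X}.

Definition gibbs_weight (sigma : cfg) : R :=
  (\prod_(e in G | (e.1 < e.2)%N) psi p.1 (sigma e.1) (sigma e.2)) *
    \prod_(i : 'I_n) psib p.2 (sigma i).
Definition gibbs (H : pred cfg) : R :=
  (\sum_(sigma | H sigma) gibbs_weight sigma) / ZG q.+2 p.1 p.2 G.

Definition eq_set (x y : 'I_n) : {set cfg} := [set sigma : cfg | sigma x == sigma y].
Definition zero_set (A : pred 'I_n) : {set cfg} :=
  [set sigma : cfg | [forall x, A x ==> (sigma x == ord0)]].

Lemma eq_group_set x y : group_set (eq_set x y).
Proof.
apply/group_setP; split; first by rewrite inE !ffunE.
by move=> s t; rewrite !inE => /eqP sx /eqP tx; rewrite !ffunE sx tx.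
Qed.
Lemma zero_group_set A : group_set (zero_set A).
Proof.
apply/group_setP; split; first by rewrite inE; apply/forallP => x; rewrite !ffunE eqxx implybT.
move=> s t; rewrite !inE => /forallP sA /forallP tA; apply/forallP => x; apply/implyP => Ax.
rewrite !ffunE (eqP (implyP (sA x) Ax)) (eqP (implyP (tA x) Ax)).
exact/eqP/(addr0 (0 : X)).
Qed.
Definition eq_group x y : {group cfg} := Group (eq_group_set x y).
Definition zero_group A : {group cfg} := Group (zero_group_set A).

Lemma cfg_abelian : abelian [set: cfg].
Proof. by apply/centsP => x _ y _; apply: addrC. Qed.

Definition fid := (('I_n * 'I_n) + 'I_n)%type.
Definition factor (f : fid) : {group cfg} * R :=
  match f with
  | inl e => (eq_group e.1 e.2, wgt p.1)
  | inr i => (zero_group (pred1 i), wgt p.2)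
  end.

Definition all_factors : seq fid :=
  [seq inl e | e <- enum [pred e in G | (e.1 < e.2)%N]] ++ [seq inr i | i <- enum 'I_n].
(** Edges of [G] are counted with the smaller end first, so a parent-child pair must be put in this
    order to name a factor of [G]. *)
Definition srt (x y : 'I_n) := if (x < y)%N then (x, y) else (y, x).
Definition tree_factors (T : ptree) t (g : seq nat -> 'I_n) : seq fid :=
  [seq inl (srt (g (parent w)) (g w)) | w <- tlist T t & w != [::]] ++
  [seq inr (g w) | w <- tlist T t].

Lemma factor_zero x (sigma : cfg) : (sigma \in zero_group (pred1 x)) = (sigma x == ord0).
Proof.
rewrite inE; apply/forallP/idP => [/(_ x)|sx y]; first by rewrite /= eqxx.
by apply/implyP => /eqP ->.
Qed.

Lemma factor_ge0 (s : seq fid) : all (fun f => 0 <= f.2) (map factor s).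
Proof. by elim: s => //= -[e|i] s -> /=; rewrite wgt_ge0. Qed.

Lemma factor_psib x (sigma : cfg) : psib p.2 (sigma x) =
  1 + wgt p.2 * (sigma \in zero_group (pred1 x))%:R.
Proof.
rewrite factor_zero psibE /wgt; case: (_ == _); rewrite ?mulr1 ?mulr0; lra.
Qed.

Lemma gweight_all sigma : gweight (map factor all_factors) sigma = gibbs_weight sigma.
Proof.
rewrite /gweight /all_factors map_cat big_cat /= !big_map !big_enum /=.
rewrite /gibbs_weight; congr (_ * _).
  apply: eq_bigr => e _.
  by rewrite psiE inE.
by apply: eq_bigr => i _; rewrite -factor_psib.
Qed.

Lemma gweight_tree T t g sigma :
  gweight (map factor (tree_factors T t g)) sigma = tree_weight p.1 p.2 t T (fun u => sigma (g u)).
Proof.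
rewrite /gweight /tree_factors map_cat big_cat /= !big_map mulrC /tree_weight.
rewrite big_filter; congr (_ * _); apply: eq_bigr => u _; first by rewrite -factor_psib.
rewrite psiE /srt; case: ifP => _; rewrite inE //=.
by rewrite eq_sym.
Qed.

Lemma edge_sym x y : ((x, y) \in G) = ((y, x) \in G).
Proof. by move/andP: sG => [/forallP/(_ x)/forallP/(_ y)/eqP]. Qed.
Lemma edge_irr x : (x, x) \in G = false.
Proof. by move/andP: sG => [_ /forallP/(_ x)/negPf]. Qed.

Lemma mem_srt x y : (x, y) \in G -> srt x y \in [pred e in G | (e.1 < e.2)%N].
Proof.
move=> xy; rewrite inE /srt; case: ifP => xy'; rewrite /= ?xy ?xy' // -edge_sym xy /=.
rewrite ltn_neqAle leqNgt xy' andbT; apply/eqP => /val_inj E.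
by move: xy; rewrite E edge_irr.
Qed.

Section Ball.
Variables (v : 'I_n) (T : ptree) (t : nat) (g : seq nat -> 'I_n).
Hypothesis gb : tree_ball G v T t g.

Lemma uniq_tree_factors : uniq (tree_factors T t g).
Proof.
have [gi _ ga _] := gb.
rewrite /tree_factors cat_uniq; apply/and3P; split.
- rewrite map_inj_in_uniq ?filter_uniq ?uniq_tlist // => u w.
  rewrite !mem_filter !mem_tlist => /andP[u0 ut] /andP[w0 wt] [].
  have pu := tball_parent ut; have pw := tball_parent wt.
  have sz x : x != [::] -> size x = (size (parent x)).+1.
    by case: x => // i x _; rewrite /parent size_take /= ltnSn.
  rewrite /srt; case: ifP => _; case: ifP => _ [].
  + by move=> _ /(gi _ _ ut wt).
  (* If two edges coincided with opposite orientations, each lower vertex would be the parent of the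
     other; comparing depths excludes this. *)
  + move=> /(gi _ _ pu wt) E /(gi _ _ ut pw) E'.
    by move/eqP: (sz _ u0); rewrite E (sz _ w0) -E' -addn2 -{1}[size u]addn0 eqn_add2l.
  + move=> /(gi _ _ ut pw) E' /(gi _ _ pu wt) E.
    by move/eqP: (sz _ u0); rewrite E (sz _ w0) -E' -addn2 -{1}[size u]addn0 eqn_add2l.
  + by move=> /(gi _ _ ut wt).
- by apply/hasP => -[f /mapP[u _ ->] /mapP[w _]].
- rewrite map_inj_in_uniq ?uniq_tlist // => u w; rewrite !mem_tlist => ut wt [].
  exact: gi.
Qed.

Lemma sub_tree_factors : {subset tree_factors T t g <= all_factors}.
Proof.
have [gi _ ga _] := gb.
move=> f; rewrite !mem_cat => /orP[] /mapP[u]; rewrite ?mem_filter ?mem_tlist.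
  move=> /andP[u0 ut] ->; apply/orP; left; apply/map_f; rewrite mem_enum.
  by apply: mem_srt; rewrite ga ?tadj_parent // tball_parent.
by move=> _ ->; apply/orP; right; apply/map_f; rewrite mem_enum.
Qed.

Definition rest_factors := [seq f <- all_factors | f \notin tree_factors T t g].

Lemma all_factorsE : perm_eq all_factors (rest_factors ++ tree_factors T t g).
Proof.
rewrite perm_sym perm_catC.
apply: perm_trans (permEl (perm_filterC (mem (tree_factors T t g)) all_factors)).
rewrite perm_cat2r.
apply: uniq_perm; rewrite ?uniq_tree_factors ?filter_uniq //.
  rewrite /all_factors cat_uniq; apply/and3P; split.
  + by rewrite map_inj_uniq ?enum_uniq // => x y [].
  + by apply/hasP => -[f /mapP[u _ ->] /mapP[w _]].
  + by rewrite map_inj_uniq ?enum_uniq // => x y [].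
move=> f; rewrite mem_filter /=; case E: (f \in _) => //=.
by rewrite sub_tree_factors.
Qed.

Lemma gsum_all (A : {set cfg}) : gsum (map factor all_factors) A = \sum_(s in A) gibbs_weight s.
Proof. by apply: eq_bigr => s _; rewrite gweight_all. Qed.

Lemma gibbsE (H : {group cfg}) : gibbs (mem H) =
  gsum (map factor all_factors) H / gsum (map factor all_factors) [set: cfg].
Proof.
rewrite !gsum_all /gibbs /ZG; congr (_ / _).
by apply: eq_big => // s; rewrite inE.
Qed.

Lemma sum_avg (h : cfg -> R) (A : {set cfg}) :
  \sum_(s in A) h s = (#|{: X}| ^ #|'I_n|)%:R * avg (fun s => (s \in A)%:R * h s).
Proof.
rewrite /avg mulrA mulfV ?cardXV_neq0 ?card_ord // mul1r big_mkcond.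
by apply: eq_bigr => s _; case: (s \in A); rewrite ?mul1r ?mul0r.
Qed.

Lemma avg_ratio (h h' : cfg -> R) (A A' : {set cfg}) :
  (\sum_(s in A) h s) / (\sum_(s in A') h' s) =
  avg (fun s => (s \in A)%:R * h s) / avg (fun s => (s \in A')%:R * h' s).
Proof.
rewrite !sum_avg invfM mulrACA mulfV ?mul1r //.
by apply: cardXV_neq0; rewrite card_ord.
Qed.

Lemma wt_free (sigma : cfg) : wt p.1 p.2 false t T (fun u => sigma (g u)) =
  tree_weight p.1 p.2 t T (fun u => sigma (g u)).
Proof. by rewrite wtE big1 ?mulr1. Qed.

(** The factors of the ball alone define the free Potts measure on the tree; restoring the remaining
    factors of [G] raises the probability of every subgroup. *)
Lemma gibbs_ge (H : {group cfg}) :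
  avg (fun sigma : cfg => (sigma \in H)%:R * wt p.1 p.2 false t T (fun u => sigma (g u))) /
  avg (fun sigma : cfg => wt p.1 p.2 false t T (fun u => sigma (g u))) <= gibbs (mem H).
Proof.
rewrite gibbsE (gsum_perm _ (perm_map factor all_factorsE)).
rewrite (gsum_perm [set: cfg] (perm_map factor all_factorsE)) map_cat.
apply: le_trans (griffiths_cat cfg_abelian H (factor_ge0 _) (factor_ge0 _)).
rewrite /gsum avg_ratio le_eqVlt; apply/orP; left; apply/eqP; congr (_ / _).
  by apply: eq_avg => s; rewrite gweight_tree wt_free.
by apply: eq_avg => s; rewrite inE mul1r gweight_tree wt_free.
Qed.
End Ball.

Section BallUpper.
Variables (v : 'I_n) (T : ptree) (t : nat) (g : seq nat -> 'I_n).
Hypothesis gb : tree_ball G v T t.+1 g.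

Let U := [seq g u | u <- tlist T t].
Let U1 := [seq g u | u <- tlist T t.+1].
(** Colour 0 everywhere outside the ball of radius [t]: this pins the sphere at depth [t.+1] and
    freezes the rest of the graph, and it is a subgroup. *)
Let L := zero_group [pred x | x \notin U].

(** An edge of [G] that meets the ball of radius [t] is an edge of the tree ball of radius [t.+1].
    Hence a remaining edge has both ends coloured 0 on [L], and so is the vertex of a remaining
    field factor. *)
Lemma rest_const f sigma : f \in rest_factors T t.+1 g -> sigma \in L -> sigma \in (factor f).1.
Proof.
have [gi _ ga gn] := gb.
have szU u : tball T t.+1 u -> (g u \in U) = (size u <= t)%N.
  move=> ut; apply/mapP/idP => [[w wt /gi]|su].
    have wt1 : tball T t.+1 w by rewrite mem_tlist in wt; apply: tball_le wt.
    by move=> /(_ ut wt1) ->; move: wt; rewrite mem_tlist => /andP[].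
  by exists u => //; rewrite mem_tlist; move: ut => /andP[vu _]; apply/andP.
rewrite mem_filter => /andP[fT fA] /[!inE] /forallP sL.
have edge x y : (x, y) \in G -> x \in U -> inl (srt x y) \in tree_factors T t.+1 g.
  move=> xy /mapP[u]; rewrite mem_tlist => ut xu; rewrite mem_cat; apply/orP; left.
  have u1 : tball T t.+1 u by apply: tball_le ut.
  have su : (size u < t.+1)%N by case/andP: ut.
  have [w w1 wy] : exists2 w, tball T t.+1 w & g w = y by apply: (gn u) => //; rewrite -xu.
  have : tadj u w by rewrite -ga // wy -xu.
  rewrite /tadj !is_childE => /orP[] /andP[z0 /eqP E]; apply/mapP.
    by exists w; rewrite ?mem_filter ?z0 ?mem_tlist // -E -xu wy.
  exists u; rewrite ?mem_filter ?z0 ?mem_tlist // -E -xu wy /srt.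
  case: (ltngtP x y) => // /val_inj E'; move: xy; by rewrite E' edge_irr.
case: f fT fA => [[x y]|i] fT.
  rewrite mem_cat => /orP[|/mapP[] //] /mapP[[x' y']]; rewrite mem_enum inE /= => /andP[xy lt] [? ?].
  subst x' y'; rewrite inE /=.
  have sxy : srt x y = (x, y) by rewrite /srt lt.
  have syx : srt y x = (x, y) by rewrite /srt ltnNge ltnW.
  have xU : x \notin U by apply/negP => /(edge _ _ xy); rewrite sxy; apply/negP.
  have yU : y \notin U.
    by apply/negP => yU; have := edge y x; rewrite -edge_sym xy syx (negPf fT) => /(_ isT yU).
  by rewrite (eqP (implyP (sL x) xU)) (eqP (implyP (sL y) yU)).
move=> _; rewrite [_.1]/= factor_zero; apply: (implyP (sL i)) => /=.
apply/negP => /mapP[u]; rewrite mem_tlist => ut iu; move/negP: fT; apply.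
rewrite mem_cat; apply/orP; right; rewrite iu; apply/mapP; exists u => //.
by rewrite mem_tlist (tball_le (leqnSn t)).
Qed.

Lemma gweight_rest sigma : sigma \in L ->
  gweight (map factor (rest_factors T t.+1 g)) sigma =
  gweight (map factor (rest_factors T t.+1 g)) 1%g.
Proof.
move=> sL; rewrite /gweight !big_map big_seq [RHS]big_seq; apply: eq_bigr => f fr.
by rewrite (rest_const fr sL) group1.
Qed.

(** Membership in [L] splits into pinning the sphere at depth [t.+1] and colour 0 off the larger
    ball; the second condition concerns other vertices than the tree weight does. *)
Lemma wt_pinned (sigma : cfg) :
  (sigma \in L)%:R * tree_weight p.1 p.2 t.+1 T (fun u => sigma (g u)) =
  wt p.1 p.2 true t.+1 T (fun u => sigma (g u)) *
    (sigma \in zero_group [pred x | x \notin U1])%:R.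
Proof.
rewrite wtE mulrC -mulrA; congr (_ * _).
have -> : \prod_(u <- tlist T t.+1 | size u == t.+1) (true ==> (sigma (g u) == ord0))%:R =
   (all (fun u => (size u == t.+1) ==> (sigma (g u) == ord0)) (tlist T t.+1))%:R :> R.
  elim: (tlist T t.+1) => [|u s IH]; first by rewrite big_nil.
  by rewrite big_cons IH /=; case: eqP => //= _; case: (_ == ord0); rewrite ?mul1r ?mul0r.
rewrite -natrM mulnb; congr (nat_of_bool _)%:R.
have [gi _ ga gn] := gb.
rewrite !inE; apply/forallP/andP => [H|[/allP H1 /forallP H2] x].
  split.
    apply/allP => u ut; apply/implyP => /eqP su; apply: (implyP (H (g u))) => /=.
    apply/mapP => -[w wt E]; rewrite mem_tlist in ut; rewrite mem_tlist in wt.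
    have uw := gi _ _ ut (tball_le (leqnSn t) wt) E.
    by move: wt; rewrite -uw /tball su ltnn andbF.
  apply/forallP => x; apply/implyP => /= xU1; apply: (implyP (H x)) => /=.
  apply: contra xU1 => /mapP[u ut ->]; apply/map_f; rewrite mem_tlist.
  by rewrite mem_tlist in ut; apply: tball_le ut.
apply/implyP => /= xU; have [|xU1] := boolP (x \in U1); last exact: (implyP (H2 x)).
move=> /mapP[u ut xu]; rewrite xu; apply: (implyP (H1 u ut)).
rewrite mem_tlist in ut; move/andP: ut => [vu]; rewrite leq_eqVlt => /orP[//|su].
by case/negP: xU; rewrite xu; apply/map_f; rewrite mem_tlist /tball vu.
Qed.

(** Conditioning on [L] raises the probability. Under it the remaining factors are constant, and the
    vertices off the larger ball are independent of the rest; both cancel from the ratio. *)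
Lemma gibbs_le (H : {group cfg}) :
  depends_on (fun x => x \in U1) (fun sigma : cfg => (sigma \in H)%:R : R) ->
  gibbs (mem H) <=
  avg (fun sigma : cfg => (sigma \in H)%:R * wt p.1 p.2 true t.+1 T (fun u => sigma (g u))) /
  avg (fun sigma : cfg => wt p.1 p.2 true t.+1 T (fun u => sigma (g u))).
Proof.
move=> dH; rewrite gibbsE.
apply: le_trans (griffiths_cond cfg_abelian H L (factor_ge0 _)) _.
rewrite !(gsum_perm _ (perm_map factor (all_factorsE gb))) map_cat /gsum.
have E (A : {set cfg}) : A \subset L ->
   \sum_(s in A) gweight (map factor (rest_factors T t.+1 g) ++
      map factor (tree_factors T t.+1 g)) s =
   gweight (map factor (rest_factors T t.+1 g)) 1%g *
   \sum_(s in A) tree_weight p.1 p.2 t.+1 T (fun u => s (g u)).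
  move=> AL; rewrite mulr_sumr; apply: eq_bigr => s sA.
  have gcat (a b : seq ({group cfg} * R)) : gweight (a ++ b) s = gweight a s * gweight b s.
    by rewrite /gweight big_cat.
  by rewrite gcat gweight_tree gweight_rest // (fintype.subsetP AL).
have W0 : gweight (map factor (rest_factors T t.+1 g)) 1%g != 0.
  rewrite lt0r_neq0 // /gweight big_seq_cond; apply: prodr_gt0 => f; rewrite andbT.
  by move=> /(allP (factor_ge0 _)) f0; rewrite ltr_pwDl // mulr_ge0.
rewrite !E ?subsetIr // invfM mulrACA mulfV // mul1r avg_ratio.
pose Z (sigma : cfg) : R := (sigma \in zero_group [pred x | x \notin U1])%:R.
have dZ : depends_on (fun x => x \notin U1) Z.
  move=> s s' ss'; congr (nat_of_bool _)%:R; rewrite !inE; apply: eq_forallb => x.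
  by apply: implyb_id2l => /= xU; rewrite ss'.
have dW := @wt_depends R q p.1 p.2 _ true t.+1 T g.
have Z0 : avg Z != 0.
  rewrite /avg mulf_neq0 ?invr_eq0 ?cardXV_neq0 ?card_ord // lt0r_neq0 //.
  rewrite (bigD1 1%g) //= /Z group1 ltr_pwDl // sumr_ge0 // => s _; apply: ler0n.
rewrite (eq_avg (h := fun s => ((s \in H)%:R * wt p.1 p.2 true t.+1 T (fun u => s (g u))) * Z s)).
  rewrite [X in _ / X](eq_avg (h := fun s => wt p.1 p.2 true t.+1 T (fun u => s (g u)) * Z s)).
    have X0 : (0 < #|{: X}|)%N by rewrite card_ord.
    have disj (x : 'I_n) : x \in U1 -> x \notin U1 -> False by move=> ->.
    have dHW : depends_on (fun x => x \in U1)
        (fun s : cfg => (s \in H)%:R * wt p.1 p.2 true t.+1 T (fun u => s (g u)) : R).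
      by move=> s s' ss'; rewrite (dH s s') // (dW s s').
    rewrite (avgM_indep X0 disj dHW dZ) (avgM_indep X0 disj dW dZ).
    by rewrite -mulf_div mulfV // mulr1.
  by move=> s; rewrite wt_pinned.
by move=> s; rewrite -mulrA -wt_pinned mulrA -natrM mulnb inE.
Qed.
End BallUpper.

Lemma gibbs_root_ge v T t g : tree_ball G v T t g ->
  rootmsg q false p t T <= gibbs (fun s => s v == ord0).
Proof.
move=> gb; have [gi g0 _ _] := gb.
rewrite -(@tree_root_prob R q p _ g false t T p1 gi) (_ : gibbs _ = gibbs (mem (zero_group (pred1 v)))).
  apply: le_trans (gibbs_ge gb _); rewrite le_eqVlt; apply/orP; left; apply/eqP.
  by congr (_ / _); apply: eq_avg => s; rewrite factor_zero g0.
by congr (_ / _); apply: eq_bigl => s; rewrite /= factor_zero.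
Qed.

Lemma gibbs_root_le v T t g : tree_ball G v T t.+1 g ->
  gibbs (fun s => s v == ord0) <= rootmsg q true p t.+1 T.
Proof.
move=> gb; have [gi g0 _ _] := gb.
rewrite -(@tree_root_prob R q p _ g true t.+1 T p1 gi) (_ : gibbs _ = gibbs (mem (zero_group (pred1 v)))).
  apply: le_trans (gibbs_le gb _) _.
    move=> s s' ss'; rewrite !factor_zero ss' //.
    by apply/mapP; exists [::] => //; apply: tlist_nil.
  rewrite le_eqVlt; apply/orP; left; apply/eqP.
  by congr (_ / _); apply: eq_avg => s; rewrite factor_zero g0.
by congr (_ / _); apply: eq_bigl => s; rewrite /= factor_zero.
Qed.

Lemma gibbs_edge_ge v T t g j : tree_ball G v T t.+1 g -> (j < T [::])%N ->
  edgep q p.1 (rootmsg q false p t.+1 T) (rootmsg q false p t (shift T j)) <=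
  gibbs (fun s => s v == s (g [:: j])).
Proof.
move=> gb jT; have [gi g0 _ _] := gb.
rewrite -(@tree_edge_prob R q p _ g false t T j p1 gi jT)
  (_ : gibbs _ = gibbs (mem (eq_group v (g [:: j])))).
  apply: le_trans (gibbs_ge gb _); rewrite le_eqVlt; apply/orP; left; apply/eqP.
  by congr (_ / _); apply: eq_avg => s; rewrite inE g0.
by congr (_ / _); apply: eq_bigl => s; rewrite /= inE.
Qed.

Lemma gibbs_edge_le v T t g j : tree_ball G v T t.+1 g -> (j < T [::])%N ->
  gibbs (fun s => s v == s (g [:: j])) <=
  edgep q p.1 (rootmsg q true p t.+1 T) (rootmsg q true p t (shift T j)).
Proof.
move=> gb jT; have [gi g0 _ _] := gb.
rewrite -(@tree_edge_prob R q p _ g true t T j p1 gi jT)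
  (_ : gibbs _ = gibbs (mem (eq_group v (g [:: j])))).
  apply: le_trans (gibbs_le gb _) _.
    move=> s s' ss'; rewrite !inE -g0 !ss' //.
      by apply/map_f; rewrite mem_tlist /tball /= jT.
    by apply/map_f; apply: tlist_nil.
  rewrite le_eqVlt; apply/orP; left; apply/eqP.
  by congr (_ / _); apply: eq_avg => s; rewrite inE g0.
by congr (_ / _); apply: eq_bigl => s; rewrite /= inE.
Qed.
End Gibbs.

End GraphComparison.
Import GraphComparison.

(** * Logarithmic inequalities for vertex and edge terms *)

Module EdgeTerms.
Local Close Scope classical_set_scope.

Section LogInequalities.
Variable R : realType.
Implicit Types x y u : R.

Lemma lnB x y : 0 < x -> 0 < y -> ln x - ln y = ln (x / y).
Proof. by move=> x0 y0; rewrite ln_div ?posrE. Qed.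

Lemma ln_leB1 x : 0 < x -> ln x <= x - 1.
Proof. by move=> x0; rewrite -{1}[x](subrKC 1) le_ln1Dx //; lra. Qed.

Lemma lnB_le x y : 0 < x -> 0 < y -> ln x - ln y <= (x - y) / y.
Proof.
move=> x0 y0; rewrite lnB // (le_trans (ln_leB1 (divr_gt0 x0 y0))) //.
by rewrite mulrBl divff ?lt0r_neq0.
Qed.

Lemma ln_le x y : 0 < x -> x <= y -> ln x <= ln y.
Proof. by move=> x0 xy; rewrite ler_ln ?posrE // (lt_le_trans x0). Qed.

Lemma jensen_pos u x y : 0 <= u <= 1 -> 0 < x -> 0 < y -> 0 < u * x + (1 - u) * y.
Proof.
move=> /andP[u0 u1] x0 y0; have [u2|u2] := ltrP 0 u.
  by apply: ltr_pwDl; [exact: mulr_gt0|rewrite mulr_ge0 ?subr_ge0 // ltW].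
have -> : u = 0 by apply/eqP; rewrite eq_le u0 u2.
by rewrite mul0r add0r subr0 mul1r.
Qed.

Lemma jensen_ln u x y : 0 <= u <= 1 -> 0 < x -> 0 < y ->
  u * ln x + (1 - u) * ln y <= ln (u * x + (1 - u) * y).
Proof.
move=> u01 x0 y0; have m0 := jensen_pos u01 x0 y0; set m := u * x + _ in m0 *.
move/andP: u01 => [u0 u1].
have h1 := lnB_le x0 m0; have h2 := lnB_le y0 m0.
have : u * (ln x - ln m) + (1 - u) * (ln y - ln m) <=
       u * ((x - m) / m) + (1 - u) * ((y - m) / m).
  by apply: lerD; apply: ler_wpM2l; rewrite ?subr_ge0.
have -> : u * ((x - m) / m) + (1 - u) * ((y - m) / m) = 0.
  rewrite !mulrA -mulrDl [X in X / m](_ : _ = 0) ?mul0r // /m; ring.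
lra.
Qed.

Lemma jensen_expR u x : 0 <= u <= 1 -> u * x <= ln (u * expR x + (1 - u)).
Proof.
move=> u01; have := jensen_ln u01 (expR_gt0 x) (@ltr01 R).
by rewrite expRK ln1 mulr0 addr0 mulr1.
Qed.

(** From [expR x <= (1 - x)^-1] and the identity that [1 + x + 2 * x ^+ 2] times [1 - x] equals
    [1 + x ^+ 2 * (1 - 2 * x)], which is at least 1 in this range. *)
Lemma expR_quad x : `|x| <= 2^-1 -> expR x <= 1 + x + 2 * x ^+ 2.
Proof.
rewrite ler_norml => /andP[x1 x2].
have e0 := expR_gt0 x; have h := expR_ge1Dx (- x); rewrite expRN in h.
have d0 : 0 < 1 - x by lra.
have : expR x <= (1 - x)^-1 by rewrite -[expR x]invrK lef_pV2 ?posrE ?invr_gt0.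
move/le_trans; apply; rewrite -[_^-1]mul1r ler_pdivrMr //.
have : 0 <= x ^+ 2 * (1 - 2 * x) by rewrite mulr_ge0 ?sqr_ge0; lra.
lra.
Qed.

Lemma ln_expR_quad u x : 0 <= u <= 1 -> `|x| <= 2^-1 ->
  ln (u * expR x + (1 - u)) <= u * x + 2 * x ^+ 2.
Proof.
move=> u01 x1; have m0 := jensen_pos u01 (expR_gt0 x) (@ltr01 R).
rewrite mulr1 in m0; apply: le_trans (ln_leB1 m0) _.
have := expR_quad x1; move/andP: u01 => [u0 u1] h.
have h2 : u * expR x <= u * (1 + x + 2 * x ^+ 2) by apply: ler_wpM2l.
have h3 : u * (2 * x ^+ 2) <= 1 * (2 * x ^+ 2).
  by apply: ler_wpM2r => //; rewrite mulr_ge0 ?sqr_ge0.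
lra.
Qed.

(* Chebyshev's association inequality for a two-point law. *)
Lemma prod_assoc u (D : nat) (x y : nat -> R) : 0 <= u <= 1 ->
  (forall j, (j < D)%N -> 0 < x j /\ 0 < y j) ->
  (forall j, (j < D)%N -> y j <= x j) \/ (forall j, (j < D)%N -> x j <= y j) ->
  \prod_(j < D) (u * x j + (1 - u) * y j) <=
    u * \prod_(j < D) x j + (1 - u) * \prod_(j < D) y j.
Proof.
move=> u01 pos dir; move/andP: (u01) => [u0 u1].
elim: D pos dir => [|D IH] pos dir; first by rewrite !big_ord0 !mulr1; lra.
have pos' j : (j < D)%N -> 0 < x j /\ 0 < y j by move=> jD; apply: pos; apply: ltnW.
have dir' : (forall j, (j < D)%N -> y j <= x j) \/ (forall j, (j < D)%N -> x j <= y j).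
  by case: dir => h; [left|right] => j jD; apply: h; apply: ltnW.
rewrite !big_ord_recr /=; have [xD yD] := pos D (ltnSn D).
have IHD := IH pos' dir'.
set X := \prod_(j < D) x j in IHD *; set Y := \prod_(j < D) y j in IHD *.
have c0 : 0 <= u * x D + (1 - u) * y D by rewrite ltW // jensen_pos.
apply: le_trans (ler_wpM2r c0 IHD) _.
have cross : 0 <= (X - Y) * (x D - y D).
  case: dir' dir => h' [] h.
  - apply: mulr_ge0; rewrite subr_ge0 ?h //; apply: ler_prod => j _.
    by rewrite h' ?andbT // ltW; have [] := pos' j (ltn_ord j).
  - have E : forall j, (j < D)%N -> x j = y j.
      by move=> j jD; apply/eqP; rewrite eq_le h' // h // ltnW.
    by rewrite /X /Y (eq_bigr (fun j : 'I_D => y j)) ?subrr ?mul0r // => j _; apply: E.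
  - have E : forall j, (j < D)%N -> x j = y j.
      by move=> j jD; apply/eqP; rewrite eq_le h' // h // ltnW.
    by rewrite /X /Y (eq_bigr (fun j : 'I_D => y j)) ?subrr ?mul0r // => j _; apply: E.
  - rewrite -mulrNN; apply: mulr_ge0; rewrite oppr_ge0 subr_le0 ?h //; apply: ler_prod => j _.
    by rewrite h' ?andbT // ltW; have [] := pos' j (ltn_ord j).
have : 0 <= u * (1 - u) * ((X - Y) * (x D - y D)).
  by rewrite mulr_ge0 // mulr_ge0 // subr_ge0.
lra.
Qed.
End LogInequalities.

Section Scalar.
Variables (R : realType) (q : nat).
Local Notation k1 := (q.+1%:R : R).
Local Notation qi := (q.+2%:R^-1 : R).
Local Notation bb := (@bb R q).
Local Notation agree := (@agree R q).
Local Notation eterm := (@eterm R q).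
Local Notation edgep := (@edgep R q).
Local Notation bp := (@bp R q).
Local Notation zz := (@zz R q).
Local Notation nn1 := (@nn1 R q).
Implicit Types (a b c beta : R) (p : R * R).

Let k0 : 0 < k1 := k1_gt0 R q.
Let kn0 : k1 != 0 := k1_neq0 R q.

Definition msgdom a := qi <= a <= 1.

Lemma qi_gt0 : 0 < qi. Proof. by rewrite invr_gt0 ltr0n. Qed.

Lemma qiE : qi * (k1 + 1) = 1.
Proof. by rewrite -[1](_ : 1%:R = _) // -natrD addn1 mulVf // pnatr_eq0. Qed.

Lemma bb_le a : qi <= a -> bb a <= a.
Proof.
move=> h; rewrite /MessageAlgebra.bb ler_pdivrMr //.
have := ler_wpM2r (ltW (ltr_pwDl k0 (@ler01 R))) h; rewrite qiE; lra.
Qed.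

Lemma bb_anti a b : a <= b -> bb b <= bb a.
Proof. by move=> ab; rewrite /MessageAlgebra.bb ler_pM2r ?invr_gt0 //; lra. Qed.

Lemma dom01 a : msgdom a -> 0 <= a <= 1.
Proof. by move=> /andP[a0 ->]; rewrite andbT (le_trans _ a0) // ltW // qi_gt0. Qed.

Lemma dombb a : msgdom a -> 0 <= bb a <= 1.
Proof.
move=> da; have /andP[a0 a1] := dom01 da; rewrite bb_ge0 //=.
by apply: le_trans a1; apply: bb_le; case/andP: da.
Qed.

Lemma agreeE a b : agree a b = a * b + (1 - a) * (1 - b) / k1.
Proof.
have F (k x y : R) : k != 0 -> k * (x / k * (y / k)) = x * y / k by move=> ?; field.
by rewrite /MessageAlgebra.agree /MessageAlgebra.bb F.
Qed.

Lemma agreeC a b : agree a b = agree b a.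
Proof. by rewrite !agreeE; ring. Qed.

Lemma agree01 a b : 0 <= a <= 1 -> 0 <= b <= 1 -> 0 <= agree a b <= 1.
Proof.
move=> /andP[a0 a1] /andP[b0 b1].
have k1' : k1^-1 <= 1 by rewrite invf_le1 // ler1n.
have k1'' : 0 <= k1^-1 by rewrite invr_ge0 ltW.
have h1 : 0 <= (1 - a) * (1 - b) by rewrite mulr_ge0 // subr_ge0.
have h2 := ler_wpM2l h1 k1'; have h3 : 0 <= a * (1 - b) by rewrite mulr_ge0 // subr_ge0.
have h4 : 0 <= b * (1 - a) by rewrite mulr_ge0 // subr_ge0.
rewrite agreeE; apply/andP; split; first by rewrite addr_ge0 ?mulr_ge0 ?subr_ge0.
move: h2 h3 h4; rewrite mulr1; move: (_ / k1) => z; lra.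
Qed.

Lemma facE beta a b : 1 + wgt beta * agree a b =
  b * (1 + wgt beta * a) + k1 * (bb b * (1 + wgt beta * bb a)).
Proof.
rewrite /MessageAlgebra.agree; have := bb_sum q b; move: (bb b) (bb a) => u v h.
rewrite [RHS](_ : _ = (b + k1 * u) + wgt beta * (a * b + k1 * (v * u))); last by ring.
by rewrite h.
Qed.

Lemma eterm_itv beta a b : 0 <= beta -> 0 <= a <= 1 -> 0 <= b <= 1 ->
  0 <= eterm beta a b <= beta.
Proof.
move=> b0 a01 b01; have /andP[g0 g1] := agree01 a01 b01.
rewrite /MessageAlgebra.eterm ln_ge0 /=; last by rewrite lerDl mulr_ge0 ?wgt_ge0.
rewrite -[leRHS](@expRK R); apply: ln_le; first exact: fac_gt0.
have := ler_wpM2l (wgt_ge0 b0) g1; rewrite /wgt; lra.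
Qed.

Lemma etermC beta a b : eterm beta a b = eterm beta b a.
Proof. by rewrite /MessageAlgebra.eterm agreeC. Qed.

(* The edge term is supermodular in its two messages. *)
Lemma eterm_mixed beta a b a' b' : 0 <= beta ->
  0 <= a <= 1 -> 0 <= b <= 1 -> 0 <= a' <= 1 -> 0 <= b' <= 1 ->
  0 <= (a' - a) * (b' - b) ->
  eterm beta a' b + eterm beta a b' <= eterm beta a' b' + eterm beta a b.
Proof.
move=> b0 a1 b1 a2 b2 s0.
have P x y : 0 <= x <= 1 -> 0 <= y <= 1 -> 0 < 1 + wgt beta * agree x y.
  by move=> x01 y01; apply: fac_gt0 => //; case/andP: (agree01 x01 y01).
rewrite /MessageAlgebra.eterm -!lnM ?posrE ?P // ; apply: ln_le; first by rewrite mulr_gt0 ?P.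
rewrite -subr_ge0.
have w0 := wgt_ge0 b0; set w := wgt beta in w0 *.
rewrite [X in 0 <= X](_ : _ = (w + w / k1 + w ^+ 2 / k1) * ((a' - a) * (b' - b))).
  have kV : 0 <= k1^-1 by rewrite invr_ge0 ltW.
  by apply: mulr_ge0 => //; apply: addr_ge0; [apply: addr_ge0 => //|]; apply: mulr_ge0; rewrite ?sqr_ge0.
by move: kn0; rewrite !agreeE; move: k1 => k kn; field.
Qed.

(** Probability of colour 0 at the parent end of an edge, in the two-vertex measure with message [a]
    from the child and [a'] from the parent. *)
Definition pstar beta a a' := a' * (1 + wgt beta * a) / (1 + wgt beta * agree a a').

Lemma pstar_compl beta a a' : 0 <= beta -> 0 <= a <= 1 -> 0 <= a' <= 1 ->
  1 - pstar beta a a' = k1 * (bb a' * (1 + wgt beta * bb a)) / (1 + wgt beta * agree a a').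
Proof.
move=> b0 a1 a2.
have P : 1 + wgt beta * agree a a' != 0.
  by rewrite lt0r_neq0 // fac_gt0 //; case/andP: (agree01 a1 a2).
apply: (mulIf P); rewrite /pstar mulrBl mul1r !mulfVK // facE; ring.
Qed.

Lemma pstar_itv beta a a' : 0 <= beta -> 0 <= a <= 1 -> 0 <= a' <= 1 -> 0 <= pstar beta a a' <= 1.
Proof.
move=> b0 a1 a2; have P : 0 < 1 + wgt beta * agree a a'.
  by rewrite fac_gt0 //; case/andP: (agree01 a1 a2).
have h : 0 <= pstar beta a a'.
  apply: divr_ge0; last exact: ltW.
  apply: mulr_ge0; first by case/andP: a2.
  by rewrite ltW // fac_gt0 //; case/andP: a1.
rewrite h /= -subr_ge0 pstar_compl //; apply: divr_ge0; last exact: ltW.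
case/andP: a1 => ? ?; case/andP: a2 => ? ?.
apply: mulr_ge0; first exact: ltW.
by apply: mulr_ge0; [exact: bb_ge0|apply/ltW/fac_gt0 => //; apply: bb_ge0].
Qed.

(** Replacing the child's message multiplies the edge partition function by the mean, over the
    colour of the parent under the edge measure, of the ratio of the child's factors. *)
Lemma eterm_diff beta a a' ah : 0 <= beta -> 0 <= a <= 1 -> 0 <= a' <= 1 -> 0 <= ah <= 1 ->
  eterm beta ah a' - eterm beta a a' =
  ln (pstar beta a a' * ((1 + wgt beta * ah) / (1 + wgt beta * a)) +
      (1 - pstar beta a a') * ((1 + wgt beta * bb ah) / (1 + wgt beta * bb a))).
Proof.
move=> b0 a1 a2 a3.
have P x y : 0 <= x <= 1 -> 0 <= y <= 1 -> 0 < 1 + wgt beta * agree x y.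
  by move=> x01 y01; apply: fac_gt0 => //; case/andP: (agree01 x01 y01).
have Q0 : 1 + wgt beta * a != 0 by rewrite lt0r_neq0 // fac_gt0 //; case/andP: a1.
have Q1 : 1 + wgt beta * bb a != 0.
  by rewrite lt0r_neq0 // fac_gt0 // bb_ge0 //; case/andP: a1.
rewrite /MessageAlgebra.eterm lnB ?P // pstar_compl // /pstar; congr ln.
have F0 := lt0r_neq0 (P _ _ a1 a2).
rewrite (facE beta ah a'); field.
by rewrite F0 Q0 Q1.
Qed.

(** The right side is the derivative of [eterm] in [beta] at fixed messages: the agreement
    probability seen from the root is the explicit derivative of the edge term. *)
Lemma edgep_pstar beta a a' : 0 <= beta -> 0 <= a <= 1 -> 0 <= a' <= 1 ->
  edgep beta (pstar beta a a') a = rr beta (agree a a').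
Proof.
move=> b0 a1 a2; rewrite /MessageAlgebra.edgep.
have -> x : k1 * (bb (pstar beta a a') * x) = (1 - pstar beta a a') * x.
  by rewrite mulrA /MessageAlgebra.bb [k1 * _]mulrC mulfVK.
have F0 : 1 + wgt beta * agree a a' != 0.
  by rewrite lt0r_neq0 // fac_gt0 //; case/andP: (agree01 a1 a2).
have Q0 : 1 + wgt beta * a != 0 by rewrite lt0r_neq0 // fac_gt0 //; case/andP: a1.
have Q1 : 1 + wgt beta * bb a != 0.
  by rewrite lt0r_neq0 // fac_gt0 // bb_ge0 //; case/andP: a1.
rewrite pstar_compl // /pstar /rr.
have -> : (1 + wgt beta) * agree a a' = (1 + wgt beta) * (a' * a + k1 * (bb a' * bb a)).
  by rewrite /MessageAlgebra.agree; ring.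
by field; rewrite F0 Q0 Q1.
Qed.

Lemma rr_itv beta c : 0 <= beta -> 0 <= c <= 1 -> 0 <= rr beta c <= 1.
Proof.
move=> b0 /andP[c0 c1]; have w0 := wgt_ge0 b0; have P := fac_gt0 b0 c0.
rewrite /rr; apply/andP; split.
  by apply: divr_ge0; [rewrite mulr_ge0 // addr_ge0|exact: ltW].
by rewrite ler_pdivrMr // mul1r mulrDl mul1r lerD2r.
Qed.

(** The ratio is the exponential moment of a Bernoulli variable of mean [rr beta c]; its logarithm
    is then bounded below by Jensen and above by [ln_expR_quad]. *)
Lemma fac_shift beta beta' c : 0 <= beta -> 0 <= c <= 1 ->
  (1 + wgt beta' * c) / (1 + wgt beta * c) =
  rr beta c * expR (beta' - beta) + (1 - rr beta c).
Proof.
move=> b0 /andP[c0 c1]; have P := lt0r_neq0 (fac_gt0 b0 c0).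
have e0 : expR beta != 0 by rewrite lt0r_neq0 // expR_gt0.
rewrite /rr expRD expRN; rewrite /wgt in P *; field.
by rewrite P e0.
Qed.

Lemma fac_ge beta beta' c : 0 <= beta -> 0 <= beta' -> 0 <= c <= 1 ->
  (beta' - beta) * rr beta c <= ln (1 + wgt beta' * c) - ln (1 + wgt beta * c).
Proof.
move=> b0 b1 c01; have /andP[c0 c1] := c01; rewrite lnB ?fac_gt0 // fac_shift //.
by rewrite mulrC jensen_expR // rr_itv.
Qed.

Lemma fac_le beta beta' c : 0 <= beta -> 0 <= beta' -> 0 <= c <= 1 ->
  `|beta' - beta| <= 2^-1 ->
  ln (1 + wgt beta' * c) - ln (1 + wgt beta * c) <=
  (beta' - beta) * rr beta c + 2 * (beta' - beta) ^+ 2.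
Proof.
move=> b0 b1 c01 db; have /andP[c0 c1] := c01; rewrite lnB ?fac_gt0 // fac_shift //.
by rewrite [_ * rr _ _]mulrC ln_expR_quad // rr_itv.
Qed.

Section Vertex.
Variables (D : nat).
Implicit Types (x y : nat -> R).
Local Notation dom x := (forall j, (j < D)%N -> 0 <= x j <= 1).

(** Again a mean of ratios, now over the root colour under its marginal, all colours but 0 sharing
    one ratio. Both Jensen ([vertex_ge]) and association ([vertex_super]) start from this
    identity. *)
Lemma vertex_diff p p' x y : 0 <= p.1 -> 0 <= p'.1 -> dom x -> dom y ->
  ln (zz p'.1 p'.2 D y) - ln (zz p.1 p.2 D x) =
  ln (bp p D x * (expR (p'.2 - p.2) *
        \prod_(j < D) ((1 + wgt p'.1 * y j) / (1 + wgt p.1 * x j))) +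
     (1 - bp p D x) *
        \prod_(j < D) ((1 + wgt p'.1 * bb (y j)) / (1 + wgt p.1 * bb (x j)))).
Proof.
move=> b0 b1 dx dy; rewrite lnB ?zz_gt0 //; congr ln.
have zx := lt0r_neq0 (zz_gt0 q p.2 b0 dx).
have n0 : nn0 p.1 p.2 D x != 0 by rewrite lt0r_neq0 // nn0_gt0 // => j /dx /andP[].
have n1 : nn1 p.1 D x != 0 by rewrite lt0r_neq0 // nn1_gt0 // => j /dx /andP[].
have -> : 1 - bp p D x = k1 * nn1 p.1 D x / zz p.1 p.2 D x.
  by apply: (mulIf zx); rewrite /MessageAlgebra.bp mulrBl !mulfVK // mul1r /MessageAlgebra.zz; ring.
rewrite !prodf_div.
have e0 : expR p.2 != 0 by rewrite lt0r_neq0 // expR_gt0.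
rewrite /MessageAlgebra.bp expRD expRN {1}/MessageAlgebra.zz.
move: n0 n1 zx; rewrite /MessageAlgebra.nn0 /MessageAlgebra.nn1 mulf_eq0 negb_or => /andP[_ P0] P1 zx.
by field; rewrite zx P1 P0 e0.
Qed.

Lemma ln_prod (F : nat -> R) : (forall j, (j < D)%N -> 0 < F j) ->
  ln (\prod_(j < D) F j) = \sum_(j < D) ln (F j).
Proof.
elim: D => [|d IH] F0; first by rewrite !big_ord0 ln1.
have F' : forall j, (j < d)%N -> 0 < F j by move=> j jd; apply: F0; apply: ltnW.
rewrite !big_ord_recr /= lnM ?posrE ?IH //; last exact: F0.
by apply: prodr_gt0 => j _; apply: F'.
Qed.

Lemma vertex_ge p p' x y : 0 <= p.1 -> 0 <= p'.1 -> dom x -> dom y ->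
  bp p D x * (p'.2 - p.2) +
  \sum_(j < D) (bp p D x * (ln (1 + wgt p'.1 * y j) - ln (1 + wgt p.1 * x j)) +
    (1 - bp p D x) * (ln (1 + wgt p'.1 * bb (y j)) - ln (1 + wgt p.1 * bb (x j)))) <=
  ln (zz p'.1 p'.2 D y) - ln (zz p.1 p.2 D x).
Proof.
move=> b0 b1 dx dy; rewrite vertex_diff //.
have f0 b z : 0 <= b -> dom z -> forall j, (j < D)%N -> 0 < 1 + wgt b * z j.
  by move=> b2 dz j jD; apply: fac_gt0 => //; case/andP: (dz j jD).
have f1 b z : 0 <= b -> dom z -> forall j, (j < D)%N -> 0 < 1 + wgt b * bb (z j).
  by move=> b2 dz j jD; apply: fac_gt0; rewrite ?bb_ge0 //; case/andP: (dz j jD).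
apply: le_trans (jensen_ln _ _ _); last 3 first.
- exact: bp_itv.
- rewrite mulr_gt0 ?expR_gt0 // prodr_gt0 // => j _; rewrite divr_gt0 ?f0 //.
- by rewrite prodr_gt0 // => j _; rewrite divr_gt0 ?f1.
rewrite lnM ?posrE ?expR_gt0 //; last by rewrite prodr_gt0 // => j _; rewrite divr_gt0 ?f0.
rewrite expRK (@ln_prod (fun j => (1 + wgt p'.1 * y j) / (1 + wgt p.1 * x j))); last first.
  by move=> j jD; rewrite divr_gt0 ?f0.
rewrite (@ln_prod (fun j => (1 + wgt p'.1 * bb (y j)) / (1 + wgt p.1 * bb (x j)))); last first.
  by move=> j jD; rewrite divr_gt0 ?f1.
rewrite big_split /= -!mulr_sumr addrA -mulrDr lerD // ler_wpM2l //.
- by case/andP: (@bp_itv R q p D x b0 dx).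
- by rewrite lerD2l ler_sum // => j _; rewrite lnB ?f0.
- by rewrite subr_ge0; case/andP: (@bp_itv R q p D x b0 dx).
- by rewrite ler_sum // => j _; rewrite lnB ?f1.
Qed.
End Vertex.
End Scalar.

End EdgeTerms.
Import EdgeTerms.

(** * Increments of the Bethe functional at a single root *)

Module BetheIncrements.
Local Close Scope classical_set_scope.

Section BetheStep.
Variables (R : realType) (q : nat).
Local Notation k1 := (q.+1%:R : R).
Local Notation bb := (@bb R q).
Local Notation agree := (@agree R q).
Local Notation eterm := (@eterm R q).
Local Notation edgep := (@edgep R q).
Local Notation bp := (@bp R q).
Local Notation zz := (@zz R q).
Local Notation nn1 := (@nn1 R q).
Local Notation pstar := (@pstar R q).
Local Notation msgdom := (@msgdom R q).
Implicit Types (a b c beta : R) (p : R * R) (x y : nat -> R).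

Let k0 : 0 < k1 := k1_gt0 R q.
Let kn0 : k1 != 0 := k1_neq0 R q.

(** The same renumbering of children as in [remove_child]. *)
Definition skip (j : nat) x := fun i => x (if (i < j)%N then i else i.+1).

Lemma prod_skip (F : nat -> R) D j : (j < D)%N ->
  \prod_(i < D) F i = F j * \prod_(i < D.-1) skip j F i.
Proof.
case: D => // D; rewrite ltnS /= => jD.
rewrite -!(big_mkord xpredT) /skip (big_cat_nat _ jD) //= [LHS](big_cat_nat _ (leqW jD)) //=.
rewrite (@big_ltn _ _ _ j D.+1) ?ltnS // mulrCA; congr (_ * (_ * _)).
  by rewrite big_nat [RHS]big_nat; apply: eq_bigr => i /andP[_ ->].
rewrite big_add1 big_nat [RHS]big_nat /=; apply: eq_bigr => i /andP[ji _].
by rewrite ltnNge ji.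
Qed.

(** Bayes' rule: the message that ignores child [j], multiplied by the factor of child [j], restores
    the product over all children. *)
Lemma cavity_pstar p D x j : (j < D)%N -> 0 <= p.1 ->
  (forall i, (i < D)%N -> 0 <= x i <= 1) ->
  pstar p.1 (x j) (bp p D.-1 (skip j x)) = bp p D x.
Proof.
move=> jD b0 dx.
have dx' i : (i < D.-1)%N -> 0 <= skip j x i <= 1.
  move=> iD; have iD' : (i.+1 < D)%N by rewrite -(ltn_predK jD).
  by apply: dx; case: ifP => // _; apply: ltnW.
have z0 := lt0r_neq0 (zz_gt0 q p.2 b0 dx').
have Z0 := lt0r_neq0 (zz_gt0 q p.2 b0 dx).
have E0 : nn0 p.1 p.2 D x = (1 + wgt p.1 * x j) * nn0 p.1 p.2 D.-1 (skip j x).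
  by rewrite /nn0 (prod_skip (fun i => 1 + wgt p.1 * x i) jD); ring.
have E1 : nn1 p.1 D x = (1 + wgt p.1 * bb (x j)) * nn1 p.1 D.-1 (skip j x).
  by rewrite /MessageAlgebra.nn1 (prod_skip (fun i => 1 + wgt p.1 * bb (x i)) jD).
rewrite /EdgeTerms.pstar facE bb_bp // /MessageAlgebra.bp.
set z := zz _ _ _ (skip j x) in z0 *.
set A := nn0 _ _ D.-1 _ in E0 *; set B := nn1 _ D.-1 _ in E1 *.
set X := 1 + _ in E0 *; set Y := 1 + wgt p.1 * bb (x j) in E1 *.
rewrite (_ : A / z * X + k1 * (B / z * Y) = zz p.1 p.2 D x / z); last first.
  by rewrite /MessageAlgebra.zz E0 E1; field.
rewrite E0; move: Z0; set Z := zz _ _ D x => Z0; field.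
by rewrite Z0 z0.
Qed.

Local Notation dom D x := (forall j, (j < D)%N -> 0 <= x j <= 1).

(* Message updates in a common direction move the vertex term by more than the sum of its one-message increments. *)
Lemma vertex_super p D x y (a' : nat -> R) : 0 <= p.1 -> dom D x -> dom D y -> dom D a' ->
  (forall j, (j < D)%N -> pstar p.1 (x j) (a' j) = bp p D x) ->
  (forall j, (j < D)%N -> x j <= y j) \/ (forall j, (j < D)%N -> y j <= x j) ->
  \sum_(j < D) (eterm p.1 (y j) (a' j) - eterm p.1 (x j) (a' j)) <=
    ln (zz p.1 p.2 D y) - ln (zz p.1 p.2 D x).
Proof.
move=> b0 dx dy da hp dir; rewrite vertex_diff // subrr expR0 mul1r.
have P01 := @bp_itv R q p D x b0 dx.
have f0 z : dom D z -> forall j, (j < D)%N -> 0 < 1 + wgt p.1 * z j.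
  by move=> dz j jD; apply: fac_gt0 => //; case/andP: (dz j jD).
have f1 z : dom D z -> forall j, (j < D)%N -> 0 < 1 + wgt p.1 * bb (z j).
  by move=> dz j jD; apply: fac_gt0; rewrite ?bb_ge0 //; case/andP: (dz j jD).
pose X j := (1 + wgt p.1 * y j) / (1 + wgt p.1 * x j).
pose Y j := (1 + wgt p.1 * bb (y j)) / (1 + wgt p.1 * bb (x j)).
have X0 j : (j < D)%N -> 0 < X j by move=> jD; rewrite divr_gt0 ?f0.
have Y0 j : (j < D)%N -> 0 < Y j by move=> jD; rewrite divr_gt0 ?f1.
rewrite (eq_bigr (fun j : 'I_D => ln (bp p D x * X j + (1 - bp p D x) * Y j))); last first.
  by move=> j _; rewrite eterm_diff ?dx ?dy ?da ?hp.
rewrite -(@ln_prod R D (fun j => bp p D x * X j + (1 - bp p D x) * Y j)); last first.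
  by move=> j jD; rewrite jensen_pos ?X0 ?Y0 ?bp_itv.
apply: ln_le.
  by rewrite prodr_gt0 // => j _; rewrite jensen_pos ?X0 ?Y0 ?bp_itv.
have w0 := wgt_ge0 b0.
apply: (@prod_assoc R _ D X Y); first exact: bp_itv.
  by move=> j jD; split; [exact: X0|exact: Y0].
case: dir => h; [left|right] => j jD; have hj := h j jD.
  apply: (@le_trans _ _ 1).
    by rewrite ler_pdivrMr ?f1 // mul1r lerD2l ler_wpM2l // bb_anti.
  by rewrite ler_pdivlMr ?f0 // mul1r lerD2l ler_wpM2l.
apply: (@le_trans _ _ 1).
  by rewrite ler_pdivrMr ?f0 // mul1r lerD2l ler_wpM2l.
by rewrite ler_pdivlMr ?f1 // mul1r lerD2l ler_wpM2l // bb_anti.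
Qed.

(** With messages frozen, Jensen gives each child [edgep] times the coupling increment from the
    vertex term. The edge term takes back half of it, up to half of the error
    [2 * (p'.1 - p.1) ^+ 2] of [fac_le]; this is the error of one squared increment per child. *)
Lemma bethe_param_ge p p' D x (a' : nat -> R) : 0 <= p.1 -> 0 <= p'.1 -> dom D x -> dom D a' ->
  (forall j, (j < D)%N -> pstar p.1 (x j) (a' j) = bp p D x) ->
  `|p'.1 - p.1| <= 2^-1 ->
  (p'.2 - p.2) * bp p D x + (p'.1 - p.1) * (2^-1 * \sum_(j < D) edgep p.1 (bp p D x) (x j))
    - (p'.1 - p.1) ^+ 2 * D%:R <=
  ln (zz p'.1 p'.2 D x) - ln (zz p.1 p.2 D x) -
  2^-1 * \sum_(j < D) (eterm p'.1 (x j) (a' j) - eterm p.1 (x j) (a' j)).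
Proof.
move=> b0 b1 dx da hp db.
have := @vertex_ge R q D p p' x x b0 b1 dx dx; set P := bp p D x in hp *.
have P01 : 0 <= P <= 1 := @bp_itv R q p D x b0 dx.
move=> h; apply: le_trans (lerB h (lexx _)).
rewrite [P * _]mulrC -!addrA lerD2l mulr_sumr mulr_sumr mulr_sumr mulr_natr -[X in - (_ *+ X)]card_ord.
rewrite -sumr_const -!sumrB ler_sum // => j _.
have xj := dx j (ltn_ord j); have aj := da j (ltn_ord j).
have /andP[x0 x1] := xj; have /andP[P0 P1] := P01.
have bbj : 0 <= bb (x j) <= 1.
  rewrite bb_ge0 //= /MessageAlgebra.bb ler_pdivrMr // mul1r (le_trans (y := 1)) ?ler1n //; lra.
have h1 := ler_wpM2l P0 (fac_ge b0 b1 xj).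
have P1' : 0 <= 1 - P by rewrite subr_ge0.
have h2 := ler_wpM2l P1' (fac_ge b0 b1 bbj).
have h3 := fac_le b0 b1 (agree01 q xj aj) db.
rewrite -edgep_pstar // hp // in h3.
have ed : edgep p.1 P (x j) = P * rr p.1 (x j) + (1 - P) * rr p.1 (bb (x j)).
  by rewrite /MessageAlgebra.edgep mulrA /MessageAlgebra.bb [k1 * _]mulrC mulfVK.
rewrite /MessageAlgebra.eterm; move: h3; rewrite ed; lra.
Qed.

Definition comparable_step (up : bool) a b := if up then a <= b else b <= a.

(* Upper bound for the increment of the Bethe functional between two comparable fixed points; the edge increments at the
   new parameters are taken with the second message frozen. *)
Lemma bethe_step_le up p p' D x y (a' : nat -> R) (C : R) : 0 <= p.1 -> 0 <= p'.1 ->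
  2 * wgt p'.1 <= C ->
  (forall j, (j < D)%N -> msgdom (x j)) -> (forall j, (j < D)%N -> msgdom (y j)) ->
  (forall j, (j < D)%N -> msgdom (a' j)) ->
  (forall j, (j < D)%N -> pstar p.1 (x j) (a' j) = bp p D x) ->
  `|p'.1 - p.1| <= 2^-1 -> comparable_step up p.1 p'.1 ->
  (forall j, (j < D)%N -> comparable_step up (x j) (y j)) ->
  comparable_step up (bp p D x) (bp p' D y) -> 
  forall P P' : R, P = bp p D x -> P' = bp p' D y ->
  ln (zz p'.1 p'.2 D y) - ln (zz p.1 p.2 D x)
    - \sum_(j < D) (eterm p'.1 (y j) (a' j) - eterm p'.1 (x j) (a' j))
    - 2^-1 * \sum_(j < D) (eterm p'.1 (x j) (a' j) - eterm p.1 (x j) (a' j)) <=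
  (p'.2 - p.2) * P + (p'.1 - p.1) * (2^-1 * \sum_(j < D) edgep p.1 P (x j))
  + (`|p'.2 - p.2| * `|P' - P| + \sum_(j < D) (C * (`|P' - P| * `|y j - x j|) +
      (`|p'.1 - p.1| * `|P' - P| + 2 * (p'.1 - p.1) ^+ 2))).
Proof.
move=> b0 b1 hC mx my ma hp db dirb dirx dirP _ _ -> ->; set P := bp p D x; set P' := bp p' D y.
have dx : dom D x by move=> j /mx /dom01.
have dy : dom D y by move=> j /my /dom01.
have da : dom D a' by move=> j /ma /dom01.
have P01 : 0 <= P <= 1 := @bp_itv R q p D x b0 dx.
have P01' : 0 <= P' <= 1 := @bp_itv R q p' D y b1 dy.
have w0 := wgt_ge0 b1.
(* Jensen is applied from the new parameters back to the old ones, with the new marginal [P'] as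
   weight, so that a lower bound turns into an upper one. *)
have V := @vertex_ge R q D p' p y x b1 b0 dy dx; rewrite -/P' in V.
suff S : P' * (p'.2 - p.2) +
  \sum_(j < D) (P' * (ln (1 + wgt p'.1 * y j) - ln (1 + wgt p.1 * x j)) +
    (1 - P') * (ln (1 + wgt p'.1 * bb (y j)) - ln (1 + wgt p.1 * bb (x j)))) 
    - \sum_(j < D) (eterm p'.1 (y j) (a' j) - eterm p'.1 (x j) (a' j))
    - 2^-1 * \sum_(j < D) (eterm p'.1 (x j) (a' j) - eterm p.1 (x j) (a' j)) <=
  (p'.2 - p.2) * P + (p'.1 - p.1) * (2^-1 * \sum_(j < D) edgep p.1 P (x j))
  + (`|p'.2 - p.2| * `|P' - P| + \sum_(j < D) (C * (`|P' - P| * `|y j - x j|) +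
      (`|p'.1 - p.1| * `|P' - P| + 2 * (p'.1 - p.1) ^+ 2))).
  apply: le_trans S; rewrite lerD2r lerD2r.
  rewrite -lerN2 opprB; apply: le_trans V; rewrite le_eqVlt; apply/orP; left; apply/eqP.
  rewrite opprD -sumrN; congr (_ + _); first by ring.
  by apply: eq_bigr => j _; ring.
rewrite [leRHS](_ : _ = ((p'.2 - p.2) * P + `|p'.2 - p.2| * `|P' - P|) +
   ((p'.1 - p.1) * (2^-1 * \sum_(j < D) edgep p.1 P (x j)) +
   \sum_(j < D) (C * (`|P' - P| * `|y j - x j|) +
      (`|p'.1 - p.1| * `|P' - P| + 2 * (p'.1 - p.1) ^+ 2)))); last by ring.
rewrite -!addrA [leRHS]addrA; apply: lerD.
  have := ler_norm ((p'.2 - p.2) * (P' - P)); rewrite normrM; lra.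
rewrite !mulr_sumr -!sumrN -!big_split /= ler_sum // => j _.
have mxj := mx j (ltn_ord j); have myj := my j (ltn_ord j).
have xj := dom01 mxj; have yj := dom01 myj; have aj := da j (ltn_ord j).
have bx := dombb mxj; have by' := dombb myj.
set u := bb (x j) in bx *; set v := bb (y j) in by' *.
have F0 z : 0 <= z <= 1 -> 0 < 1 + wgt p'.1 * z by move=> /andP[z0 _]; apply: fac_gt0.
set X := ln (1 + wgt p'.1 * y j) - ln (1 + wgt p'.1 * x j).
set Y := ln (1 + wgt p'.1 * v) - ln (1 + wgt p'.1 * u).
have ps := pstar_itv q b1 xj aj; set ps' := pstar p'.1 (x j) (a' j) in ps.
have E1 : ps' * X + (1 - ps') * Y <= eterm p'.1 (y j) (a' j) - eterm p'.1 (x j) (a' j).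
  rewrite eterm_diff // -/ps' -/u -/v /X /Y !lnB ?F0 //.
  by apply: jensen_ln => //; rewrite divr_gt0 ?F0.
have E2 := fac_ge b0 b1 (agree01 q xj aj).
rewrite -edgep_pstar // hp // -/P in E2.
have ed : edgep p.1 P (x j) = P * rr p.1 (x j) + (1 - P) * rr p.1 u.
  by rewrite /MessageAlgebra.edgep mulrA [bb P]/MessageAlgebra.bb [k1 * _]mulrC mulfVK.
have L1 := fac_le b0 b1 xj db; have L2 := fac_le b0 b1 bx db.
have /andP[P0' P1'] := P01'; have P1n : 0 <= 1 - P' by rewrite subr_ge0.
have L1' := ler_wpM2l P0' L1; have L2' := ler_wpM2l P1n L2.
have r0 := rr_itv b0 xj; have r1 := rr_itv b0 bx.
have E3 : (p'.1 - p.1) * ((P' - P) * (rr p.1 (x j) - rr p.1 u)) <= `|p'.1 - p.1| * `|P' - P|.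
  apply: le_trans (ler_norm _) _; rewrite normrM ler_wpM2l // normrM ler_piMr //.
  by rewrite ler_norml; move: r0 r1; lra.
have Xle : `|X - Y| <= C * `|y j - x j|.
  apply: (@le_trans _ _ (2 * wgt p'.1 * `|y j - x j|)); last exact: ler_wpM2r.
  have lip s r : 0 <= s <= 1 -> 0 <= r <= 1 -> s <= r ->
     0 <= ln (1 + wgt p'.1 * r) - ln (1 + wgt p'.1 * s) <= wgt p'.1 * (r - s).
    move=> s01 r01 sr; apply/andP; split.
      by rewrite subr_ge0; apply: ln_le; rewrite ?F0 // lerD2l ler_wpM2l.
    apply: le_trans (lnB_le (F0 _ r01) (F0 _ s01)) _.
    rewrite ler_pdivrMr ?F0 // [1 + _ - _](_ : _ = wgt p'.1 * (r - s)); last by ring.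
    rewrite ler_peMr //; first by rewrite mulr_ge0 // subr_ge0.
    by rewrite lerDl mulr_ge0 //; case/andP: s01.
  have bbd s r : bb s - bb r = (r - s) / k1 by rewrite /MessageAlgebra.bb -mulrBl; congr (_ / _); ring.
  have kV : k1^-1 <= 1 by rewrite invf_le1 // ler1n.
  have bl s r : s <= r -> wgt p'.1 * (bb s - bb r) <= wgt p'.1 * (r - s).
    by move=> sr; rewrite ler_wpM2l // bbd ler_piMr // subr_ge0.
  have [yx|/ltW xy] := lerP (y j) (x j).
    have /andP[l1 l2] := lip _ _ yj xj yx; have /andP[l3 l4] := lip _ _ bx by' (bb_anti q yx).
    have l5 := bl _ _ yx; rewrite -/u -/v in l5.
    by rewrite ler_norml /X /Y; apply/andP; split; lra.
  have /andP[l1 l2] := lip _ _ xj yj xy; have /andP[l3 l4] := lip _ _ by' bx (bb_anti q xy).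
  have l5 := bl _ _ xy; rewrite -/u -/v in l5.
  by rewrite ler_norml /X /Y; apply/andP; split; lra.
(* The only discrepancy of first order: the vertex bound carries the weight [P'], the edge increment
   the weight [ps']. As [ps'] lies beyond [P] in the direction of the step and [X - Y] has the sign
   of that direction, [ps'] may be replaced by [P], which leaves a product of two message jumps. *)
have XYs : (P' - ps') * (X - Y) <= C * (`|P' - P| * `|y j - x j|).
  have Pps : comparable_step up P ps'.
    rewrite /ps' -[P](hp j (ltn_ord j)).
    have /andP[a0 a1] := aj; have /andP[x0 x1] := xj.
    have ux : u <= x j by apply: bb_le; case/andP: mxj.
    have bb0 : 0 <= bb (a' j) by apply: bb_ge0.
    (* A stronger coupling helps colour 0 because the child's message favours it, [u <= x j]. *)
    have pm s r : 0 <= s -> 0 <= r -> s <= r -> pstar s (x j) (a' j) <= pstar r (x j) (a' j).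
      move=> s0 r0' sr; have G z : 0 <= z -> 0 < 1 + wgt z * agree (x j) (a' j).
        by move=> z0; apply: fac_gt0 => //; case/andP: (agree01 q xj aj).
      rewrite /EdgeTerms.pstar ler_pdivrMr ?G // mulrAC ler_pdivlMr ?G // !facE -/u -subr_ge0.
      have ws : 0 <= wgt r - wgt s by rewrite /wgt; have := ler_expR s r; rewrite sr; lra.
      rewrite [X in 0 <= X](_ : _ = k1 * (a' j * bb (a' j) * ((wgt r - wgt s) * (x j - u)))).
        by rewrite !mulr_ge0 // ?subr_ge0 // ltW.
      ring.
    by rewrite /comparable_step; move: dirb; rewrite /comparable_step; case: (up) => h; apply: pm.
  have XY : if up then 0 <= X - Y else X - Y <= 0.
    have dj := dirx j (ltn_ord j); move: dj; rewrite /comparable_step; case: (up) => h.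
      have h1 : 0 <= X by rewrite subr_ge0; apply: ln_le; rewrite ?F0 // lerD2l ler_wpM2l.
      have h2 : Y <= 0.
        by rewrite subr_le0; apply: ln_le; rewrite ?F0 // lerD2l ler_wpM2l // /u /v bb_anti.
      lra.
    have h1 : X <= 0 by rewrite subr_le0; apply: ln_le; rewrite ?F0 // lerD2l ler_wpM2l.
    have h2 : 0 <= Y.
      by rewrite subr_ge0; apply: ln_le; rewrite ?F0 // lerD2l ler_wpM2l // /u /v bb_anti.
    lra.
  apply: (@le_trans _ _ (`|P' - P| * `|X - Y|)); last first.
    by rewrite mulrCA ler_wpM2l.
  move: Pps XY dirP; rewrite /comparable_step -/P -/P'; case: (up) => h1 h2 h3.
    rewrite (ger0_norm h2) ler_wpM2r // (le_trans _ (ler_norm _)) //; lra.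
  rewrite (ler0_norm h2) -mulrNN ler_wpM2r ?oppr_ge0 // (ler0_norm (x := P' - P)) ?subr_le0 //; lra.
rewrite /MessageAlgebra.eterm in E2 E1 *.
move: E1 E2 L1' L2' E3 XYs; rewrite ed /X /Y; lra.
Qed.
End BetheStep.

End BetheIncrements.
Import BetheIncrements.

(** * Monotonicity and limits of the message iterations *)

Section MessageLimits.
Variables (R : realType) (q : nat).
Local Notation k1 := (q.+1%:R : R).
Local Notation qi := (q.+2%:R^-1 : R).
Local Notation bb := (@bb R q).
Local Notation bp := (@bp R q).
Local Notation zz := (@zz R q).
Local Notation pstar := (@pstar R q).
Local Notation msgdom := (@msgdom R q).
Local Notation msg := (@msg R q).
Local Notation cmp := (@comparable_step R).
Implicit Types (p : R * R) (x y : nat -> R) (up : bool) (T : ptree) (l : seq (R * R)).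

Let k0 : 0 < k1 := k1_gt0 R q.
Let kn0 : k1 != 0 := k1_neq0 R q.
Local Notation mdom D x := (forall j, (j < D)%N -> msgdom (x j)).

Definition nonneg p := (0 <= p.1) && (0 <= p.2).

Lemma bpE_ratio (a b c d : R) : 0 < a -> 0 < b -> 0 < c -> 0 < d -> a * d <= c * b ->
  a / (a + k1 * b) <= c / (c + k1 * d).
Proof.
move=> a0 b0 c0 d0 h.
rewrite ler_pdivrMr ?addr_gt0 ?mulr_gt0 // mulrAC ler_pdivlMr ?addr_gt0 ?mulr_gt0 //.
have := ler_wpM2l (ltW k0) h; lra.
Qed.

(** Compare odds: after cross-multiplication the claim factors over the children. For one child the
    larger coupling is moved from the factor of another colour to that of colour 0, which does not
    decrease the product because [bb (x j) <= x j]. *)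
Lemma bp_mono p p' D x y : nonneg p -> p.1 <= p'.1 -> p.2 <= p'.2 -> mdom D x -> mdom D y ->
  (forall j, (j < D)%N -> x j <= y j) -> bp p D x <= bp p' D y.
Proof.
move=> /andP[b0 B0] h1 h2 mx my xy; have b1 := le_trans b0 h1.
have w0 := wgt_ge0 b0; have w1 := wgt_ge0 b1.
have ww : wgt p.1 <= wgt p'.1 by rewrite /wgt lerD2r ler_expR.
have f0 b z : 0 <= b -> mdom D z -> forall j, (j < D)%N -> 0 < 1 + wgt b * z j.
  by move=> b2 dz j jD; apply: fac_gt0 => //; case/andP: (dom01 (dz j jD)).
have f1 b z : 0 <= b -> mdom D z -> forall j, (j < D)%N -> 0 < 1 + wgt b * bb (z j).
  by move=> b2 dz j jD; apply: fac_gt0 => //; case/andP: (dombb (dz j jD)).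
apply: bpE_ratio.
- by apply: nn0_gt0 => // j /mx /dom01 /andP[].
- by apply: nn1_gt0 => // j /mx /andP[].
- by apply: nn0_gt0 => // j /my /dom01 /andP[].
- by apply: nn1_gt0 => // j /my /andP[].
rewrite /nn0 /MessageAlgebra.nn1 -!mulrA; apply: ler_pM; rewrite ?expR_ge0 ?ler_expR //.
  by rewrite mulr_ge0 // prodr_ge0 // => j _; rewrite ltW ?f0 ?f1.
rewrite -!big_split /=; apply: ler_prod => j _.
apply/andP; split; first by rewrite mulr_ge0 // ltW // (f0, f1).
have mxj := mx j (ltn_ord j); have myj := my j (ltn_ord j).
have /andP[x0 x1] := dom01 mxj; have xyj := xy j (ltn_ord j).
have bx : bb (x j) <= x j by apply: bb_le; case/andP: mxj.
have by' : bb (y j) <= bb (x j) by apply: bb_anti.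
have bx0 : 0 <= bb (x j) by case/andP: (dombb mxj).
apply: (@le_trans _ _ ((1 + wgt p.1 * x j) * (1 + wgt p'.1 * bb (x j)))).
  by rewrite ler_wpM2l ?lerD2l ?ler_wpM2l // ltW // f0.
apply: (@le_trans _ _ ((1 + wgt p'.1 * x j) * (1 + wgt p.1 * bb (x j)))); last first.
  by rewrite ler_wpM2r ?lerD2l ?ler_wpM2l // ltW // f1.
have : 0 <= (wgt p'.1 - wgt p.1) * (x j - bb (x j)) by rewrite mulr_ge0 // subr_ge0.
lra.
Qed.

(** Colour 0 keeps at least the uniform mass, since the field and all incoming messages favour
    it. *)
Lemma bp_dom p D x : nonneg p -> mdom D x -> msgdom (bp p D x).
Proof.
move=> /andP[b0 B0] mx; have dx : forall j, (j < D)%N -> 0 <= x j <= 1 by move=> j /mx /dom01.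
apply/andP; split; last by case/andP: (@bp_itv R q p D x b0 dx).
have h : @MessageAlgebra.nn1 R q p.1 D x <= nn0 p.1 p.2 D x.
  rewrite /nn0 /MessageAlgebra.nn1 -[leLHS]mul1r; apply: ler_pM => //.
  - by rewrite prodr_ge0 // => j _; rewrite ltW // fac_gt0 // bb_ge0 //; case/andP: (mx j (ltn_ord j)).
  - by rewrite -expR0 ler_expR.
  apply: ler_prod => j _; have mj := mx j (ltn_ord j).
  rewrite ltW ?fac_gt0 //=; last by case/andP: (dombb mj).
  by rewrite lerD2l ler_wpM2l ?wgt_ge0 // bb_le //; case/andP: mj.
rewrite /MessageAlgebra.bp ler_pdivlMr ?zz_gt0 // /MessageAlgebra.zz.
have qi0 : 0 <= qi := ltW (qi_gt0 R q).
have h2 := ler_wpM2l (mulr_ge0 qi0 (ltW k0)) h.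
have aux (u k v w : R) : u * k * w <= u * k * v -> u * (k + 1) = 1 -> u * (v + k * w) <= v.
  move=> h' e; have -> : u * (v + k * w) = u * v + u * k * w by ring.
  apply: le_trans (lerD (lexx _) h') _.
  have -> : u * v + u * k * v = u * (k + 1) * v by ring.
  by rewrite e mul1r.
exact: aux h2 (qiE R q).
Qed.

(** [true] is the free boundary, whose iterates increase, and [false] the pinned one, whose iterates
    decrease; [cmp up] is the order in which iterates advance. *)
Definition start up : R := if up then qi else 1.

Lemma start_dom up : msgdom (start up).
Proof.
by have /andP[_ h] := q2V_itv R q; case: up; rewrite /EdgeTerms.msgdom /start lexx ?h.
Qed.

Lemma start_cmp up a : msgdom a -> cmp up (start up) a.
Proof. by case: up => /andP[]. Qed.

Lemma cmp_refl up a : cmp up a a. Proof. by case: up => /=. Qed.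
Lemma cmp_trans up a b c : cmp up a b -> cmp up b c -> cmp up a c.
Proof. by case: up => /= h1 h2; [exact: le_trans h1 h2|exact: le_trans h2 h1]. Qed.

Definition cmp2 up p p' := cmp up p.1 p'.1 && cmp up p.2 p'.2.

Lemma bp_cmp up p p' D x y : nonneg p -> nonneg p' -> cmp2 up p p' -> mdom D x -> mdom D y ->
  (forall j, (j < D)%N -> cmp up (x j) (y j)) -> cmp up (bp p D x) (bp p' D y).
Proof.
by move=> p0 p0' /andP[]; case: up => /= h1 h2 mx my xy; apply: bp_mono.
Qed.

Lemma msg_dom a0 l T : msgdom a0 -> all nonneg l -> msgdom (msg a0 l T).
Proof.
move=> a01; elim: l T => //= p l IH T /andP[p0 l0]; apply: bp_dom => // j _; exact: IH.
Qed.

Lemma msg_cmp up a0 l l' T : msgdom a0 -> all nonneg l -> all nonneg l' ->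
  all2 (cmp2 up) l l' -> cmp up (msg a0 l T) (msg a0 l' T).
Proof.
move=> a01; elim: l l' T => [|p l IH] [|p' l'] T //=; first by move=> *; apply: cmp_refl.
move=> /andP[p0 l0] /andP[p0' l0'] /andP[pp ll]; apply: bp_cmp => // j _;
  [exact: msg_dom|exact: msg_dom|exact: IH].
Qed.

Lemma cmp2_refl up p : cmp2 up p p. Proof. by rewrite /cmp2 !cmp_refl. Qed.

(** Additional updates at the bottom replace the extreme value [start up] by a genuine message, and
    monotonicity of [bp] carries the comparison up to the root. *)
Lemma msg_cat_cmp up l l' T : all nonneg l -> all nonneg l' ->
  cmp up (msg (start up) l T) (msg (start up) (l ++ l') T).
Proof.
move=> l0 l0'; elim: l T l0 => [|p l IH] T /=.
  by move=> _; apply: start_cmp; apply: msg_dom => //; apply: start_dom.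
move=> /andP[p0 l0]; apply: bp_cmp => // [|j _|j _|j _]; first exact: cmp2_refl.
- exact/msg_dom/l0/start_dom.
- by apply: msg_dom; rewrite ?start_dom // all_cat l0 l0'.
- exact: IH.
Qed.

Lemma nonneg_nseq t p : nonneg p -> all nonneg (nseq t p).
Proof. by move=> p0; elim: t => //= t ->; rewrite p0. Qed.

Definition hseq up p t T := msg (start up) (nseq t p) T.
Definition hlim up p T : R := limn (fun t => hseq up p t T).

Lemma hseq_dom up p t T : nonneg p -> msgdom (hseq up p t T).
Proof. by move=> p0; apply: msg_dom; [exact: start_dom|exact: nonneg_nseq]. Qed.

Lemma hseq_cmp up p s t T : nonneg p -> (s <= t)%N -> cmp up (hseq up p s T) (hseq up p t T).
Proof.
move=> p0 st; rewrite /hseq -(subnKC st) nseqD; apply: msg_cat_cmp; exact: nonneg_nseq.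
Qed.

Lemma hseq_is_cvg up p T : nonneg p -> cvgn (fun t => hseq up p t T).
Proof.
move=> p0; case: up (hseq_cmp up (p := p)) (hseq_dom up (p := p)) => H dH.
  apply: nondecreasing_is_cvgn; first by move=> s t st; apply: H.
  by exists 1 => _ [t _ <-]; case/andP: (dH t T p0).
apply: nonincreasing_is_cvgn; first by move=> s t st; apply: H.
by exists qi => _ [t _ <-]; case/andP: (dH t T p0).
Qed.

Lemma hseq_cvg up p T : nonneg p -> (fun t => hseq up p t T) @ \oo --> hlim up p T.
Proof. by move=> p0; apply: hseq_is_cvg. Qed.

Lemma cvg_le (u v : nat -> R) (a b : R) : u @ \oo --> a -> v @ \oo --> b ->
  (forall t, u t <= v t) -> a <= b.
Proof. by move=> ua vb uv; apply: (ler_cvg_to ua vb); apply: nearW. Qed.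

Lemma cvg_dom (u : nat -> R) (a : R) : u @ \oo --> a -> (forall t, msgdom (u t)) -> msgdom a.
Proof.
move=> ua du; apply/andP; split.
  by apply: (cvg_le (cvg_cst _) ua) => t; case/andP: (du t).
by apply: (cvg_le ua (cvg_cst _)) => t; case/andP: (du t).
Qed.

Lemma cvg_cmp up (u v : nat -> R) (a b : R) : u @ \oo --> a -> v @ \oo --> b ->
  (forall t, cmp up (u t) (v t)) -> cmp up a b.
Proof. by move=> ua vb; case: up => /= uv; [exact: cvg_le ua vb uv|exact: cvg_le vb ua uv]. Qed.

Lemma cvg_prod D (u : nat -> nat -> R) (a : nat -> R) :
  (forall j, (j < D)%N -> (u^~ j) @ \oo --> a j) ->
  (fun t => \prod_(j < D) u t j) @ \oo --> \prod_(j < D) a j.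
Proof.
elim: D => [|D IH] ua.
  rewrite big_ord0; under eq_fun do rewrite big_ord0; exact: cvg_cst.
rewrite big_ord_recr; under eq_fun do rewrite big_ord_recr; apply: cvgM.
  by apply: IH => j jD; apply: ua; apply: ltnW.
exact: ua.
Qed.

Lemma cvg_sum D (u : nat -> nat -> R) (a : nat -> R) :
  (forall j, (j < D)%N -> (u^~ j) @ \oo --> a j) ->
  (fun t => \sum_(j < D) u t j) @ \oo --> \sum_(j < D) a j.
Proof.
elim: D => [|D IH] ua.
  rewrite big_ord0; under eq_fun do rewrite big_ord0; exact: cvg_cst.
rewrite big_ord_recr; under eq_fun do rewrite big_ord_recr; apply: cvgD.
  by apply: IH => j jD; apply: ua; apply: ltnW.
exact: ua.
Qed.

Lemma cvg_bb (u : nat -> R) (a : R) : u @ \oo --> a -> (fun t => bb (u t)) @ \oo --> bb a.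
Proof. by move=> ua; apply: cvgMl; apply: cvgB => //; apply: cvg_cst. Qed.

Lemma cvg_zz beta B D (u : nat -> nat -> R) (a : nat -> R) :
  (forall j, (j < D)%N -> (u^~ j) @ \oo --> a j) ->
  (fun t => zz beta B D (u t)) @ \oo --> zz beta B D a.
Proof.
move=> ua; apply: cvgD; apply: cvgMr.
  apply: (@cvg_prod _ (fun t j => 1 + wgt beta * u t j) (fun j => 1 + wgt beta * a j)) => j jD.
  by apply: cvgD; [exact: cvg_cst|apply: cvgMr; apply: ua].
apply: (@cvg_prod _ (fun t j => 1 + wgt beta * bb (u t j)) (fun j => 1 + wgt beta * bb (a j))) => j jD.
by apply: cvgD; [exact: cvg_cst|apply: cvgMr; apply: cvg_bb; apply: ua].
Qed.

Lemma cvg_bp p D (u : nat -> nat -> R) (a : nat -> R) : 0 <= p.1 ->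
  (forall j, (j < D)%N -> 0 <= a j <= 1) ->
  (forall j, (j < D)%N -> (u^~ j) @ \oo --> a j) ->
  (fun t => bp p D (u t)) @ \oo --> bp p D a.
Proof.
move=> b0 da ua; apply: cvgM.
  apply: cvgMr.
  apply: (@cvg_prod _ (fun t j => 1 + wgt p.1 * u t j) (fun j => 1 + wgt p.1 * a j)) => j jD.
  by apply: cvgD; [exact: cvg_cst|apply: cvgMr; apply: ua].
apply: cvgV; first by rewrite lt0r_neq0 // zz_gt0.
exact: cvg_zz.
Qed.

Lemma cvg_uniq (u : nat -> R) (a b : R) : u @ \oo --> a -> u @ \oo --> b -> a = b.
Proof.
by move=> ua ub; rewrite -(cvg_lim (@Rhausdorff R) ua) (cvg_lim (@Rhausdorff R) ub).
Qed.

Lemma hlim_dom up p T : nonneg p -> msgdom (hlim up p T).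
Proof. by move=> p0; apply: (cvg_dom (@hseq_cvg up p T p0)) => t; apply: hseq_dom. Qed.

Lemma hlim_fix up p T : nonneg p ->
  hlim up p T = bp p (T [::]) (fun j => hlim up p (shift T j)).
Proof.
move=> p0; have b0 : 0 <= p.1 by case/andP: p0.
apply: (@cvg_uniq (fun t => hseq up p t.+1 T)).
  by rewrite (cvg_shiftS (fun t => hseq up p t T)); apply: hseq_cvg.
apply: (@cvg_bp p (T [::]) (fun t j => hseq up p t (shift T j))) => // j _.
  exact/dom01/hlim_dom.
exact: hseq_cvg.
Qed.

Lemma hseq_hlim up p t T : nonneg p -> cmp up (hseq up p t T) (hlim up p T).
Proof.
move=> p0; apply: (@cvg_cmp up (fun=> hseq up p t T) (fun s => hseq up p (s + t) T)).
- exact: cvg_cst.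
- by rewrite (cvg_shiftn t (fun s => hseq up p s T)); apply: hseq_cvg.
- by move=> s; apply: hseq_cmp => //; apply: leq_addl.
Qed.

Lemma all2_nseq (r : rel (R * R)) t p p' : r p p' -> all2 r (nseq t p) (nseq t p').
Proof. by move=> pp; elim: t => //= t ->; rewrite pp. Qed.

Lemma hseq_cmp2 up p p' t T : nonneg p -> nonneg p' -> cmp2 up p p' ->
  cmp up (hseq up p t T) (hseq up p' t T).
Proof.
move=> p0 p0' pp; apply: msg_cmp; rewrite ?start_dom ?nonneg_nseq //.
exact: all2_nseq.
Qed.

Lemma hlim_cmp2 up p p' T : nonneg p -> nonneg p' -> cmp2 up p p' ->
  cmp up (hlim up p T) (hlim up p' T).
Proof.
move=> p0 p0' pp; apply: (cvg_cmp (@hseq_cvg up p T p0) (@hseq_cvg up p' T p0')) => t.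
exact: hseq_cmp2.
Qed.

Lemma hseq_f1 p t T : nonneg p -> hseq true p t T <= hseq false p t T.
Proof.
move=> p0; rewrite /hseq; elim: t T => [|t IH] T.
  by rewrite /= /start; case/andP: (q2V_itv R q).
apply: (bp_mono p0 (lexx _) (lexx _)) => j _; last exact: IH.
  exact: (@hseq_dom true p t).
exact: (@hseq_dom false p t).
Qed.

Lemma hlim_f1 p T : nonneg p -> hlim true p T <= hlim false p T.
Proof.
by move=> p0; apply: (cvg_le (@hseq_cvg true p T p0) (@hseq_cvg false p T p0)) => t; apply: hseq_f1.
Qed.

(* Messages obtained by [s] updates at [p'] from the [t]-th iterate at [p]: they interpolate between the two fixed points. *)
Definition hmix up p' s p t T := msg (start up) (nseq s p' ++ nseq t p) T.

Lemma all_nonneg_mix p' s p t : nonneg p' -> nonneg p -> all nonneg (nseq s p' ++ nseq t p).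
Proof. by move=> p0' p0; rewrite all_cat !nonneg_nseq. Qed.

Lemma all2_cmp2_refl up l : all2 (cmp2 up) l l.
Proof. by elim: l => //= p l ->; rewrite cmp2_refl. Qed.

(** Two moves: append one more update at [p] at the bottom, then change the topmost update at [p]
    into one at [p']. *)
Lemma hmix_cmpS up p' s p t T : nonneg p' -> nonneg p -> cmp2 up p p' ->
  cmp up (hmix up p' s p t T) (hmix up p' s.+1 p t T).
Proof.
move=> p0' p0 pp; apply: (@cmp_trans up _ (msg (start up) (nseq s p' ++ nseq t.+1 p) T)).
  have -> : nseq t.+1 p = nseq t p ++ [:: p] by rewrite cats1 -[RHS]/(rcons (nseq t p) p); elim: (t) => //= n <-.
  by rewrite catA; apply: msg_cat_cmp; rewrite ?all_nonneg_mix //= p0.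
rewrite /hmix; have -> : nseq s.+1 p' = nseq s p' ++ [:: p'] by elim: (s) => //= n <-.
rewrite -catA; apply: msg_cmp; first exact: start_dom.
- by rewrite all_cat !nonneg_nseq.
- by rewrite all_cat /= p0' !nonneg_nseq.
elim: (s) => /= [|n ->]; last by rewrite cmp2_refl.
by rewrite pp all2_cmp2_refl.
Qed.

(** Squeezed between [s] and [s + t] updates at [p'] from the boundary value. *)
Lemma hmix_cvg up p' p t T : nonneg p' -> nonneg p -> cmp2 up p p' ->
  (fun s => hmix up p' s p t T) @ \oo --> hlim up p' T.
Proof.
move=> p0' p0 pp.
have lo s : cmp up (hseq up p' s T) (hmix up p' s p t T).
  by apply: msg_cat_cmp; apply: nonneg_nseq.
have hi s : cmp up (hmix up p' s p t T) (hseq up p' (s + t) T).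
  rewrite /hseq nseqD; apply: msg_cmp; rewrite ?start_dom ?all_nonneg_mix //.
  elim: (s) => /= [|n ->]; last by rewrite cmp2_refl.
  exact: all2_nseq.
have c1 := @hseq_cvg up p' T p0'.
have c2 : (fun s => hseq up p' (s + t) T) @ \oo --> hlim up p' T.
  by rewrite (cvg_shiftn t (fun s => hseq up p' s T)).
case: up lo hi c1 c2 pp => /= lo hi c1 c2 _.
  by apply: squeeze_cvgr c1 c2; apply: nearW => s; rewrite lo hi.
by apply: squeeze_cvgr c2 c1; apply: nearW => s; rewrite lo hi.
Qed.

Lemma hlim_hf p T (s : 'I_q.+2) : nonneg p -> hf p.1 p.2 T s = vecm (hlim true p T) s.
Proof.
move=> p0; have b0 : 0 <= p.1 by case/andP: p0.
have E : (fun t => hbar_f p.1 p.2 t T s) = (fun t => vecm (hseq true p t.+1 T) s).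
  by apply/funext => t; rewrite hbar_fE.
apply: cvg_lim; first exact: Rhausdorff.
rewrite E; have c : (fun t => hseq true p t.+1 T) @ \oo --> hlim true p T.
  by rewrite (cvg_shiftS (fun t => hseq true p t T)); apply: hseq_cvg.
by rewrite /vecm; case: ifP => // _; apply: cvg_bb.
Qed.

Lemma hlim_h1 p T (s : 'I_q.+2) : nonneg p -> h1 p.1 p.2 T s = vecm (hlim false p T) s.
Proof.
move=> p0; have b0 : 0 <= p.1 by case/andP: p0.
have E : (fun t => hbar_1 p.1 p.2 t T s) = (fun t => vecm (hseq false p t.+1 T) s).
  by apply/funext => t; rewrite hbar_1E.
apply: cvg_lim; first exact: Rhausdorff.
rewrite E; have c : (fun t => hseq false p t.+1 T) @ \oo --> hlim false p T.
  by rewrite (cvg_shiftS (fun t => hseq false p t T)); apply: hseq_cvg.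
by rewrite /vecm; case: ifP => // _; apply: cvg_bb.
Qed.

Lemma remove_childE (a0 : R) p l T j :
  msg a0 (p :: l) (remove_child T j) = bp p (T [::]).-1 (skip j (fun i => msg a0 l (shift T i))).
Proof.
by [].
Qed.

Lemma cavity_msg up p l T j : nonneg p -> all nonneg l -> (j < T [::])%N ->
  pstar p.1 (msg (start up) l (shift T j)) (msg (start up) (p :: l) (remove_child T j)) =
  msg (start up) (p :: l) T.
Proof.
move=> p0 l0 jT; have b0 : 0 <= p.1 by case/andP: p0.
rewrite remove_childE.
apply: (@cavity_pstar R q p (T [::]) (fun i => msg (start up) l (shift T i))) => // i _.
by apply/dom01/msg_dom => //; apply: start_dom.
Qed.

Lemma cavity_hlim up p T j : nonneg p -> (j < T [::])%N ->
  pstar p.1 (hlim up p (shift T j)) (hlim up p (remove_child T j)) = hlim up p T.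
Proof.
move=> p0 jT; have b0 : 0 <= p.1 by case/andP: p0.
have E : hlim up p (remove_child T j) =
    bp p (T [::]).-1 (skip j (fun i => hlim up p (shift T i))).
  by rewrite hlim_fix.
rewrite E [RHS]hlim_fix //.
apply: (@cavity_pstar R q p (T [::]) (fun i => hlim up p (shift T i))) => // i _.
exact/dom01/hlim_dom.
Qed.
End MessageLimits.

Module LocalFunctions.

(** * Local functions of the random tree *)

Section Discrete.
Implicit Types (T : ptree) (g : ptree -> nat).

Definition discrete_meas g := forall c, measurable [set T : ptree_mt | g T = c].

Lemma discrete_label u : discrete_meas (fun T => T u).
Proof. by move=> c; apply: sub_sigma_algebra; exists u, c. Qed.

Lemma discrete_cst c : discrete_meas (fun=> c).
Proof.
move=> c'; have [->|/eqP ne] := eqVneq c c'.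
  by rewrite (_ : [set _ | _] = setT) //; apply/seteqP; split.
by rewrite (_ : [set _ | _] = set0) //; apply/seteqP; split.
Qed.

Lemma discrete_op2 (h : nat -> nat -> nat) g g' : discrete_meas g -> discrete_meas g' ->
  discrete_meas (fun T => h (g T) (g' T)).
Proof.
move=> mg mg' c.
rewrite (_ : [set _ | _] = \bigcup_a \bigcup_(b in [set b | h a b = c])
    ([set T : ptree_mt | g T = a] `&` [set T : ptree_mt | g' T = b])).
  by apply: bigcupT_measurable => a; apply: bigcup_measurable => b _; apply: measurableI.
apply/seteqP; split => [T /= gT|T [a _] [b /= hc [/= ga gb]]]; last by rewrite ga gb.
by exists (g T) => //; exists (g' T).
Qed.

Definition hpair (a b : nat) : nat := CodeSeq.code [:: a; b].
Lemma hpair_inj a b a' b' : hpair a b = hpair a' b' -> a = a' /\ b = b'.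
Proof. by move=> /(can_inj CodeSeq.codeK) [-> ->]. Qed.

(* Code of the labels at depth less than [t]. *)
Fixpoint enc t T : nat :=
  if t is t'.+1 then hpair (T [::]) (foldr (fun k => hpair (enc t' (shift T k))) 0%N (iota 0 (T [::])))
  else 0%N.

(** The address [u] of a subtree is quantified so that the induction on depth can descend. The
    number of children is fixed first, through a countable union, to give the fold a constant
    length. *)
Lemma discrete_enc t u : discrete_meas (fun T => enc t (fun w => T (u ++ w))).
Proof.
elim: t u => [|t IH] u /=; first exact: discrete_cst.
apply: discrete_op2; first by rewrite cats0; apply: discrete_label.
pose g D T := foldr (fun k => hpair (enc t (shift (fun w => T (u ++ w)) k))) 0%N (iota 0 D).
have mg s : discrete_meas (fun T =>
    foldr (fun k => hpair (enc t (shift (fun w => T (u ++ w)) k))) 0%N s).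
  elim: s => [|k s IHs] /=; first exact: discrete_cst.
  apply: discrete_op2 => //.
  rewrite (_ : (fun T => _) = (fun T => enc t (fun w => T (rcons u k ++ w)))); first exact: IH.
  apply/funext => T; congr (enc t _); apply/funext => w.
  by rewrite cat_rcons.
rewrite cats0 => c.
rewrite (_ : [set _ | _] = \bigcup_D ([set T : ptree_mt | T u = D] `&`
    [set T : ptree_mt | g D T = c])).
  by apply: bigcupT_measurable => D; apply: measurableI; [exact: discrete_label|exact: mg].
by apply/seteqP; split => [T /= gT|T [D _ [/= <-]] //]; exists (T u).
Qed.

Definition agree_upto t T T' := forall u, valid T u -> (size u < t)%N -> T u = T' u.

Lemma enc_agree t T T' : enc t T = enc t T' -> agree_upto t T T'.
Proof.
elim: t T T' => [|t IH] T T' //= /hpair_inj [TT' E] [|k u] //= /andP[kT vu] su.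
suff : enc t (shift T k) = enc t (shift T' k) by move=> /IH; apply.
have : k \in iota 0 (T [::]) by rewrite mem_iota.
move: E; rewrite -TT'; elim: (iota 0 (T [::])) => //= a s IHs /hpair_inj [E1 E2].
by rewrite inE => /orP[/eqP -> //|]; apply: IHs.
Qed.

Lemma agree_tball t T T' : agree_upto t T T' -> tball T t =1 tball T' t.
Proof.
elim: t T T' => [|t IH] T T' H u.
  by rewrite /tball; case: u => //= k u; rewrite !andbF.
case: u => // k u; have E : T [::] = T' [::] by apply: H.
rewrite /tball /= -E -!andbA; case kT: (_ < _)%N => //=.
apply: (IH (shift T k) (shift T' k)) => w vw sw; apply: H => //=.
by rewrite kT.
Qed.

Lemma agree_shift t T T' k : (k < T [::])%N -> agree_upto t.+1 T T' ->
  agree_upto t (shift T k) (shift T' k).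
Proof. by move=> kT H w vw sw; apply: H => //=; rewrite kT. Qed.

Lemma agree_le s t T T' : (s <= t)%N -> agree_upto t T T' -> agree_upto s T T'.
Proof. by move=> st H u vu su; apply: H => //; apply: leq_trans su st. Qed.

Lemma agree_remove t T T' j : (j < T [::])%N -> agree_upto t T T' ->
  agree_upto t (remove_child T j) (remove_child T' j).
Proof.
move=> jT H [|k u] /=; first by move=> _ t0; rewrite H.
move=> /andP[kT vu] su; apply: H => //=.
have kT' : (k.+1 < T [::])%N by rewrite -(ltn_predK jT).
rewrite -[shift (remove_child T j) k]/(shift T (if (k < j)%N then k else k.+1)) in vu.
by rewrite vu andbT; case: ifP => _ //; apply: ltnW.
Qed.
End Discrete.

Section Expectation.
Variables (R : realType) (mu : probability ptree_mt R).
Implicit Types (f g : ptree -> R) (T : ptree).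

Definition is_local t (U : Type) (f : ptree -> U) := forall T T', agree_upto t T T' -> f T = f T'.
Definition mfun f := measurable_fun [set: ptree_mt] (f : ptree_mt -> R).
Definition intg f := mu.-integrable [set: ptree_mt] (EFin \o (f : ptree_mt -> R)).
Definition Em f : R := \int[mu]_(T in [set: ptree_mt]) f T.

(** Codes of balls are natural numbers, so a set that depends on the ball alone is a countable union
    of measurable sets. *)
Lemma local_set_measurable t (A : set ptree_mt) : is_local t (A : ptree -> Prop) -> measurable A.
Proof.
move=> lA.
rewrite (_ : A = \bigcup_(c in [set c | exists2 T, A T & enc t T = c])
    [set T : ptree_mt | enc t T = c]).
  by apply: bigcup_measurable => c _; apply: (discrete_enc t [::]).
apply/seteqP; split => [T AT|T [c [T' AT' <-]] /= E]; first by exists (enc t T) => //; exists T.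
by rewrite (lA T T') //; apply: enc_agree.
Qed.

Lemma local_mfun t f : is_local t f -> mfun f.
Proof.
move=> lf _ Y mY; rewrite setTI; apply: (@local_set_measurable t) => T T' TT' /=.
by rewrite /preimage /= (lf T T').
Qed.

Lemma mfun_cvg (F : nat -> ptree -> R) f : (forall n, mfun (F n)) ->
  (forall T, (fun n => F n T) @ \oo --> f T) -> mfun f.
Proof.
by move=> mF Ff; apply: (measurable_realfun.measurable_fun_cvg mF) => T _; apply: Ff.
Qed.

Lemma intg_mfun f : intg f -> mfun f.
Proof. by move=> /integrableP[] /measurable_realfun.measurable_EFinP. Qed.

Lemma intg_dom f g : mfun f -> intg g -> (forall T, `|f T| <= g T) -> intg f.
Proof.
move=> mf ig fg; apply: (le_integrable measurableT _ _ ig) => [|T _].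
  exact/measurable_realfun.measurable_EFinP.
by rewrite /= lee_fin (le_trans (fg T)) // ler_norm.
Qed.

Lemma intg_cst c : intg (fun=> c).
Proof. exact: (finite_measure_integrable_cst mu c measurableT). Qed.

Lemma intg_bdd f c : mfun f -> (forall T, `|f T| <= c) -> intg f.
Proof. by move=> mf fc; apply: (intg_dom mf (intg_cst c)). Qed.

Lemma intgD f g : intg f -> intg g -> intg (fun T => f T + g T).
Proof. by move=> f1 g1; have := integrableD measurableT f1 g1. Qed.

Lemma intgB f g : intg f -> intg g -> intg (fun T => f T - g T).
Proof. by move=> f1 g1; have := integrableB measurableT f1 g1. Qed.

Lemma intgZ c f : intg f -> intg (fun T => c * f T).
Proof. by move=> f1; have := integrableZl measurableT c f1. Qed.

Lemma EmD f g : intg f -> intg g -> Em (fun T => f T + g T) = Em f + Em g.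
Proof. by move=> f1 g1; apply: RintegralD. Qed.

Lemma EmB f g : intg f -> intg g -> Em (fun T => f T - g T) = Em f - Em g.
Proof. by move=> f1 g1; apply: RintegralB. Qed.

Lemma EmZ c f : intg f -> Em (fun T => c * f T) = c * Em f.
Proof. by move=> f1; apply: RintegralZl. Qed.

Lemma Em_cst c : Em (fun=> c) = c.
Proof. by rewrite /Em Rintegral_cst //= probability_setT mulr1. Qed.

Lemma Em_le f g : intg f -> intg g -> (forall T, f T <= g T) -> Em f <= Em g.
Proof. by move=> f1 g1 fg; apply: le_Rintegral. Qed.

Lemma EmE f : intg f -> (Em f)%:E = (\int[mu]_T (f T)%:E)%E.
Proof. by move=> f1; rewrite /Em /Rintegral fineK //; apply: integrable_fin_num. Qed.

Lemma Em_ae f g : mfun f -> mfun g -> {ae mu, forall T : ptree_mt, f T = g T} -> Em f = Em g.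
Proof.
move=> mf mg fg; rewrite /Em /Rintegral; congr fine; apply: ae_eq_integral => //.
- exact/measurable_realfun.measurable_EFinP.
- exact/measurable_realfun.measurable_EFinP.
- by apply: filterS fg => T E _; rewrite E.
Qed.

Lemma Em_cvg_ae (F : nat -> ptree -> R) f g : (forall n, mfun (F n)) -> mfun f ->
  {ae mu, forall T : ptree_mt, (fun n => F n T) @ \oo --> f T} -> intg g ->
  (forall n T, `|F n T| <= g T) -> intg f /\ (fun n => Em (F n)) @ \oo --> Em f.
Proof.
move=> mF mf Ff ig Fg.
have [|||||] := @dominated_convergence _ _ _ mu setT measurableT
   (fun n => EFin \o (F n : ptree_mt -> R)) (EFin \o (f : ptree_mt -> R)) (EFin \o (g : ptree_mt -> R)).
- by move=> n; apply/measurable_realfun.measurable_EFinP; apply: mF.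
- exact/measurable_realfun.measurable_EFinP.
- by apply: filterS Ff => T h _; apply/cvg_EFin => //; apply: nearW.
- exact: ig.
- by apply: nearW => T n _ /=; rewrite lee_fin.
move=> i1 _ c; split => //.
have E n : (\int[mu]_(x in setT) (EFin \o (F n : ptree_mt -> R)) x)%E = (Em (F n))%:E.
  by rewrite EmE //; apply: (intg_dom (mF n) ig).
move: c; rewrite /sequence (_ : (fun n => _) = (fun n => (Em (F n))%:E)); last exact/funext.
by rewrite -EmE // => /fine_cvgP[].
Qed.

Lemma Em_cvg (F : nat -> ptree -> R) f g : (forall n, mfun (F n)) ->
  (forall T, (fun n => F n T) @ \oo --> f T) -> intg g ->
  (forall n T, `|F n T| <= g T) -> intg f /\ (fun n => Em (F n)) @ \oo --> Em f.
Proof.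
move=> mF Ff ig Fg; apply: (Em_cvg_ae mF (mfun_cvg mF Ff) _ ig Fg).
by apply: nearW => T; apply: Ff.
Qed.

Lemma Em_sum (I : Type) (r : seq I) (F : I -> ptree -> R) : (forall i, intg (F i)) ->
  intg (fun T => \sum_(i <- r) F i T) /\ Em (fun T => \sum_(i <- r) F i T) = \sum_(i <- r) Em (F i).
Proof.
move=> iF; elim: r => [|i r [IH1 IH2]].
  rewrite big_nil (_ : (fun T => _) = fun=> 0); last by apply/funext => T; rewrite big_nil.
  by split; [exact: intg_cst|exact: Em_cst].
rewrite big_cons (_ : (fun T => _) = fun T => F i T + \sum_(j <- r) F j T); last first.
  by apply/funext => T; rewrite big_cons.
by split; [exact: intgD|rewrite EmD // IH2].
Qed.
End Expectation.

End LocalFunctions.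
Import LocalFunctions.

(** * Transfer along local weak convergence *)

Section RootedIso.
Variables (U V W : eqType).

Lemma rooted_iso_sym (A : pred U) eA a (B : pred V) eB b :
  A a -> rooted_iso A eA a B eB b -> rooted_iso B eB b A eA a.
Proof.
move=> Aa [f [fi [fs [fab fe]]]].
have H y : exists x, B y -> A x /\ f x = y.
  by have [/fs[x Ax fx]|nB] := pselect (B y); [exists x|exists a].
pose g y := projT1 (cid (H y)).
have gP y : B y -> A (g y) /\ f (g y) = y by move=> By; apply: (projT2 (cid (H y))).
have gf x : A x -> g (f x) = x.
  move=> Ax; have Bf : B (f x) by apply/fs; exists x.
  by have [Ag fg] := gP _ Bf; apply: fi.
exists g; split; first by move=> y z /gP[_ {2}<-] /gP[_ {2}<-] ->.
split.
  move=> x; split => [Ax|[y By <-]]; last by case: (gP y By).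
  by exists (f x); [apply/fs; exists x|exact: gf].
split; first by rewrite -fab gf.
move=> y z By Bz; have [Ay fy] := gP y By; have [Az fz] := gP z Bz.
by rewrite -fe // fy fz.
Qed.

Lemma rooted_iso_trans (A : pred U) eA a (B : pred V) eB b (C : pred W) eC c :
  rooted_iso A eA a B eB b -> rooted_iso B eB b C eC c -> rooted_iso A eA a C eC c.
Proof.
move=> [f [fi [fs [fab fe]]]] [g [gi [gs [gbc ge]]]].
have fB x : A x -> B (f x) by move=> Ax; apply/fs; exists x.
exists (fun x => g (f x)); split.
  by move=> x y Ax Ay /gi E; apply: fi => //; apply: E; apply: fB.
split.
  move=> z; split => [/gs [y /fs [x Ax <-] <-]|[x Ax <-]]; first by exists x.
  by apply/gs; exists (f x) => //; apply: fB.
split; first by rewrite fab.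
by move=> x y Ax Ay; rewrite ge ?fe //; apply: fB.
Qed.
End RootedIso.

Lemma rooted_iso_refl (U : eqType) (A : pred U) eA a : rooted_iso A eA a A eA a.
Proof.
exists id; split => //; split => //.
by move=> y; split => [Ay|[x Ax <-]] //; exists y.
Qed.

Section Classes.
Variable t : nat.
Implicit Types (T H : ptree) (c : nat).

Definition isoT T H := rooted_iso (tball T t) tadj [::] (tball H t) tadj [::].
Definition isoG n (G : graphn n) v T :=
  rooted_iso (fun x => x \in gball G v t) (fun x y => (x, y) \in G) v (tball T t) tadj [::].

Lemma isoT_sym T H : isoT T H -> isoT H T. Proof. exact: rooted_iso_sym. Qed.
Lemma isoT_trans T H K : isoT T H -> isoT H K -> isoT T K. Proof. exact: rooted_iso_trans. Qed.
Lemma isoGT n (G : graphn n) v T H : isoG G v T -> isoT T H -> isoG G v H.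
Proof. exact: rooted_iso_trans. Qed.
Lemma gball_root n (G : graphn n) v s : v \in gball G v s.
Proof. by elim: s => [|s IH] /=; rewrite !inE ?IH. Qed.
Lemma isoGG n (G : graphn n) v T H : isoG G v T -> isoG G v H -> isoT T H.
Proof.
move=> gT gH; apply: rooted_iso_trans gH; apply: rooted_iso_sym gT.
exact: gball_root.
Qed.

Lemma agree_isoT T T' : agree_upto t T T' -> isoT T T'.
Proof.
move=> /agree_tball TT'; rewrite /isoT (_ : tball T' t = tball T t); last first.
  by apply/funext => u; rewrite TT'.
exact: rooted_iso_refl.
Qed.

(* Canonical representatives of the countably many isomorphism classes of balls. *)
Definition rep c : ptree := xget (fun=> 0%N) [set T : ptree | enc t T = c].
Definition canon c := forall c', (c' < c)%N -> ~ isoT (rep c') (rep c).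
Definition cls c T := canon c /\ isoT T (rep c).
Definition clsG c n (G : graphn n) v := canon c /\ isoG G v (rep c).

Lemma rep_iso T : isoT T (rep (enc t T)).
Proof.
apply: agree_isoT; apply: enc_agree; rewrite /rep; case: xgetP => [H _ /= ->//|no].
by case: (no T).
Qed.

Lemma cls_ex T : exists c, cls c T.
Proof.
have ex : exists c, `[< isoT T (rep c) >] by exists (enc t T); apply/asboolP/rep_iso.
case: (ex_minnP ex) => c /asboolP cT cmin; exists c; split => // c' c'c c'i.
have : `[< isoT T (rep c') >] by apply/asboolP; apply: isoT_trans cT (isoT_sym c'i).
by move=> /cmin; rewrite leqNgt c'c.
Qed.

Lemma canon_uniq c c' : canon c -> canon c' -> isoT (rep c) (rep c') -> c = c'.
Proof.
move=> cc cc' i; case: (ltngtP c c') => // h; first by case: (cc' _ h i).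
by case: (cc _ h (isoT_sym i)).
Qed.

Lemma cls_uniq c c' T : cls c T -> cls c' T -> c = c'.
Proof.
by move=> [cc i] [cc' i']; apply: canon_uniq => //; apply: isoT_trans (isoT_sym i) i'.
Qed.

Lemma clsG_uniq c c' n (G : graphn n) v : clsG c G v -> clsG c' G v -> c = c'.
Proof. by move=> [cc i] [cc' i']; apply: canon_uniq => //; apply: isoGG i i'. Qed.

Lemma clsG_cls c n (G : graphn n) v T : clsG c G v -> cls c T -> isoG G v T.
Proof. by move=> [_ i] [_ i']; apply: isoGT i (isoT_sym i'). Qed.

Lemma isoT_local H : is_local t (fun T => isoT T H).
Proof.
move=> T T' TT'; apply/propext; split; apply: isoT_trans.
  by apply/isoT_sym/agree_isoT.
exact: agree_isoT.
Qed.

Lemma cls_local c : is_local t (cls c).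
Proof. by move=> T T' TT'; rewrite /cls (isoT_local _ TT'). Qed.
End Classes.

Lemma sum_uniq_le (R : realType) N (a : nat -> R) (Q : nat -> Prop) y : 0 <= y ->
  (forall c, Q c -> a c <= y) -> (forall c c', Q c -> Q c' -> c = c') ->
  \sum_(c < N) a c * `[< Q c >]%:R <= y.
Proof.
move=> y0 ay Qu; have [[c Qc]|no] := pselect (exists c : 'I_N, Q c).
  rewrite (bigD1 c) //= (asboolT Qc) mulr1 big1 ?addr0; first exact: ay.
  move=> c' c'c; rewrite (_ : `[< Q c' >] = false) ?mulr0 //; apply/asboolPn => Qc'.
  by move: c'c; rewrite -val_eqE /= (Qu _ _ Qc' Qc) eqxx.
rewrite big1 // => c _; rewrite (_ : `[< Q c >] = false) ?mulr0 //; apply/asboolPn => Qc.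
by apply: no; exists c.
Qed.

Section Transfer.
Variables (R : realType) (P : forall n, graphn n -> R) (mu : probability ptree_mt R).
Hypotheses (rP : random_graphs P) (bc : ball_conv P mu).
Local Notation En := (@En R P).
Local Notation Em := (@Em R mu).
Local Notation intg := (@intg R mu).

Lemma En_le n (f g : graphn n -> 'I_n -> R) :
  (forall G v, simple_graph G -> f G v <= g G v) -> En f <= En g.
Proof.
move=> fg; have [P0 [_ sP]] := rP n; apply: ler_sum => G _.
have [->|/sP sG] := eqVneq (P G) 0; first by rewrite !mul0r.
by rewrite !ler_wpM2l // ler_sum // => v _; apply: fg.
Qed.

Lemma EnD n (f g : graphn n -> 'I_n -> R) : En (fun G v => f G v + g G v) = En f + En g.
Proof.
rewrite /Defs.En -big_split /=; apply: eq_bigr => G _.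
by rewrite big_split /= !mulrDr.
Qed.

Lemma EnZ n c (f : graphn n -> 'I_n -> R) : En (fun G v => c * f G v) = c * En f.
Proof.
rewrite /Defs.En mulr_sumr; apply: eq_bigr => G _.
by rewrite -mulr_sumr; ring.
Qed.

Lemma EnB n (f g : graphn n -> 'I_n -> R) : En (fun G v => f G v - g G v) = En f - En g.
Proof.
rewrite -mulN1r -EnZ -EnD; congr Defs.En; apply/funext => G; apply/funext => v.
by rewrite mulN1r.
Qed.

Lemma En_sum n N (f : nat -> graphn n -> 'I_n -> R) :
  En (fun G v => \sum_(c < N) f c G v) = \sum_(c < N) En (f c).
Proof.
elim: N => [|N IH].
  rewrite big_ord0 /Defs.En big1 // => G _; rewrite big1 ?mulr0 // => v _.
  by rewrite big_ord0.
rewrite big_ord_recr /= -IH -EnD; congr Defs.En; apply/funext => G; apply/funext => v.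
by rewrite big_ord_recr.
Qed.

Lemma En_cst n c : (0 < n)%N -> En (fun (G : graphn n) v => c) = c.
Proof.
move=> n0; have [_ [P1 _]] := rP n; rewrite /Defs.En -mulr_suml P1 mul1r.
rewrite sumr_const card_ord -[X in _ * X]mulr_natl mulrA mulVf ?mul1r //.
by rewrite pnatr_eq0 -lt0n.
Qed.

Lemma Em_indic (A : set ptree_mt) : measurable A ->
  Em (fun T => `[< A T >]%:R) = fine (mu A).
Proof.
move=> mA; rewrite /LocalFunctions.Em /Rintegral; congr fine.
rewrite (_ : (fun T => _) = fun T => (\1_A T)%:E); last first.
  by apply/funext => T; rewrite indicE.
by rewrite integral_indic // setIT.
Qed.

Section AtRadius.
Variable t : nat.

Lemma measurable_cls c : measurable (cls t c : set ptree_mt).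
Proof. exact: local_set_measurable (@cls_local t c). Qed.

Lemma clsG_cvg c : (fun n => En (fun G v => `[< @clsG t c n G v >]%:R)) @ \oo -->
  Em (fun T => `[< cls t c T >]%:R).
Proof.
have [cc|ncc] := pselect (canon t c); last first.
  have E1 n : (fun (G : graphn n) v => `[< clsG t c G v >]%:R : R) = fun _ _ => 0.
    by apply/funext => G; apply/funext => v; rewrite asboolF // => -[].
  have E2 : (fun T => `[< cls t c T >]%:R : R) = fun=> 0.
    by apply/funext => T; rewrite asboolF // => -[].
  rewrite E2 Em_cst; apply: cvg_near_cst; apply: nearW => n.
  rewrite E1 /Defs.En; rewrite big1 // => G _; by rewrite big1 ?mulr0.
have mc := measurable_cls c.
rewrite Em_indic //.
have E : cls t c = (fun T => isoT t T (rep t c)).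
  by apply/funext => T; apply/propext; split => [[]|].
have := @bc t (rep t c); rewrite -[X in mu X]E.
have -> : mu (cls t c) = (fine (mu (cls t c)))%:E by rewrite fineK // fin_num_measure.
move=> /fine_cvgP[_]; apply: cvg_trans; apply: near_eq_cvg; apply: nearW => n /=.
congr Defs.En; apply/funext => G; apply/funext => v; congr (nat_of_bool _)%:R.
by apply/asbool_equiv_eq; split => [|[]].
Qed.

(** A bound of Fatou type: [Y] may be unbounded, but its nonnegativity allows all but finitely many
    classes of balls to be discarded, and on these convergence of frequencies can be used class by
    class. *)
Lemma transfer_ge (Y : forall n, graphn n -> 'I_n -> R) (k : ptree -> R) :
  (forall n G v, 0 <= Y n G v) -> intg k -> (forall T, 0 <= k T) ->
  (forall n G v T, simple_graph G -> @isoG t n G v T -> k T <= Y n G v) ->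
  forall e, 0 < e -> \forall n \near \oo, Em k - e <= En (Y n).
Proof.
move=> Y0 ik k0 kY e e0.
pose S c := [set y | exists n (G : graphn n) v, [/\ simple_graph G, clsG t c G v & y = Y n G v]].
(* The infimum of [Y] over all graphs whose ball has class [c] separates the two sides: it is below
   [Y] and, if the class is realised at all, above [k]. *)
pose kc c := inf (S c).
have S0 c : lbound (S c) 0 by move=> _ [n [G [v [_ _ ->]]]].
have kcY c n (G : graphn n) v : simple_graph G -> clsG t c G v -> kc c <= Y n G v.
  by move=> sG cG; apply: ge_inf; [exists 0; apply: S0|exists n, G, v].
have kkc c T : S c !=set0 -> cls t c T -> k T <= kc c.
  move=> nS cT; apply: lb_le_inf => // _ [n [G [v [sG cG ->]]]].
  by apply: kY => //; apply: clsG_cls cG cT.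
pose ind c T : R := `[< cls t c T >]%:R.
have mind c : mfun (ind c).
  by apply: (@local_mfun R t) => T T' TT'; rewrite /ind (cls_local c TT').
have indk c : intg (fun T => ind c T * k T).
  apply: (intg_dom _ ik) => [|T].
    by apply: measurable_realfun.measurable_funM; [exact: mind|exact: intg_mfun ik].
  by rewrite normrM (ger0_norm (k0 T)) ger0_norm ?ler0n // ler_piMl // lern1 leq_b1.
have iind c : intg (ind c).
  apply: (@intg_bdd _ _ _ 1 (mind c)) => T.
  by rewrite ger0_norm ?ler0n // lern1 leq_b1.
pose kN N T := \sum_(c < N) ind c T * k T.
have skN N := @Em_sum R mu 'I_N (index_enum 'I_N) (fun c T => ind c T * k T) (fun c => indk c).
have kN_cvg : (fun N => Em (kN N)) @ \oo --> Em k.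
  have [] // := @Em_cvg R mu kN k k _ _ ik _.
  - move=> N; exact: intg_mfun (proj1 (skN N)).
  - move=> T; have [c cT] := cls_ex t T.
    apply: cvg_near_cst; near=> N.
    have cN : (c < N)%N by near: N; exists c.+1.
    rewrite /kN (bigD1 (Ordinal cN)) //= {1}/ind (asboolT cT) mul1r big1 ?addr0 // => c' c'c.
    rewrite /ind asboolF ?mul0r // => c'T; move: c'c.
    by rewrite -val_eqE /= (cls_uniq c'T cT) eqxx.
  - move=> N T; rewrite ger0_norm; last by apply: sumr_ge0 => c _; rewrite mulr_ge0.
    rewrite /kN; under eq_bigr do rewrite mulrC.
    apply: (@sum_uniq_le R N (fun=> k T) (fun c => cls t c T)) => // c c'.
    exact: cls_uniq.
have bound c : Em (fun T => ind c T * k T) <= kc c * Em (ind c).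
  have [nS|eS] := pselect (S c !=set0).
    rewrite -EmZ //; apply: Em_le => //; first exact: intgZ.
    move=> T; rewrite [leRHS]mulrC /ind; case: asboolP => cT; rewrite ?mul0r // !mul1r.
    exact: kkc.
  (* A class realised by no simple graph has frequency 0 for every [n], hence probability 0 in the
     limit. *)
  have Z : Em (ind c) = 0.
    rewrite -(cvg_lim (@Rhausdorff R) (@clsG_cvg c)); apply: cvg_lim; first exact: Rhausdorff.
    apply: cvg_near_cst; apply: nearW => n; rewrite /Defs.En big1 // => G _.
    have [->|/(proj2 (proj2 (rP n))) sG] := eqVneq (P G) 0; first by rewrite mul0r.
    rewrite big1 ?mulr0 // => v _; rewrite asboolF // => cG.
    by apply: eS; exists (Y n G v), n, G, v.
  rewrite Z mulr0 (_ : Em _ = Em (fun=> 0)); first by rewrite Em_cst.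
  apply: Em_ae; [exact: intg_mfun (indk c)|exact: measurable_cst|].
  have mc := measurable_cls c.
  exists (cls t c); split => //.
    rewrite -(@fineK _ (mu (cls t c))) ?fin_num_measure //.
    by rewrite -Em_indic // -/(ind c) Z.
  move=> T /= h; apply: contrapT => nc; apply: h.
  by rewrite /ind asboolF // mul0r.
have [N NP] : exists N, Em k - e / 2 <= Em (kN N).
  have e2 : 0 < e / 2 by rewrite divr_gt0.
  have /cvgrPdist_le/(_ _ e2)[N _ NP] := kN_cvg.
  exists N; have := NP N (leqnn N); rewrite /= ler_norml => /andP[_]; lra.
pose s n := \sum_(c < N) kc c * En (fun G v => `[< @clsG t c n G v >]%:R).
have s_cvg : s @ \oo --> \sum_(c < N) kc c * Em (ind c).
  rewrite /s; elim: (N) => [|M IH].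
    by rewrite big_ord0; apply: cvg_near_cst; apply: nearW => n; rewrite big_ord0.
  rewrite big_ord_recr; under eq_fun do rewrite big_ord_recr.
  by apply: cvgD => //; apply: cvgMr; apply: clsG_cvg.
have sY n : s n <= En (Y n).
  rewrite /s; under eq_bigr do rewrite -EnZ.
  rewrite -(En_sum N (fun c (G : graphn n) v => kc c * `[< clsG t c G v >]%:R)).
  apply: En_le => G v sG; apply: (@sum_uniq_le R N kc (fun c => clsG t c G v)) => //.
    by move=> c; apply: kcY.
  by move=> c c'; apply: clsG_uniq.
have kNs : Em (kN N) <= \sum_(c < N) kc c * Em (ind c).
  rewrite (proj2 (skN N)).
  by apply: ler_sum.
have e2 : 0 < e / 2 by rewrite divr_gt0.
have /cvgrPdist_le/(_ _ e2) := s_cvg; apply: filterS => n.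
rewrite ler_norml => /andP[_ h]; have := sY n; lra.
Unshelve. all: by end_near.
Qed.
End AtRadius.
End Transfer.

(** * Message passing on graphs, integrability of the root degree and unimodularity *)

Module GraphLimits.

Lemma valid_rcons T u k : valid T (rcons u k) = valid T u && (k < T u)%N.
Proof.
elim: u T => [|i u IH] T /=; first by rewrite andbT.
by rewrite IH andbA.
Qed.

Lemma parent_rcons u k : parent (rcons u k) = u.
Proof. by rewrite /parent size_rcons /= -cats1 take_size_cat. Qed.

Section Neighbours.
Variables (n : nat) (G : graphn n) (v : 'I_n) (T : ptree) (t : nat) (g : seq nat -> 'I_n).
Hypothesis gb : tree_ball G v T t g.

Lemma tball_rcons u k : (size u < t)%N -> tball T t u -> (k < T u)%N -> tball T t (rcons u k).
Proof. by move=> su /andP[vu _] kT; rewrite /tball valid_rcons vu kT size_rcons. Qed.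

(** Edges inside the ball join parents to children, and no edge leaves it from an inner vertex; so
    apart from the parent the neighbours are exactly the children. *)
Lemma mem_neighbours u y : tball T t u -> (size u < t)%N ->
  (y \in [seq g (rcons u k) | k <- iota 0 (T u)]) =
  ((g u, y) \in G) && ((u == [::]) || (y != g (parent u))).
Proof.
have [gi _ ga gn] := gb; move=> ut su.
apply/mapP/andP => [[k]|[uy py]].
  rewrite mem_iota add0n /= => kT ->; have rt := tball_rcons su ut kT.
  rewrite ga //; split.
    by rewrite /tadj is_childE parent_rcons eqxx andbT; case: (u).
  case: eqVneq => //= u0; apply/eqP => /gi E.
  have := E rt (tball_parent ut) => /(congr1 size).
  rewrite size_rcons /parent size_take.
  by case: (u) u0 => //= i w _; rewrite ltnSn => /eqP; rewrite -addn2 -{2}[size w]addn0 eqn_add2l.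
have [w wt wy] := gn u y ut su uy; move: uy py; rewrite -wy ga // /tadj !is_childE.
case/orP => /andP[w0 /eqP E]; last by rewrite (negPf w0) -E eqxx.
move=> _; case/lastP: w w0 E wt {wy} => // w k _; rewrite parent_rcons => -> wt.
by exists k => //; rewrite mem_iota add0n /=; case/andP: wt; rewrite valid_rcons => /andP[].
Qed.

Lemma uniq_neighbours u : tball T t u -> (size u < t)%N ->
  uniq [seq g (rcons u k) | k <- iota 0 (T u)].
Proof.
have [gi _ _ _] := gb; move=> ut su; rewrite map_inj_in_uniq ?iota_uniq // => j k.
rewrite !mem_iota !add0n /= => jT kT E.
by have /rcons_inj[] := gi _ _ (tball_rcons su ut jT) (tball_rcons su ut kT) E.
Qed.

Lemma big_neighbours (S : Type) (idx : S) (op : Monoid.com_law idx) (F : 'I_n -> S) u :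
  tball T t u -> (size u < t)%N ->
  \big[op/idx]_(y | ((g u, y) \in G) && ((u == [::]) || (y != g (parent u)))) F y =
  \big[op/idx]_(k < T u) F (g (rcons u k)).
Proof.
move=> ut su; under eq_bigl do rewrite -mem_neighbours //.
rewrite -big_uniq ?uniq_neighbours // big_map -(big_mkord xpredT (fun k => F (g (rcons u k)))).
by rewrite /index_iota subn0.
Qed.

Lemma big_neighbours_root (S : Type) (idx : S) (op : Monoid.com_law idx) (F : 'I_n -> S) :
  (0 < t)%N -> \big[op/idx]_(y | (v, y) \in G) F y = \big[op/idx]_(k < T [::]) F (g [:: nat_of_ord k]).
Proof.
move=> t0; have [_ g0 _ _] := gb; rewrite -(@big_neighbours _ _ op F [::]) //.
by apply: eq_bigl => y; rewrite g0 andbT.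
Qed.

Lemma deg_tree : (0 < t)%N -> deg G v = T [::].
Proof.
move=> t0; rewrite /deg -sum1_card.
rewrite (eq_bigl (fun y => (v, y) \in G)); last first.
  by move=> y; apply/idP/idP => [/set_mem|h]; last exact/mem_set.
by rewrite big_neighbours_root // sum1_card card_ord.
Qed.
End Neighbours.

Section GraphMessages.
Variables (R : realType) (q : nat).
Local Notation k1 := (q.+1%:R : R).
Local Notation bb := (@bb R q).
Local Notation msg := (@msg R q).

Definition gbp n (p : R * R) (A : pred 'I_n) (m : 'I_n -> R) : R :=
  let a := expR p.2 * \prod_(y | A y) (1 + wgt p.1 * m y) in
  a / (a + k1 * \prod_(y | A y) (1 + wgt p.1 * bb (m y))).

(* Non-backtracking message passing on a graph; on tree balls it coincides with [msg]. *)
Fixpoint gmsg (a0 : R) (l : seq (R * R)) n (G : graphn n) (x z : 'I_n) : R :=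
  if l is p :: l' then gbp p (fun y => ((x, y) \in G) && (y != z)) (fun y => gmsg a0 l' G y x)
  else a0.

Lemma gbp_itv n p (A : pred 'I_n) m : 0 <= p.1 -> (forall y, 0 <= m y <= 1) -> 0 <= gbp p A m <= 1.
Proof.
move=> b0 m01.
have a0 : 0 < expR p.2 * \prod_(y | A y) (1 + wgt p.1 * m y).
  by rewrite mulr_gt0 ?expR_gt0 // prodr_gt0 // => y _; rewrite fac_gt0 //; case/andP: (m01 y).
have c0 : 0 < k1 * \prod_(y | A y) (1 + wgt p.1 * bb (m y)).
  rewrite mulr_gt0 ?k1_gt0 // prodr_gt0 // => y _; rewrite fac_gt0 // bb_ge0 //.
  by case/andP: (m01 y).
rewrite /gbp; apply/andP; split; first by rewrite divr_ge0 // ltW // addr_gt0.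
by rewrite ler_pdivrMr ?addr_gt0 // mul1r lerDl ltW.
Qed.

Lemma gmsg_itv a0 l n (G : graphn n) x z : 0 <= a0 <= 1 -> all (fun p => 0 <= p.1) l ->
  0 <= gmsg a0 l G x z <= 1.
Proof.
move=> a01; elim: l x z => //= p l IH x z /andP[p0 l0].
by apply: gbp_itv => // y; apply: IH.
Qed.

Section OnBall.
Variables (n : nat) (G : graphn n) (v : 'I_n) (T : ptree) (t : nat) (g : seq nat -> 'I_n).
Hypothesis gb : tree_ball G v T t g.

Lemma gmsg_up a0 l u : u != [::] -> tball T t u -> (size u + size l <= t)%N ->
  gmsg a0 l G (g u) (g (parent u)) = msg a0 l (fun w => T (u ++ w)).
Proof.
elim: l u => // p l IH u u0 ut su.
have su' : (size u < t)%N by apply: leq_trans su; rewrite /= addnS ltnS leq_addr.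
rewrite /= /gbp /bp /zz /nn0 /nn1 cats0.
have E (F : R -> R) : \prod_(y | ((g u, y) \in G) && (y != g (parent u))) F (gmsg a0 l G y (g u)) =
    \prod_(j < T u) F (msg a0 l (shift (fun w => T (u ++ w)) j)).
  rewrite (eq_bigl (fun y => ((g u, y) \in G) && ((u == [::]) || (y != g (parent u))))); last first.
    by move=> y; rewrite (negPf u0).
  rewrite (big_neighbours gb) //; apply: eq_bigr => -[k kT] _ /=.
  have := IH (rcons u k); rewrite parent_rcons => ->.
  - by congr (F (msg _ _ _)); apply/funext => w; rewrite cat_rcons.
  - by case: (u).
  - exact: (tball_rcons su' ut kT).
  - by rewrite size_rcons addSnnS.
by rewrite (E (fun x => 1 + wgt p.1 * x)) (E (fun x => 1 + wgt p.1 * bb x)).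
Qed.

Lemma gmsg_child a0 l j : (j < T [::])%N -> (size l < t)%N ->
  gmsg a0 l G (g [:: j]) v = msg a0 l (shift T j).
Proof.
move=> jT lt; have [_ g0 _ _] := gb; rewrite -{1}g0 -[[::]]/(parent [:: j]) gmsg_up //.
by rewrite /tball /= jT; apply: leq_ltn_trans lt.
Qed.

(** The message from the root that ignores child [j] combines the other children, which [skip]
    renumbers as the children of [remove_child T j]. *)
Lemma gmsg_down a0 l j : (j < T [::])%N -> (size l <= t)%N -> (0 < t)%N ->
  gmsg a0 l G v (g [:: j]) = msg a0 l (remove_child T j).
Proof.
case: l => // p l jT lt t0; rewrite remove_childE /=.
have [gi g0 _ _] := gb.
have jb : tball T t [:: j] by rewrite /tball /= jT.
have E (F : R -> R) : \prod_(y | ((v, y) \in G) && (y != g [:: j])) F (gmsg a0 l G y v) =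
    \prod_(i < (T [::]).-1) F (skip j (fun i => msg a0 l (shift T i)) i).
  pose F' y := if y != g [:: j] then F (gmsg a0 l G y v) else 1.
  rewrite big_mkcondr -/(F' _) (big_neighbours_root gb _ F' t0).
  rewrite (prod_skip (fun k => F' (g [:: k])) jT) {1}/F' eqxx mul1r.
  apply: eq_bigr => -[i iT] _; rewrite /skip /F' /=.
  have iD : (i.+1 < T [::])%N by rewrite -(ltn_predK jT) ltnS.
  set k := if (i < j)%N then i else i.+1.
  have kD : (k < T [::])%N by rewrite /k; case: ifP => // _; apply: ltnW.
  have kj : k != j.
    rewrite /k; case: ltnP => ij; first by rewrite ltn_eqF.
    by rewrite gtn_eqF // ltnS.
  rewrite ifT; first by rewrite gmsg_child.
  apply: contra kj => /eqP /gi E; have [] // : [:: k] = [:: j]; last by move=> ->.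
  by apply: E; rewrite unfold_in /tball /= ?kD ?jT.
rewrite /gbp /bp /zz /nn0 /nn1.
by rewrite (E (fun x => 1 + wgt p.1 * x)) (E (fun x => 1 + wgt p.1 * bb x)).
Qed.
End OnBall.
End GraphMessages.

Section Limsup.
Variable R : realType.
Implicit Types (u : nat -> \bar R) (x : \bar R).
Local Open Scope ereal_scope.

Lemma esup_lt u x : limn_esup u < x -> \forall n \near \oo, u n < x.
Proof.
move=> /ereal_inf_lt [_ [V oV <-] Vx]; apply: filterS oV => n Vn.
by apply: le_lt_trans Vx; apply: ereal_sup_ubound; exists n.
Qed.

Lemma esup_le u x : (\forall n \near \oo, u n <= x) -> limn_esup u <= x.
Proof.
move=> ux; apply: (@le_trans _ _ (ereal_sup (u @` [set n | u n <= x]))).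
  by apply: ereal_inf_lbound; exists [set n | u n <= x].
by apply: ub_ereal_sup => _ [n /= h <-].
Qed.

Lemma einf_ge u x : (\forall n \near \oo, x <= u n) -> x <= limn_einf u.
Proof.
move=> ux; rewrite /limn_einf leeNr; apply: esup_le; apply: filterS ux => n.
by rewrite leeN2.
Qed.
End Limsup.

Section Unimodularity.
Variables (R : realType) (q : nat) (P : forall n, graphn n -> R) (mu : probability ptree_mt R).
Hypotheses (rP : random_graphs P) (bc : ball_conv P mu) (us : uniformly_sparse P).
Local Notation En := (@En R P).
Local Notation Em := (@Em R mu).
Local Notation intg := (@intg R mu).
Local Notation msg := (@msg R q).
Local Notation gmsg := (@gmsg R q).

Definition degT (T : ptree) : R := (T [::])%:R.

Lemma isoG_deg t n (G : graphn n) v T : (0 < t)%N -> simple_graph G -> isoG t G v T ->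
  deg G v = T [::].
Proof. by move=> t0 sG i; have [g gb] := tree_ball_of_iso sG i; apply: deg_tree gb t0. Qed.

Lemma root_local t : (0 < t)%N -> is_local t (fun T : ptree => T [::]).
Proof. by move=> t0 T T' TT'; apply: TT'. Qed.

Lemma degT_mfun : mfun degT.
Proof. by apply: (@local_mfun R 1) => T T' TT'; rewrite /degT (root_local _ TT'). Qed.

Definition mindeg (L : nat) (d : nat) : R := (minn d L)%:R.

Lemma mindeg_intg L : intg (fun T => mindeg L (T [::])).
Proof.
apply: (@intg_bdd _ _ _ L%:R) => [|T].
  by apply: (@local_mfun R 1) => T T' TT'; rewrite (root_local _ TT').
by rewrite ger0_norm ?ler0n // ler_nat geq_minr.
Qed.

Lemma tail_bound : forall e, 0 < e -> exists L : nat, \forall n \near \oo,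
  En (fun (G : graphn n) v => (deg G v)%:R * ((L <= deg G v)%N)%:R) <= e.
Proof.
move=> e e0; have e0' : (0 < e%:E)%E by rewrite lte_fin.
have [L _ HL] := us (open_ereal_lt' e0').
exists L; have := HL L (leqnn L) => /= /esup_lt.
by apply: filterS => n; rewrite lte_fin => /ltW.
Qed.

Lemma deg_split L (d : nat) : (d%:R : R) <= mindeg L d + d%:R * ((L <= d)%N)%:R.
Proof.
rewrite /mindeg; have [Ld|] := boolP (L <= d)%N; first by rewrite mulr1 lerDr ler0n.
by rewrite -ltnNge => dL; rewrite (minn_idPl (ltnW dL)) mulr0 addr0.
Qed.

Lemma En_deg_bdd : exists M, \forall n \near \oo, En (fun (G : graphn n) v => (deg G v)%:R) <= M.
Proof.
have [L HL] := tail_bound (@ltr01 R); exists (L%:R + 1).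
near=> n; have n0 : (0 < n)%N by near: n; exists 1%N.
apply: (@le_trans _ _ (En (fun (G : graphn n) v => L%:R + (deg G v)%:R * ((L <= deg G v)%N)%:R))).
  apply: En_le => // G v _; apply: le_trans (deg_split L _) _.
  by rewrite lerD2r ler_nat geq_minr.
rewrite EnD (En_cst rP) // lerD2l.
by near: n.
Unshelve. all: by end_near.
Qed.

Lemma eventually_ex (Q : set nat) : eventually Q -> exists n, Q n.
Proof. by case=> N _ h; exists N; apply: (h N (leqnn N)). Qed.

(** Truncated degrees pass to the limit and stay below the mean degrees of the finite graphs,
    uniformly in [L]; monotone convergence in [L] then makes the root degree integrable. *)
Lemma mindeg_bdd : exists M, forall L, Em (fun T => mindeg L (T [::])) <= M.
Proof.
have [M HM] := En_deg_bdd; exists (M + 1) => L.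
have H : \forall n \near \oo, Em (fun T => mindeg L (T [::])) - 1 <=
     En (fun (G : graphn n) v => (deg G v)%:R).
  apply: (@transfer_ge R P mu rP bc 1 (fun n G v => (deg G v)%:R)) => //.
  - exact: mindeg_intg.
  - move=> n G v T sG i; rewrite -(isoG_deg _ sG i) //.
    by rewrite ler_nat geq_minl.
by have [n [/= h1 h2]] := eventually_ex (filterI H HM); lra.
Qed.

Lemma degT_intg : intg degT.
Proof.
have [M HM] := mindeg_bdd.
apply/integrableP; split; first by apply/measurable_realfun.measurable_EFinP; exact: degT_mfun.
pose md L (T : ptree) := mindeg L (T [::]).
have C : (fun L => (\int[mu]_(x in setT) (md L x)%:E)%E) @ \oo -->
    (\int[mu]_(x in setT) limn (fun L => (md L x)%:E))%E.
  apply: (@cvg_monotone_convergence _ _ _ mu setT measurableT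
     (fun L => EFin \o (md L : ptree_mt -> R))).
    by move=> L; apply/measurable_realfun.measurable_EFinP; exact: intg_mfun (mindeg_intg L).
    by move=> L T _; rewrite lee_fin ler0n.
  by move=> T _ L L' LL'; rewrite lee_fin ler_nat leq_min geq_minl (leq_trans (geq_minr _ _) LL').
have E : (\int[mu]_(x in setT) `|(EFin \o degT) x|)%E =
   (\int[mu]_(x in setT) limn (fun L => (md L x)%:E))%E.
  apply: eq_integral => T _; rewrite /= ger0_norm ?ler0n //; symmetry.
  apply: cvg_lim => //; apply: cvg_near_cst; exists (T [::]) => // L /= TL.
  by rewrite /md /mindeg /degT (minn_idPl TL).
rewrite E; apply: (@le_lt_trans _ _ M%:E); last exact: ltry.
rewrite -(cvg_lim _ C) //; apply: lime_le; first exact: (cvgP _ C).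
by apply: nearW => L; rewrite -(EmE (mindeg_intg L)) lee_fin.
Qed.

(** The lower bound is a transfer of the degree. For the upper bound the nonnegative function
    [L%:R - mindeg L] is transferred instead, and uniform sparsity controls the degrees of size at
    least [L]. *)
Lemma degT_cvg : (fun n => En (fun (G : graphn n) v => (deg G v)%:R)) @ \oo --> Em degT.
Proof.
apply/cvgrPdist_le => e e0; have e2 : 0 < e / 2 by rewrite divr_gt0.
have [L HL] := tail_bound e2.
have H1 : \forall n \near \oo, Em degT - e <= En (fun (G : graphn n) v => (deg G v)%:R).
  apply: (@transfer_ge R P mu rP bc 1 (fun n G v => (deg G v)%:R)) => //.
  - exact: degT_intg.
  - by move=> n G v T sG i; rewrite /degT -(isoG_deg _ sG i).
have H2 : \forall n \near \oo, Em (fun T => L%:R - mindeg L (T [::])) - e / 2 <=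
     En (fun (G : graphn n) v => L%:R - mindeg L (deg G v)).
  apply: (@transfer_ge R P mu rP bc 1 (fun n G v => L%:R - mindeg L (deg G v))) => //.
  - by move=> n G v; rewrite subr_ge0 ler_nat geq_minr.
  - by apply: intgB; [exact: intg_cst|exact: mindeg_intg].
  - by move=> T; rewrite subr_ge0 ler_nat geq_minr.
  - by move=> n G v T sG i; rewrite -(isoG_deg _ sG i).
near=> n; have n0 : (0 < n)%N by near: n; exists 1%N.
have h1 : Em degT - e <= En (fun (G : graphn n) v => (deg G v)%:R) by near: n.
have h2 : Em (fun T => L%:R - mindeg L (T [::])) - e / 2 <=
     En (fun (G : graphn n) v => L%:R - mindeg L (deg G v)) by near: n.
have h3 : En (fun (G : graphn n) v => (deg G v)%:R * ((L <= deg G v)%N)%:R) <= e / 2 by near: n.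
move: h2; rewrite EmB ?Em_cst ?EnB ?(En_cst rP) //; [|exact: intg_cst|exact: mindeg_intg].
move=> h2; have h4 : Em (fun T => mindeg L (T [::])) <= Em degT.
  apply: Em_le; [exact: mindeg_intg|exact: degT_intg|move=> T].
  by rewrite ler_nat geq_minl.
have h5 : En (fun (G : graphn n) v => (deg G v)%:R) <= En (fun (G : graphn n) v => mindeg L (deg G v)) +
    En (fun (G : graphn n) v => (deg G v)%:R * ((L <= deg G v)%N)%:R).
  by rewrite -EnD; apply: En_le => // G v _; apply: deg_split.
rewrite ler_norml; apply/andP; split; lra.
Unshelve. all: by end_near.
Qed.

Lemma intg_deg (f : ptree -> R) c : mfun f -> (forall T, `|f T| <= c * (1 + degT T)) -> intg f.
Proof.
move=> mf fc; apply: (intg_dom mf _ fc); apply: intgZ; apply: intgD; first exact: intg_cst.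
exact: degT_intg.
Qed.

(** [transfer_ge] applied to the nonnegative difference between [M * (1 + degree)] and [Y]; the mean
    degree converges and can be subtracted again. *)
Lemma transfer_le t (Y : forall n, graphn n -> 'I_n -> R) (k : ptree -> R) M : (0 < t)%N ->
  (forall n G v, Y n G v <= M * (1 + (deg G v)%:R)) -> intg k -> (forall T, k T <= M * (1 + degT T)) ->
  (forall n G v T, simple_graph G -> @isoG t n G v T -> Y n G v <= k T) ->
  forall e, 0 < e -> \forall n \near \oo, En (Y n) <= Em k + e.
Proof.
move=> t0 YM ik kM kY e e0.
have id : intg (fun T => 1 + degT T) by apply: intgD; [exact: intg_cst|exact: degT_intg].
have H1 : \forall n \near \oo, Em (fun T => M * (1 + degT T) - k T) - e / 2 <=
     En (fun (G : graphn n) v => M * (1 + (deg G v)%:R) - Y n G v).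
  apply: (@transfer_ge R P mu rP bc t (fun n G v => M * (1 + (deg G v)%:R) - Y n G v)).
  - by move=> n G v; rewrite subr_ge0.
  - by apply: intgB => //; apply: intgZ.
  - by move=> T; rewrite subr_ge0.
  - by move=> n G v T sG i; rewrite (isoG_deg t0 sG i) lerB // kY.
  - by rewrite divr_gt0.
have d0 : 0 < e / (2 * (`|M| + 1)) by rewrite divr_gt0 // mulr_gt0 // ltr_wpDl.
have /cvgrPdist_le/(_ _ d0) H2 := degT_cvg.
near=> n; have n0 : (0 < n)%N by near: n; exists 1%N.
have h1 : Em (fun T => M * (1 + degT T) - k T) - e / 2 <=
     En (fun (G : graphn n) v => M * (1 + (deg G v)%:R) - Y n G v) by near: n.
have h2 : `|Em degT - En (fun (G : graphn n) v => (deg G v)%:R)| <= e / (2 * (`|M| + 1)) by near: n.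
move: h1; rewrite EmB //; last exact: intgZ.
rewrite EmZ // EmD ?Em_cst //; [|exact: intg_cst|exact: degT_intg].
rewrite EnB EnZ EnD (En_cst rP) //.
have h3 : `|M| * `|Em degT - En (fun (G : graphn n) v => (deg G v)%:R)| <= e / 2.
  apply: (@le_trans _ _ (`|M| * (e / (2 * (`|M| + 1))))); first exact: ler_wpM2l.
  have M1 : 0 < `|M| + 1 by rewrite ltr_wpDl.
  rewrite mulrA ler_pdivrMr ?mulr_gt0 //.
  have -> : e / 2 * (2 * (`|M| + 1)) = e * (`|M| + 1) by field.
  by rewrite mulrC ler_pM2l // lerDl.
move: h3; rewrite -normrM ler_norml => /andP[h3 h4] h1; lra.
Unshelve. all: by end_near.
Qed.

Lemma transfer_cvg t (Y : forall n, graphn n -> 'I_n -> R) (k : ptree -> R) M : (0 < t)%N ->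
  (forall n G v, 0 <= Y n G v <= M * (1 + (deg G v)%:R)) -> mfun k ->
  (forall T, 0 <= k T <= M * (1 + degT T)) ->
  (forall n G v T, simple_graph G -> @isoG t n G v T -> Y n G v = k T) ->
  (fun n => En (Y n)) @ \oo --> Em k.
Proof.
move=> t0 YM mk kM Yk.
have ik : intg k.
  by apply: (intg_deg mk (c := M)) => T; have /andP[k0 kM'] := kM T; rewrite ger0_norm.
apply/cvgrPdist_le => e e0.
have H1 : \forall n \near \oo, Em k - e <= En (Y n).
  apply: (@transfer_ge R P mu rP bc t) => //.
  - by move=> n G v; case/andP: (YM n G v).
  - by move=> T; case/andP: (kM T).
  - by move=> n G v T sG i; rewrite (Yk _ _ _ _ sG i).
have H2 : \forall n \near \oo, En (Y n) <= Em k + e.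
  apply: (@transfer_le t Y k M) => //.
  - by move=> n G v; case/andP: (YM n G v).
  - by move=> T; case/andP: (kM T).
  - by move=> n G v T sG i; rewrite (Yk _ _ _ _ sG i).
apply: filterS (filterI H1 H2) => n [h1 h2].
by rewrite ler_norml; apply/andP; split; lra.
Qed.

Lemma msg_local a0 l : is_local (size l) (msg a0 l).
Proof.
elim: l => [|p l IH] T T' TT' //=; have E : T [::] = T' [::] by apply: TT'.
rewrite -E /bp /zz /nn0 /nn1.
have H (F : R -> R) : \prod_(j < T [::]) F (msg a0 l (shift T j)) =
    \prod_(j < T [::]) F (msg a0 l (shift T' j)).
  apply: eq_bigr => j _; congr F; apply: IH; exact: agree_shift (ltn_ord j) TT'.
by rewrite (H (fun x => 1 + wgt p.1 * x)) (H (fun x => 1 + wgt p.1 * bb q x)).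
Qed.

Lemma local_le s t (U : Type) (f : ptree -> U) : (s <= t)%N -> is_local s f -> is_local t f.
Proof. by move=> st lf T T' TT'; apply: lf; apply: agree_le TT'. Qed.

Lemma edge_sum_local s (a b : ptree -> R) (F : R -> R -> R) : is_local s a -> is_local s.+1 b ->
  is_local s.+1 (fun T => \sum_(j < T [::]) F (a (shift T j)) (b (remove_child T j))).
Proof.
move=> la lb T T' TT'; have E : T [::] = T' [::] by apply: TT'.
rewrite -E; apply: eq_bigr => j _; congr (F _ _).
  by apply: la; apply: agree_shift (ltn_ord j) TT'.
by apply: lb; apply: agree_remove (ltn_ord j) TT'.
Qed.

Lemma edge_sum_itv (T : ptree) (F : nat -> R) c : (forall j, (j < T [::])%N -> 0 <= F j <= c) ->
  0 <= \sum_(j < T [::]) F j <= c * degT T.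
Proof.
move=> F0; apply/andP; split.
  by apply: sumr_ge0 => j _; case/andP: (F0 j (ltn_ord j)).
rewrite /degT mulr_natr -[X in _ *+ X]card_ord -sumr_const ler_sum // => j _.
by case/andP: (F0 j (ltn_ord j)).
Qed.

(** On a finite graph the two sums over directed edges differ only by reversal of edges, so they are
    equal. Both converge, because messages after finitely many updates read a bounded ball and the
    sums are dominated by the degree. *)
Lemma unimodular_msg a0 l1 l2 (F : R -> R -> R) c : 0 <= a0 <= 1 ->
  all (fun p => 0 <= p.1) l1 -> all (fun p => 0 <= p.1) l2 -> 0 <= c ->
  (forall x y, 0 <= x <= 1 -> 0 <= y <= 1 -> 0 <= F x y <= c) ->
  Em (fun T => \sum_(j < T [::]) F (msg a0 l1 (shift T j)) (msg a0 l2 (remove_child T j))) =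
  Em (fun T => \sum_(j < T [::]) F (msg a0 l1 (remove_child T j)) (msg a0 l2 (shift T j))).
Proof.
move=> a01 p1 p2 c0 Fc.
(* One level more than the longer list, since a message from a child starts at depth one. *)
pose t := (maxn (size l1) (size l2)).+1.
pose Y1 n (G : graphn n) v := \sum_(y | (v, y) \in G) F (gmsg a0 l1 G y v) (gmsg a0 l2 G v y).
pose Y2 n (G : graphn n) v := \sum_(y | (v, y) \in G) F (gmsg a0 l1 G v y) (gmsg a0 l2 G y v).
have s1 : (size l1 < t)%N by rewrite ltnS leq_maxl.
have s2 : (size l2 < t)%N by rewrite ltnS leq_maxr.
have M l : all (fun p => 0 <= p.1) l -> forall T, 0 <= msg a0 l T <= 1 by move=> h T; apply: msg_itv01.
have Mg l n (G : graphn n) x y : all (fun p => 0 <= p.1) l -> 0 <= gmsg a0 l G x y <= 1.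
  by move=> h; apply: gmsg_itv.
have Yb n (G : graphn n) v (H : 'I_n -> R) : (forall y, 0 <= H y <= c) ->
    0 <= \sum_(y | (v, y) \in G) H y <= c * (1 + (deg G v)%:R).
  move=> H0; apply/andP; split; first by apply: sumr_ge0 => y _; case/andP: (H0 y).
  apply: (@le_trans _ _ (\sum_(y | (v, y) \in G) c)); first by apply: ler_sum => y _; case/andP: (H0 y).
  have dE : deg G v = #|fun y => (v, y) \in G|.
    by apply: eq_card => y; apply/idP/idP => [/set_mem|h]; last exact/mem_set.
  by rewrite sumr_const -dE -[leLHS]mulr_natr ler_wpM2l // lerDr.
have C1 : (fun n => En (@Y1 n)) @ \oo --> Em (fun T => \sum_(j < T [::]) F (msg a0 l1 (shift T j)) (msg a0 l2 (remove_child T j))).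
  apply: (@transfer_cvg t Y1 _ c) => //.
  - by move=> n G v; apply: Yb => y; apply: Fc; apply: Mg.
  - apply: (@local_mfun R t); apply: edge_sum_local.
      exact: (local_le (leq_maxl _ _) (@msg_local a0 l1)).
    exact: (local_le (ltnW s2) (@msg_local a0 l2)).
  - move=> T; have /andP[h1 h2] := @edge_sum_itv T (fun j => F (msg a0 l1 (shift T j)) (msg a0 l2 (remove_child T j))) c (fun j _ => Fc _ _ (M _ p1 _) (M _ p2 _)).
    by rewrite h1 (le_trans h2) // mulrDr mulr1 lerDr.
  - move=> n G v T sG i; have [g gb] := tree_ball_of_iso sG i.
    rewrite /Y1 (big_neighbours_root gb) //; apply: eq_bigr => -[j jT] _ /=.
    by rewrite (gmsg_child q gb) // (gmsg_down q gb) // ltnW.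
have C2 : (fun n => En (@Y2 n)) @ \oo --> Em (fun T => \sum_(j < T [::]) F (msg a0 l1 (remove_child T j)) (msg a0 l2 (shift T j))).
  apply: (@transfer_cvg t Y2 _ c) => //.
  - by move=> n G v; apply: Yb => y; apply: Fc; apply: Mg.
  - apply: (@local_mfun R t).
    apply: (@edge_sum_local (maxn (size l1) (size l2)) (msg a0 l2) (msg a0 l1) (fun x y => F y x)).
      exact: (local_le (leq_maxr _ _) (@msg_local a0 l2)).
    exact: (local_le (ltnW s1) (@msg_local a0 l1)).
  - move=> T; have /andP[h1 h2] := @edge_sum_itv T (fun j => F (msg a0 l1 (remove_child T j)) (msg a0 l2 (shift T j))) c (fun j _ => Fc _ _ (M _ p1 _) (M _ p2 _)).
    by rewrite h1 (le_trans h2) // mulrDr mulr1 lerDr.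
  - move=> n G v T sG i; have [g gb] := tree_ball_of_iso sG i.
    rewrite /Y2 (big_neighbours_root gb) //; apply: eq_bigr => -[j jT] _ /=.
    by rewrite (gmsg_child q gb) // (gmsg_down q gb) // ltnW.
suff E : (fun n => En (@Y1 n)) = (fun n => En (@Y2 n)).
  by rewrite -(cvg_lim (@Rhausdorff R) C1) E (cvg_lim (@Rhausdorff R) C2).
apply/funext => n; apply: eq_bigr => G _.
have [->|/(proj2 (proj2 (rP n))) sG] := eqVneq (P G) 0; first by rewrite !mul0r.
congr (_ * (_ * _)); rewrite /Y1 /Y2 (exchange_big_dep xpredT) //=.
apply: eq_bigr => y _; apply: eq_bigl => v; exact: edge_sym.
Qed.
End Unimodularity.

End GraphLimits.
Import GraphLimits.

Module BetheFunctional.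

(** * The Bethe functional along comparable fixed points *)

(** Here [v'] and [v] are vertex terms, [o] is the old edge sum, and [e11], [e10], [e01], [e00] are
    edge sums at the new coupling with new (1) or old (0) messages, first towards the root and then
    away from it. The two hypotheses on them are supermodularity and unimodularity. *)
Lemma bethe_split (R : realFieldType) (v' v e11 e10 e01 e00 o r : R) :
  e10 + e01 <= e11 + e00 -> e01 = e10 ->
  v' - v - (e10 - e00) - 2^-1 * (e00 - o) <= r -> v' - 2^-1 * e11 - (v - 2^-1 * o) <= r.
Proof. by move=> *; lra. Qed.

Section BetheExpectation.
Variables (R : realType) (q : nat) (P : forall n, graphn n -> R) (mu : probability ptree_mt R).
Hypotheses (rP : random_graphs P) (bc : ball_conv P mu) (us : uniformly_sparse P).
Local Notation Em := (@Em R mu).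
Local Notation intg := (@intg R mu).
Local Notation mfun := (@mfun R).
Local Notation degT := (@degT R).
Local Notation msg := (@msg R q).
Local Notation k1 := (q.+1%:R : R).
Local Notation eterm := (@eterm R q).
Local Notation edgep := (@edgep R q).
Local Notation zz := (@zz R q).
Local Notation nn1 := (@nn1 R q).
Local Notation msgdom := (@msgdom R q).
Local Notation cmp := (@comparable_step R).
Local Notation start := (@start R q).
Local Notation hlim := (@hlim R q).
Local Notation hseq := (@hseq R q).
Local Notation hmix := (@hmix R q).
Local Notation phiS := (@phiS R q).
Implicit Types (p : R * R) (up : bool) (T : ptree) (A : ptree -> R).

Definition eS beta (A B : ptree -> R) T : R :=
  \sum_(j < T [::]) eterm beta (A (shift T j)) (B (remove_child T j)).
Definition vS p A T : R := ln (zz p.1 p.2 (T [::]) (fun j => A (shift T j))).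
Definition edS up p T : R := \sum_(j < T [::]) edgep p.1 (hlim up p T) (hlim up p (shift T j)).

Lemma phiSE p A T : phiS p A T = vS p A T - 2^-1 * eS p.1 A A T.
Proof. by []. Qed.

(** One class for both finite iterates and their limits, so that integrability and unimodularity are
    proved once, by approximation with local functions. *)
Definition lim_msg up A := exists2 l : nat -> seq (R * R), forall t, all (@nonneg R) (l t) &
  forall T, (fun t => msg (start up) (l t) T) @ \oo --> A T.

Lemma lim_msg_hlim up p : nonneg p -> lim_msg up (hlim up p).
Proof.
move=> p0; exists (fun t => nseq t p) => [t|T]; first exact: nonneg_nseq.
exact: (@hseq_cvg _ _ up p T p0).
Qed.

Lemma lim_msg_msg up l : all (@nonneg R) l -> lim_msg up (msg (start up) l).
Proof. by move=> l0; exists (fun=> l) => // T; apply: cvg_cst. Qed.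

Lemma lim_msg_dom up A T : lim_msg up A -> msgdom (A T).
Proof.
by move=> [l l0 lA]; apply: (cvg_dom (lA T)) => t; apply: msg_dom => //; apply: start_dom.
Qed.

Lemma nonneg1 (l : seq (R * R)) : all (@nonneg R) l -> all (fun p => 0 <= p.1) l.
Proof. by apply: sub_all => p /andP[]. Qed.

Lemma cvg_ln (u : nat -> R) (a : R) : 0 < a -> u @ \oo --> a -> (fun t => ln (u t)) @ \oo --> ln a.
Proof. by move=> a0 ua; apply: (continuous_cvg _ (continuous_ln a0)). Qed.

Lemma cvg_eterm beta (u v : nat -> R) (a b : R) : 0 <= beta -> 0 <= a <= 1 -> 0 <= b <= 1 ->
  u @ \oo --> a -> v @ \oo --> b -> (fun t => eterm beta (u t) (v t)) @ \oo --> eterm beta a b.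
Proof.
move=> b0 a1 b1 ua vb; apply: cvg_ln.
  by apply: fac_gt0 => //; case/andP: (agree01 q a1 b1).
apply: cvgD; first exact: cvg_cst.
apply: cvgMr; apply: cvgD; first exact: cvgM.
by apply: cvgMr; apply: cvgM; apply: cvg_bb.
Qed.

Lemma cvg_edgep beta (u v : nat -> R) (a b : R) : 0 <= beta -> 0 <= a <= 1 -> 0 <= b <= 1 ->
  u @ \oo --> a -> v @ \oo --> b -> (fun t => edgep beta (u t) (v t)) @ \oo --> edgep beta a b.
Proof.
move=> b0 a1 /andP[b1 b2] ua vb.
have rc (x : nat -> R) (c : R) : 0 <= c -> x @ \oo --> c ->
    (fun t => rr beta (x t)) @ \oo --> rr beta c.
  move=> c0 xc; apply: cvgM; first exact: cvgMr.
  apply: cvgV; first by rewrite lt0r_neq0 // fac_gt0.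
  by apply: cvgD; [exact: cvg_cst|exact: cvgMr].
apply: cvgD; first by apply: cvgM => //; apply: rc.
by apply: cvgMr; apply: cvgM; [exact: cvg_bb|apply: rc; [exact: bb_ge0|exact: cvg_bb]].
Qed.

Lemma eS_itv up beta A B T : 0 <= beta -> lim_msg up A -> lim_msg up B ->
  0 <= eS beta A B T <= beta * degT T.
Proof.
move=> b0 lA lB; apply: (@edge_sum_itv R T (fun j => eterm beta (A (shift T j)) (B (remove_child T j)))) => j _.
by apply: eterm_itv => //; apply/dom01/lim_msg_dom; eassumption.
Qed.

Lemma eS_cvg up beta A B (l l' : nat -> seq (R * R)) T : 0 <= beta ->
  lim_msg up A -> lim_msg up B ->
  (forall T, (fun t => msg (start up) (l t) T) @ \oo --> A T) ->
  (forall T, (fun t => msg (start up) (l' t) T) @ \oo --> B T) ->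
  (fun t => eS beta (msg (start up) (l t)) (msg (start up) (l' t)) T) @ \oo --> eS beta A B T.
Proof.
move=> b0 lA lB lA' lB'.
apply: (@cvg_sum R (T [::]) (fun t j => eterm beta (msg (start up) (l t) (shift T j))
   (msg (start up) (l' t) (remove_child T j)))
   (fun j => eterm beta (A (shift T j)) (B (remove_child T j)))) => j _.
by apply: cvg_eterm => //; apply/dom01/lim_msg_dom; eassumption.
Qed.

Lemma eS_local beta up l l' : exists t, is_local t (eS beta (msg (start up) l) (msg (start up) l')).
Proof.
exists (maxn (size l) (size l')).+1.
apply: (@edge_sum_local R (maxn (size l) (size l')) (msg (start up) l) (msg (start up) l')).
  exact: (local_le (leq_maxl _ _) (@msg_local R q _ l)).
apply: (local_le _ (@msg_local R q _ l')); exact: leqW (leq_maxr _ _).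
Qed.

Lemma eS_Em_cvg up beta A B (l l' : nat -> seq (R * R)) : 0 <= beta ->
  (forall t, all (@nonneg R) (l t)) -> (forall t, all (@nonneg R) (l' t)) ->
  (forall T, (fun t => msg (start up) (l t) T) @ \oo --> A T) ->
  (forall T, (fun t => msg (start up) (l' t) T) @ \oo --> B T) ->
  intg (eS beta A B) /\
  (fun t => Em (eS beta (msg (start up) (l t)) (msg (start up) (l' t)))) @ \oo --> Em (eS beta A B).
Proof.
move=> b0 l0 l0' lA lB.
have LA : lim_msg up A by exists l.
have LB : lim_msg up B by exists l'.
apply: (@Em_cvg R mu (fun t => eS beta (msg (start up) (l t)) (msg (start up) (l' t))) _ (fun T => beta * degT T)).
- by move=> t; have [s ls] := eS_local beta up (l t) (l' t); apply: local_mfun ls.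
- by move=> T; apply: eS_cvg.
- by apply: intgZ; apply: (degT_intg rP bc us).
- move=> t T; have /andP[h1 h2] := eS_itv T b0 (lim_msg_msg up (l0 t)) (lim_msg_msg up (l0' t)).
  by rewrite ger0_norm.
Qed.

Lemma eS_intg up beta A B : 0 <= beta -> lim_msg up A -> lim_msg up B -> intg (eS beta A B).
Proof. by move=> b0 [l l0 lA] [l' l0' lB]; case: (eS_Em_cvg b0 l0 l0' lA lB). Qed.

Lemma eS_unimodular up beta A B : 0 <= beta -> lim_msg up A -> lim_msg up B ->
  Em (eS beta A B) = Em (eS beta B A).
Proof.
move=> b0 [l l0 lA] [l' l0' lB].
have [_ c1] := eS_Em_cvg b0 l0 l0' lA lB; have [_ c2] := eS_Em_cvg b0 l0' l0 lB lA.
suff E : (fun t => Em (eS beta (msg (start up) (l t)) (msg (start up) (l' t)))) =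
   (fun t => Em (eS beta (msg (start up) (l' t)) (msg (start up) (l t)))).
  by rewrite -(cvg_lim (@Rhausdorff R) c1) E (cvg_lim (@Rhausdorff R) c2).
apply/funext => t; rewrite /eS (@unimodular_msg R q P mu rP bc us _ (l t) (l' t) (eterm beta) beta) //.
- congr Em; apply/funext => T; apply: eq_bigr => j _; exact: etermC.
- exact/dom01/start_dom.
- exact: nonneg1.
- exact: nonneg1.
- by move=> x y x01 y01; apply: eterm_itv.
Qed.

Lemma zz_itv p D (x : nat -> R) : 0 <= p.1 -> 0 <= p.2 ->
  (forall j, (j < D)%N -> 0 <= x j <= 1) ->
  p.2 <= ln (zz p.1 p.2 D x) <= ln (expR p.2 + k1) + p.1 * D%:R.
Proof.
move=> b0 B0 dx; have w0 := wgt_ge0 b0.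
have n1 : 0 < nn1 p.1 D x by apply: nn1_gt0 => // j /dx /andP[].
have f1 c : 0 <= c -> 1 <= 1 + wgt p.1 * c by move=> c0; rewrite lerDl mulr_ge0.
have prod1 (F : nat -> R) : (forall j, (j < D)%N -> 0 <= F j) -> 1 <= \prod_(j < D) (1 + wgt p.1 * F j).
  move=> F0; have {1}-> : 1 = \prod_(j < D) (1 : R) by rewrite big1.
  by apply: ler_prod => j _; rewrite ler01 f1 // F0.
have prod2 (F : nat -> R) : (forall j, (j < D)%N -> 0 <= F j <= 1) ->
    \prod_(j < D) (1 + wgt p.1 * F j) <= expR (p.1 * D%:R).
  move=> F0; rewrite expRM_natr -[X in _ <= _ ^+ X]card_ord -prodr_const.
  apply: ler_prod => j _; have /andP[g0 g1] := F0 j (ltn_ord j).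
  rewrite (le_trans ler01 (f1 _ g0)) /=.
  by have := ler_wpM2l w0 g1; rewrite /wgt; lra.
have bx j : (j < D)%N -> 0 <= bb q (x j) <= 1.
  move=> /dx /andP[x0 x1]; rewrite bb_ge0 //= /bb ler_pdivrMr ?k1_gt0 // mul1r.
  by apply: (@le_trans _ _ 1); [lra|rewrite ler1n].
apply/andP; split.
  rewrite -[leLHS](@expRK R); apply: ln_le; first exact: expR_gt0.
  apply: (@le_trans _ _ (nn0 p.1 p.2 D x)).
    by rewrite /nn0 ler_peMr ?expR_ge0 // prod1 // => j /dx /andP[].
  by rewrite lerDl mulr_ge0 // ltW.
rewrite -[X in _ + X](@expRK R) -lnM ?posrE ?expR_gt0 ?addr_gt0 ?expR_gt0 ?k1_gt0 //.
apply: ln_le; first exact: zz_gt0.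
rewrite mulrDl; apply: lerD; first by rewrite /nn0 ler_wpM2l ?expR_ge0 // prod2.
by apply: ler_wpM2l; [exact/ltW/k1_gt0|exact: (prod2 (fun j => bb q (x j)))].
Qed.

Lemma vS_bound up p A T : nonneg p -> lim_msg up A ->
  `|vS p A T| <= (ln (expR p.2 + k1) + p.1) * (1 + degT T).
Proof.
move=> /andP[b0 B0] lA.
have /andP[h1 h2] := @zz_itv p (T [::]) (fun j => A (shift T j)) b0 B0 (fun j _ => dom01 (lim_msg_dom _ lA)).
have l0 : 0 <= ln (expR p.2 + k1).
  apply: ln_ge0; have := ltW (k1_gt0 R q); have : 1 <= expR p.2 by rewrite -expR0 ler_expR.
  lra.
rewrite ger0_norm ?(le_trans B0) //; apply: le_trans h2 _.
have : 0 <= ln (expR p.2 + k1) * degT T by rewrite mulr_ge0 // ler0n.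
rewrite /GraphLimits.degT; lra.
Qed.

Lemma vS_local p up l : is_local (size l).+1 (vS p (msg (start up) l)).
Proof.
move=> T T' TT'; have E : T [::] = T' [::] by apply: TT'.
have H (F : R -> R) : \prod_(j < T [::]) F (msg (start up) l (shift T j)) =
    \prod_(j < T [::]) F (msg (start up) l (shift T' j)).
  apply: eq_bigr => j _; congr F; apply: msg_local; exact: agree_shift (ltn_ord j) TT'.
rewrite /vS -E /zz /nn0 /nn1.
by rewrite (H (fun x => 1 + wgt p.1 * x)) (H (fun x => 1 + wgt p.1 * bb q x)).
Qed.

Lemma vS_Em_cvg up p A (l : nat -> seq (R * R)) : nonneg p ->
  (forall t, all (@nonneg R) (l t)) ->
  (forall T, (fun t => msg (start up) (l t) T) @ \oo --> A T) ->
  intg (vS p A) /\ (fun t => Em (vS p (msg (start up) (l t)))) @ \oo --> Em (vS p A).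
Proof.
move=> p0 l0 lA; have LA : lim_msg up A by exists l.
have b0 : 0 <= p.1 by case/andP: p0.
apply: (@Em_cvg R mu (fun t => vS p (msg (start up) (l t))) _ (fun T => (ln (expR p.2 + k1) + p.1) * (1 + degT T))).
- by move=> t; apply: local_mfun (@vS_local p up (l t)).
- move=> T; apply: cvg_ln; first by apply: zz_gt0 => // j _; apply/dom01/(lim_msg_dom _ LA).
  exact: (@cvg_zz R q p.1 p.2 (T [::]) (fun t j => msg (start up) (l t) (shift T j)) (fun j => A (shift T j))).
- by apply: intgZ; apply: intgD; [exact: intg_cst|exact: (degT_intg rP bc us)].
- by move=> t T; apply: (vS_bound T p0 (lim_msg_msg up (l0 t))).
Qed.

Lemma vS_intg up p A : nonneg p -> lim_msg up A -> intg (vS p A).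
Proof. by move=> p0 [l l0 lA]; case: (vS_Em_cvg p0 l0 lA). Qed.

Lemma phiS_intg up p A : nonneg p -> lim_msg up A -> intg (phiS p A).
Proof.
move=> p0 lA; have /andP[b0 _] := p0.
by apply: intgB; [exact: vS_intg lA|apply: intgZ; exact: (eS_intg b0 lA lA)].
Qed.

Lemma Em_phiS up p A : nonneg p -> lim_msg up A ->
  Em (phiS p A) = Em (vS p A) - 2^-1 * Em (eS p.1 A A).
Proof.
move=> p0 lA; have /andP[b0 _] := p0; have i1 := eS_intg b0 lA lA.
by rewrite -EmZ // -EmB //; [exact: vS_intg lA|exact: intgZ].
Qed.

Lemma phiS_Em_cvg up p A (l : nat -> seq (R * R)) : nonneg p ->
  (forall t, all (@nonneg R) (l t)) ->
  (forall T, (fun t => msg (start up) (l t) T) @ \oo --> A T) ->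
  (fun t => Em (phiS p (msg (start up) (l t)))) @ \oo --> Em (phiS p A).
Proof.
move=> p0 l0 lA; have LA : lim_msg up A by exists l.
have /andP[b0 _] := p0.
rewrite (Em_phiS p0 LA) (_ : (fun t => _) = fun t => Em (vS p (msg (start up) (l t))) -
   2^-1 * Em (eS p.1 (msg (start up) (l t)) (msg (start up) (l t)))); last first.
  by apply/funext => t; apply: (Em_phiS p0 (lim_msg_msg up (l0 t))).
apply: cvgB; first exact: (vS_Em_cvg p0 l0 lA).2.
by apply: cvgMr; apply: (eS_Em_cvg b0 l0 l0 lA lA).2.
Qed.

Lemma cmp_sign up (a b c d : R) : cmp up a b -> cmp up c d -> 0 <= (b - a) * (d - c).
Proof.
case: up => /= h1 h2; first by rewrite mulr_ge0 // subr_ge0.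
by rewrite -mulrNN !opprB mulr_ge0 // subr_ge0.
Qed.

Lemma eS_mixed up beta A B : 0 <= beta -> lim_msg up A -> lim_msg up B ->
  (forall T, cmp up (A T) (B T)) ->
  Em (eS beta B A) + Em (eS beta A B) <= Em (eS beta B B) + Em (eS beta A A).
Proof.
move=> b0 lA lB AB.
have i1 := eS_intg b0 lB lA; have i2 := eS_intg b0 lA lB.
have i3 := eS_intg b0 lB lB; have i4 := eS_intg b0 lA lA.
rewrite -!EmD //; apply: Em_le; [exact: intgD|exact: intgD|move=> T].
rewrite /eS -!big_split /=; apply: ler_sum => j _.
have dA U := dom01 (lim_msg_dom U lA); have dB U := dom01 (lim_msg_dom U lB).
by apply: eterm_mixed => //; apply: cmp_sign (AB _) (AB _).
Qed.

(** By [vertex_super] the vertex term gains at least the change of the edge sum under the incoming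
    messages alone, the outgoing ones being already updated. Supermodularity and unimodularity
    together say that half of the full edge change is no larger. *)
Lemma phi_update_ge up p l : nonneg p -> all (@nonneg R) l ->
  (forall T, cmp up (msg (start up) l T) (msg (start up) (p :: l) T)) ->
  Em (phiS p (msg (start up) l)) <= Em (phiS p (msg (start up) (p :: l))).
Proof.
move=> p0 l0 AB; have /andP[b0 B0] := p0.
set A := msg (start up) l in AB *; set B := msg (start up) (p :: l) in AB *.
have lA : lim_msg up A by apply: lim_msg_msg.
have lB : lim_msg up B by apply: lim_msg_msg; rewrite /= p0.
have i1 := eS_intg b0 lB lB; have i2 := eS_intg b0 lA lB.
have iv1 := vS_intg p0 lA; have iv2 := vS_intg p0 lB.
have V : Em (eS p.1 B B) - Em (eS p.1 A B) <= Em (vS p B) - Em (vS p A).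
  rewrite -!EmB //; apply: Em_le; [exact: intgB|exact: intgB|move=> T].
  rewrite /eS -sumrB.
  have dA U : 0 <= A U <= 1 by apply: dom01 (lim_msg_dom U lA).
  have dB U : 0 <= B U <= 1 by apply: dom01 (lim_msg_dom U lB).
  apply: (@vertex_super R q p (T [::]) (fun j => A (shift T j)) (fun j => B (shift T j))
     (fun j => B (remove_child T j))) => //.
    by move=> j jT; exact: (@cavity_msg R q up p l T j p0 l0 jT).
  by case: (up) AB => AB; [left|right] => j _; apply: AB.
have M := eS_mixed b0 lA lB AB; have U := eS_unimodular b0 lA lB.
rewrite (Em_phiS p0 lA) (Em_phiS p0 lB); lra.
Qed.

Lemma phi_hmix_ge up p p' s t : nonneg p -> nonneg p' -> cmp2 up p p' ->
  Em (phiS p' (hseq up p t)) <= Em (phiS p' (hmix up p' s p t)).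
Proof.
move=> p0 p0' pp; elim: s => [|s IH] //; apply: le_trans IH _.
apply: (@phi_update_ge up p' (nseq s p' ++ nseq t p)) => //; first exact: all_nonneg_mix.
by move=> T; apply: hmix_cmpS.
Qed.

(** Two limits: the number [s] of updates at [p'], for a fixed number [t] of updates at [p], and
    then [t]. *)
Lemma phi_hlim_ge up p p' : nonneg p -> nonneg p' -> cmp2 up p p' ->
  Em (phiS p' (hlim up p)) <= Em (phiS p' (hlim up p')).
Proof.
move=> p0 p0' pp.
have c1 := @phiS_Em_cvg up p' (hlim up p) (fun t => nseq t p) p0' (fun t => nonneg_nseq t p0)
   (fun T => @hseq_cvg R q up p T p0).
apply: (cvg_le c1 (cvg_cst _)) => t.
have c2 := @phiS_Em_cvg up p' (hlim up p') (fun s => nseq s p' ++ nseq t p) p0'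
   (fun s => all_nonneg_mix s t p0' p0) (fun T => @hmix_cvg R q up p' p t T p0' p0 pp).
apply: (cvg_le (cvg_cst _) c2) => s.
exact: phi_hmix_ge.
Qed.

Definition Phi up p := Em (phiS p (hlim up p)).

Lemma hlim_mfun up p : nonneg p -> mfun (hlim up p).
Proof.
move=> p0; apply: (mfun_cvg (F := fun t => hseq up p t)) => [t|T]; last exact: hseq_cvg.
exact: local_mfun (@msg_local R q _ (nseq t p)).
Qed.

Lemma hlim_intg up p : nonneg p -> intg (hlim up p).
Proof.
move=> p0; apply: (@intg_bdd _ _ _ 1); first exact: hlim_mfun.
by move=> T; have /andP[h0 h1] := dom01 (@hlim_dom R q up p T p0); rewrite ger0_norm.
Qed.

Lemma edgep_itv beta (a b : R) : 0 <= beta -> msgdom a -> msgdom b -> 0 <= edgep beta a b <= 1.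
Proof.
move=> b0 da db; have /andP[a0 a1] := dom01 da.
have /andP[r0 r1] := rr_itv b0 (dom01 db); have /andP[s0 s1] := rr_itv b0 (dombb db).
have bs := bb_sum q a; have bb0 := bb_ge0 q a1.
have h : 0 <= k1 * bb q a by rewrite mulr_ge0 // ltW // k1_gt0.
rewrite /MessageAlgebra.edgep mulrA; apply/andP; split; first by rewrite addr_ge0 // mulr_ge0.
rewrite -[leRHS]bs; apply: lerD; first by rewrite ler_piMr.
by rewrite ler_piMr.
Qed.

(** The root has one update more than its child, so that both messages come from the same boundary
    sphere. *)
Definition edseq up p t T : R :=
  \sum_(j < T [::]) edgep p.1 (hseq up p t.+1 T) (hseq up p t (shift T j)).

Lemma edseq_local up p t : is_local t.+1 (edseq up p t).
Proof.
move=> T T' TT'; have E : T [::] = T' [::] by apply: TT'.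
rewrite /edseq -E; apply: eq_bigr => j _; congr (edgep _ _ _).
  by have := @msg_local R q (start up) (nseq t.+1 p) T T'; rewrite size_nseq => h; apply: h.
have := @msg_local R q (start up) (nseq t p) (shift T j) (shift T' j).
by rewrite size_nseq; apply; apply: agree_shift (ltn_ord j) TT'.
Qed.

Lemma edseq_itv up p t T : nonneg p -> 0 <= edseq up p t T <= degT T.
Proof.
move=> p0; rewrite -[degT T]mul1r.
apply: (@edge_sum_itv R T (fun j => edgep p.1 (hseq up p t.+1 T) (hseq up p t (shift T j)))) => j _.
by apply: edgep_itv; rewrite ?hseq_dom //; case/andP: p0.
Qed.

Lemma edseq_Em_cvg up p : nonneg p ->
  intg (edS up p) /\ (fun t => Em (edseq up p t)) @ \oo --> Em (edS up p).
Proof.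
move=> p0; apply: (@Em_cvg R mu (edseq up p) _ degT).
- by move=> t; apply: local_mfun (@edseq_local up p t).
- move=> T; apply: (@cvg_sum R (T [::])
    (fun t j => edgep p.1 (hseq up p t.+1 T) (hseq up p t (shift T j)))
    (fun j => edgep p.1 (hlim up p T) (hlim up p (shift T j)))) => j _.
  apply: cvg_edgep; first by case/andP: p0.
  + exact/dom01/hlim_dom.
  + exact/dom01/hlim_dom.
  + by rewrite (cvg_shiftS (fun t => hseq up p t T)); apply: hseq_cvg.
  + exact: hseq_cvg.
- exact: (degT_intg rP bc us).
- by move=> t T; have /andP[h0 h1] := edseq_itv up t T p0; rewrite ger0_norm.
Qed.

Lemma hseq_Em_cvg up p : nonneg p -> (fun t => Em (hseq up p t)) @ \oo --> Em (hlim up p).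
Proof.
move=> p0; have [||||//] := @Em_cvg R mu (fun t => hseq up p t) (hlim up p) (fun=> 1).
- by move=> t; apply: local_mfun (@msg_local R q _ (nseq t p)).
- by move=> T; apply: hseq_cvg.
- exact: intg_cst.
- by move=> t T; have /andP[h0 h1] := dom01 (@hseq_dom R q up p t T p0); rewrite ger0_norm.
Qed.

(** Explicit derivative of the Bethe functional at [p] in the direction [p' - p], messages being
    frozen: the expected mass of colour 0 at the root and half the expected number of agreeing root
    edges. *)
Definition slope up p p' : R :=
  (p'.2 - p.2) * Em (hlim up p) + (p'.1 - p.1) * (2^-1 * Em (edS up p)).

(** The parameters move first, with messages fixed ([bethe_param_ge]); then the messages move to
    their new fixed point, which does not decrease the functional ([phi_hlim_ge]). *)
Lemma Phi_ge up p p' : nonneg p -> nonneg p' -> cmp2 up p p' -> `|p'.1 - p.1| <= 2^-1 ->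
  slope up p p' - (p'.1 - p.1) ^+ 2 * Em degT <= Phi up p' - Phi up p.
Proof.
move=> p0 p0' pp db; have /andP[b0 _] := p0; have /andP[b0' _] := p0'.
have L := lim_msg_hlim up p0; have [ie _] := edseq_Em_cvg up p0.
have ih := hlim_intg up p0; have id := degT_intg rP bc us.
apply: (@le_trans _ _ (Em (phiS p' (hlim up p)) - Phi up p)); last first.
  by rewrite lerD2r; apply: phi_hlim_ge.
have if1 := phiS_intg p0' L; have if2 := phiS_intg p0 L.
have j1 := intgZ (p'.2 - p.2) ih.
have j2 := intgZ (p'.1 - p.1) (intgZ 2^-1 ie).
have j3 := intgZ ((p'.1 - p.1) ^+ 2) id.
have -> : slope up p p' - (p'.1 - p.1) ^+ 2 * Em degT = Em (fun T =>
    ((p'.2 - p.2) * hlim up p T + (p'.1 - p.1) * (2^-1 * edS up p T)) - (p'.1 - p.1) ^+ 2 * degT T).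
  by rewrite (EmB (intgD j1 j2) j3) (EmD j1 j2) (EmZ _ ih) (EmZ _ (intgZ _ ie)) (EmZ _ ie) (EmZ _ id).
rewrite /Phi -(EmB if1 if2); apply: (Em_le (intgB (intgD j1 j2) j3) (intgB if1 if2)).
move=> T; have dh U := dom01 (@hlim_dom R q up p U p0).
have H := @bethe_param_ge R q p p' (T [::]) (fun j => hlim up p (shift T j))
   (fun j => hlim up p (remove_child T j)) b0 b0' (fun j _ => dh _) (fun j _ => dh _).
rewrite -(@hlim_fix R q up p T p0) in H.
apply: le_trans (H _ db) _; first by move=> j jT; rewrite cavity_hlim.
rewrite !phiSE /vS /eS sumrB mulrBr; lra.
Qed.

(** Every term is a product of two increments, each of a parameter or of a message. *)
Definition step_error up p p' (C : R) T : R :=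
  `|p'.2 - p.2| * `|hlim up p' T - hlim up p T| +
  \sum_(j < T [::]) (C * (`|hlim up p' T - hlim up p T| * `|hlim up p' (shift T j) - hlim up p (shift T j)|) +
      (`|p'.1 - p.1| * `|hlim up p' T - hlim up p T| + 2 * (p'.1 - p.1) ^+ 2)).

(** Supermodularity and unimodularity reduce the expected change of the edge sum to the one with the
    outgoing messages frozen at their old values, to which [bethe_step_le] applies at each root. *)
Lemma Phi_le up p p' C : nonneg p -> nonneg p' -> cmp2 up p p' -> `|p'.1 - p.1| <= 2^-1 ->
  2 * wgt p'.1 <= C -> intg (step_error up p p' C) ->
  Phi up p' - Phi up p <= slope up p p' + Em (step_error up p p' C).
Proof.
move=> p0 p0' pp db hC ierr; have /andP[b0 _] := p0; have /andP[b0' _] := p0'.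
have L := lim_msg_hlim up p0; have L' := lim_msg_hlim up p0'.
have [ie _] := edseq_Em_cvg up p0; have ih := hlim_intg up p0.
have cp T : cmp up (hlim up p T) (hlim up p' T) by apply: hlim_cmp2.
have M := eS_mixed b0' L L' cp; have U := eS_unimodular b0' L L'.
have i1 := eS_intg b0' L' L; have i2 := eS_intg b0' L L; have i3 := eS_intg b0 L L.
have v1 := vS_intg p0' L'; have v2 := vS_intg p0 L.
suff S : Em (vS p' (hlim up p')) - Em (vS p (hlim up p)) -
    (Em (eS p'.1 (hlim up p') (hlim up p)) - Em (eS p'.1 (hlim up p) (hlim up p))) -
    2^-1 * (Em (eS p'.1 (hlim up p) (hlim up p)) - Em (eS p.1 (hlim up p) (hlim up p))) <=
    slope up p p' + Em (step_error up p p' C).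
  rewrite /Phi (Em_phiS p0' L') (Em_phiS p0 L).
  exact: bethe_split M U S.
have j1 := intgB v1 v2; have j2 := intgB i1 i2; have j3 := intgB i2 i3.
have k2 := intgZ 2^-1 j3.
have s1 := intgZ (p'.2 - p.2) ih; have s2 := intgZ (p'.1 - p.1) (intgZ 2^-1 ie).
have -> : Em (vS p' (hlim up p')) - Em (vS p (hlim up p)) -
    (Em (eS p'.1 (hlim up p') (hlim up p)) - Em (eS p'.1 (hlim up p) (hlim up p))) -
    2^-1 * (Em (eS p'.1 (hlim up p) (hlim up p)) - Em (eS p.1 (hlim up p) (hlim up p))) =
    Em (fun T => (vS p' (hlim up p') T - vS p (hlim up p) T) -
      (eS p'.1 (hlim up p') (hlim up p) T - eS p'.1 (hlim up p) (hlim up p) T) -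
      2^-1 * (eS p'.1 (hlim up p) (hlim up p) T - eS p.1 (hlim up p) (hlim up p) T)).
  by rewrite (EmB (intgB j1 j2) k2) (EmB j1 j2) (EmB v1 v2) (EmB i1 i2) (EmZ _ j3) (EmB i2 i3).
have -> : slope up p p' + Em (step_error up p p' C) = Em (fun T =>
    ((p'.2 - p.2) * hlim up p T + (p'.1 - p.1) * (2^-1 * edS up p T)) + step_error up p p' C T).
  by rewrite (EmD (intgD s1 s2) ierr) (EmD s1 s2) (EmZ _ ih) (EmZ _ (intgZ _ ie)) (EmZ _ ie).
apply: (Em_le (intgB (intgB j1 j2) k2) (intgD (intgD s1 s2) ierr)).
move=> T; have dh W := @hlim_dom R q up p W p0; have dh' W := @hlim_dom R q up p' W p0'.
have H := @bethe_step_le R q up p p' (T [::]) (fun j => hlim up p (shift T j))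
   (fun j => hlim up p' (shift T j)) (fun j => hlim up p (remove_child T j)) C b0 b0' hC
   (fun j _ => dh _) (fun j _ => dh' _) (fun j _ => dh _).
rewrite -(@hlim_fix R q up p T p0) -(@hlim_fix R q up p' T p0') in H.
have {}H := H _ db _ (fun j _ => cp _) (cp T) (hlim up p T) (hlim up p' T) erefl erefl.
have {}H := H (fun j jT => @cavity_hlim R q up p T j p0 jT) (proj1 (andP pp)).
by rewrite /vS /eS /step_error -!sumrB; exact: H.
Qed.
End BetheExpectation.

End BetheFunctional.
Import BetheFunctional.

(** * Free energy increments of finite graphs *)

Section FreeEnergy.
Variables (R : realType) (q : nat) (P : forall n, graphn n -> R) (mu : probability ptree_mt R).
Hypotheses (rP : random_graphs P) (bc : ball_conv P mu) (us : uniformly_sparse P).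
Local Notation Em := (@Em R mu).
Local Notation En := (@En R P).
Local Notation hlim := (@hlim R q).
Local Notation hseq := (@hseq R q).
Local Notation gibbs := (@gibbs R q).
Local Notation phin := (@phin R q.+2 P).
Local Notation X := 'I_q.+2.
Implicit Types (p : R * R) (up : bool).

Definition yroot p n (G : graphn n) (v : 'I_n) : R := gibbs p G (fun s => s v == ord0).
Definition yedge p n (G : graphn n) (v : 'I_n) : R :=
  \sum_(y | (v, y) \in G) gibbs p G (fun s => s v == s y).
Definition slopen p p' n : R :=
  (p'.2 - p.2) * En (@yroot p n) + (p'.1 - p.1) * (2^-1 * En (@yedge p n)).

Section OneGraph.
Variables (n : nat) (G : graphn n).
Hypothesis sG : simple_graph G.
Local Notation W := (@gibbs_weight R q n).

Lemma gibbs_weight_gt0 p sigma : 0 < W p G sigma.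
Proof.
by rewrite /gibbs_weight mulr_gt0 // prodr_gt0 // => i _; apply: expR_gt0.
Qed.

Lemma ZG_gibbs p : ZG q.+2 p.1 p.2 G = \sum_sigma W p G sigma.
Proof. by []. Qed.

Lemma ZG_gt0 p : 0 < ZG q.+2 p.1 p.2 G.
Proof.
rewrite ZG_gibbs (bigD1 [ffun=> ord0]) //= ltr_pwDl ?gibbs_weight_gt0 //.
by apply: sumr_ge0 => s _; rewrite ltW // gibbs_weight_gt0.
Qed.

Lemma gibbs_itv p H : 0 <= gibbs p G H <= 1.
Proof.
rewrite /gibbs; apply/andP; split.
  by rewrite divr_ge0 ?(ltW (ZG_gt0 p)) // sumr_ge0 // => s _; rewrite ltW // gibbs_weight_gt0.
rewrite ler_pdivrMr ?ZG_gt0 // mul1r ZG_gibbs big_mkcond; apply: ler_sum => s _.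
by case: (H s) => //; rewrite ltW // gibbs_weight_gt0.
Qed.

Definition energy (d : R * R) (sigma : {ffun 'I_n -> X}) : R :=
  d.2 * (\sum_(v : 'I_n) (sigma v == ord0)%:R) +
  d.1 * (\sum_(e in G | (e.1 < e.2)%N) (sigma e.1 == sigma e.2)%:R).

Lemma gibbs_weight_shift p p' sigma :
  W p' G sigma = W p G sigma * expR (energy (p'.1 - p.1, p'.2 - p.2) sigma).
Proof.
have prod_exp (I : Type) (r : seq I) (Q : pred I) b (F : I -> R) :
   \prod_(i <- r | Q i) expR (b * F i) = expR (b * \sum_(i <- r | Q i) F i).
  by rewrite mulr_sumr expR_sum.
have E p0 : W p0 G sigma = expR (energy p0 sigma).
  rewrite /gibbs_weight /energy expRD mulrC; congr (_ * _); last exact: prod_exp.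
  rewrite -prod_exp; apply: eq_bigr => i _; by rewrite /psib -val_eqE.
by rewrite !E -expRD /energy /=; congr expR; ring.
Qed.

(** Convexity of the logarithm of the partition function: its increment is at least the Gibbs mean
    [m] of the energy change, as the tangent of [expR] at [m] shows. *)
Lemma lnZG_ge p p' :
  (p'.2 - p.2) * \sum_v gibbs p G (fun s => s v == ord0) +
  (p'.1 - p.1) * \sum_(e in G | (e.1 < e.2)%N) gibbs p G (fun s => s e.1 == s e.2) <=
  ln (ZG q.+2 p'.1 p'.2 G) - ln (ZG q.+2 p.1 p.2 G).
Proof.
set d := (p'.1 - p.1, p'.2 - p.2); have Z0 := ZG_gt0 p.
have gE H : gibbs p G H = \sum_sigma (W p G sigma / ZG q.+2 p.1 p.2 G) * (H sigma)%:R.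
  rewrite /gibbs mulr_suml big_mkcond; apply: eq_bigr => s _.
  by case: (H s); rewrite ?mulr1 ?mulr0.
set m := (X in X <= _).
have mE : m = \sum_sigma (W p G sigma / ZG q.+2 p.1 p.2 G) * energy d sigma.
  rewrite /m; under eq_bigr do rewrite gE; under [X in _ + _ * X]eq_bigr do rewrite gE.
  rewrite exchange_big [X in _ + _ * X]exchange_big /= !mulr_sumr -big_split /=.
  apply: eq_bigr => s _; rewrite /energy -!mulr_sumr /=; ring.
have W1 : \sum_sigma (W p G sigma / ZG q.+2 p.1 p.2 G) = 1.
  by rewrite -mulr_suml -ZG_gibbs divff // lt0r_neq0.
rewrite lnB ?ZG_gt0 // -[leLHS](@expRK R); apply: ln_le; first exact: expR_gt0.
have -> : ZG q.+2 p'.1 p'.2 G / ZG q.+2 p.1 p.2 G =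
    \sum_sigma (W p G sigma / ZG q.+2 p.1 p.2 G) * expR (energy d sigma).
  rewrite [X in X / _]ZG_gibbs mulr_suml; apply: eq_bigr => s _.
  by rewrite (gibbs_weight_shift p p') mulrAC.
apply: (@le_trans _ _ (\sum_sigma (W p G sigma / ZG q.+2 p.1 p.2 G) *
    (expR m * (1 + (energy d sigma - m))))).
  rewrite (eq_bigr (fun s => expR m * ((W p G s / ZG q.+2 p.1 p.2 G) * (1 - m)) +
     expR m * ((W p G s / ZG q.+2 p.1 p.2 G) * energy d s))); last by move=> s _; ring.
  rewrite big_split /= -!mulr_sumr -mulr_suml W1 -mE mul1r -mulrDr subrK mulr1.
  exact: lexx.
apply: ler_sum => s _; apply: ler_wpM2l; first by rewrite divr_ge0 // ltW // gibbs_weight_gt0.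
have -> : expR (energy d s) = expR m * expR (energy d s - m) by rewrite -expRD; congr expR; ring.
by rewrite ler_wpM2l ?expR_ge0 // expR_ge1Dx.
Qed.

Lemma sum_edges_half (h : 'I_n -> 'I_n -> R) : (forall x y, h x y = h y x) ->
  \sum_(e in G | (e.1 < e.2)%N) h e.1 e.2 = 2^-1 * \sum_v \sum_(y | (v, y) \in G) h v y.
Proof.
move=> hC.
have E1 : \sum_(e in G | (e.1 < e.2)%N) h e.1 e.2 =
    \sum_v \sum_(y | ((v, y) \in G) && (v < y)%N) h v y.
  rewrite pair_big_dep /=; apply: eq_bigl => -[x y] //=.
have E2 : \sum_v \sum_(y | ((v, y) \in G) && (v < y)%N) h v y =
    \sum_v \sum_(y | ((v, y) \in G) && (y < v)%N) h v y.
  rewrite (exchange_big_dep xpredT) //=; apply: eq_bigr => y _.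
  by apply: eq_big => [v|v _]; [rewrite (edge_sym sG)|apply: hC].
have E3 : \sum_v \sum_(y | (v, y) \in G) h v y =
    \sum_v \sum_(y | ((v, y) \in G) && (v < y)%N) h v y +
    \sum_v \sum_(y | ((v, y) \in G) && (y < v)%N) h v y.
  rewrite -big_split /=; apply: eq_bigr => v _.
  rewrite (bigID (fun y : 'I_n => (v < y)%N)) /=; congr (_ + _).
  apply: eq_bigl => y; case vy: ((v, y) \in G) => //=.
  rewrite -leqNgt leq_eqVlt; case: eqP => //= /val_inj yv.
  by move: vy; rewrite yv (edge_irr sG).
by rewrite E3 -E2 -E1; field.
Qed.

Lemma gibbs_eqC p x y : gibbs p G (fun s => s x == s y) = gibbs p G (fun s => s y == s x).
Proof. by congr (_ / _); apply: eq_bigl => s; rewrite eq_sym. Qed.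
End OneGraph.

Lemma phin_ge p p' n : slopen p p' n <= phin p'.1 p'.2 n - phin p.1 p.2 n.
Proof.
rewrite /phin -mulrBr /slopen /Defs.En.
rewrite [leLHS](_ : _ = n%:R^-1 * \sum_(G : graphn n) P G * ((p'.2 - p.2) * (\sum_v yroot p G v) +
   (p'.1 - p.1) * (2^-1 * \sum_v yedge p G v))); last first.
  rewrite !mulr_sumr -big_split /=; apply: eq_bigr => G _; ring.
apply: ler_wpM2l; first by rewrite invr_ge0 ler0n.
rewrite -sumrB; apply: ler_sum => G _; rewrite -mulrBr.
have [P0 [_ sP]] := rP n.
have [->|/sP sG] := eqVneq (P G) 0; first by rewrite !mul0r.
apply: ler_wpM2l; first exact: P0.
have := @lnZG_ge n G p p'; rewrite (@sum_edges_half n G sG (fun x y => gibbs p G (fun s => s x == s y))) //.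
by move=> x y; apply: gibbs_eqC.
Qed.

(** The same convexity bound, taken from the other end of the step. *)
Lemma phin_le p p' n : phin p'.1 p'.2 n - phin p.1 p.2 n <= - slopen p' p n.
Proof. by rewrite -[leLHS]opprB lerN2; apply: phin_ge. Qed.

Lemma rootmsg_hseq pin p t T :
  rootmsg q pin p t T = if pin then hseq false p t T else hseq true p t.+1 T.
Proof. by case: pin. Qed.

Lemma hseq_intg up p t : nonneg p -> LocalFunctions.intg mu (hseq up p t).
Proof.
move=> p0; apply: (@intg_bdd _ _ _ 1); first exact: local_mfun (@msg_local R q _ (nseq t p)).
by move=> T; have /andP[h0 h1] := dom01 (@hseq_dom R q up p t T p0); rewrite ger0_norm.
Qed.

(** The index is a successor because the free ball of radius [t] yields [t.+1] updates; in the
    pinned counterpart because the comparison needs a ball of positive radius. *)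
Lemma cvg_gt (u : nat -> R) (a e : R) : 0 < e -> u @ \oo --> a -> exists t, a - e <= u t.+1.
Proof.
move=> e0 /cvgrPdist_le/(_ _ e0) [N _ H]; exists N.
by have := H N.+1 (leqnSn N); rewrite /= ler_norml => /andP[_]; rewrite lerBlDl lerBlDr addrC.
Qed.

Lemma cvg_lt (u : nat -> R) (a e : R) : 0 < e -> u @ \oo --> a -> exists t, u t.+1 <= a + e.
Proof.
move=> e0 /cvgrPdist_le/(_ _ e0) [N _ H]; exists N.
by have := H N.+1 (leqnSn N); rewrite /= ler_norml => /andP[+ _]; rewrite lerNl opprB lerBlDl.
Qed.

Lemma yroot_ge p e : nonneg p -> 0 < e ->
  \forall n \near \oo, Em (hlim true p) - e <= En (@yroot p n).
Proof.
move=> p0 e0; have e2 : 0 < e / 2 by rewrite divr_gt0.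
have [t Ht] := cvg_gt e2 (@hseq_Em_cvg R q mu true p p0).
have /andP[b0 B0] := p0.
have H : \forall n \near \oo, Em (hseq true p t.+1) - e / 2 <= En (@yroot p n).
  apply: (@transfer_ge R P mu rP bc t) => //.
  - by move=> n G v; case/andP: (gibbs_itv G p (fun s => s v == ord0)).
  - exact: hseq_intg.
  - by move=> T; case/andP: (dom01 (@hseq_dom R q true p t.+1 T p0)).
  - move=> n G v T sG i; have [g gb] := tree_ball_of_iso sG i.
    by have := @gibbs_root_ge R q n p G b0 B0 sG v T _ g gb; rewrite rootmsg_hseq.
apply: filterS H => n h; lra.
Qed.

Lemma yroot_le p e : nonneg p -> 0 < e ->
  \forall n \near \oo, En (@yroot p n) <= Em (hlim false p) + e.
Proof.
move=> p0 e0; have e2 : 0 < e / 2 by rewrite divr_gt0.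
have [t Ht] := cvg_lt e2 (@hseq_Em_cvg R q mu false p p0).
have /andP[b0 B0] := p0.
have H : \forall n \near \oo, En (@yroot p n) <= Em (hseq false p t.+1) + e / 2.
  apply: (@transfer_le R P mu rP bc us t.+1 _ _ 1) => //.
  - move=> n G v; case/andP: (gibbs_itv G p (fun s => s v == ord0)) => _ h.
    by apply: le_trans h _; rewrite mul1r lerDl ler0n.
  - exact: hseq_intg.
  - move=> T; case/andP: (dom01 (@hseq_dom R q false p t.+1 T p0)) => _ h.
    by apply: le_trans h _; rewrite mul1r lerDl ler0n.
  - move=> n G v T sG i; have [g gb] := tree_ball_of_iso sG i.
    by have := @gibbs_root_le R q n p G b0 B0 sG v T _ g gb; rewrite rootmsg_hseq.
apply: filterS H => n h; lra.
Qed.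

Local Notation edS := (@edS R q).
Local Notation edseq := (@edseq R q).

Lemma edseq_intg up p t : nonneg p -> LocalFunctions.intg mu (edseq up p t).
Proof.
move=> p0; apply: (intg_dom _ (degT_intg rP bc us)).
  exact: local_mfun (@edseq_local R q up p t).
by move=> T; have /andP[h0 h1] := @edseq_itv R q up p t T p0; rewrite ger0_norm.
Qed.

Lemma yedge_ge p e : nonneg p -> 0 < e ->
  \forall n \near \oo, Em (edS true p) - e <= En (@yedge p n).
Proof.
move=> p0 e0; have e2 : 0 < e / 2 by rewrite divr_gt0.
have [t Ht] := cvg_gt e2 (@edseq_Em_cvg R q P mu rP bc us true p p0).2.
have /andP[b0 B0] := p0.
have H : \forall n \near \oo, Em (edseq true p t.+1) - e / 2 <= En (@yedge p n).
  apply: (@transfer_ge R P mu rP bc t.+1) => //.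
  - move=> n G v; apply: sumr_ge0 => y _.
    by case/andP: (gibbs_itv G p (fun s => s v == s y)).
  - exact: edseq_intg.
  - by move=> T; case/andP: (@edseq_itv R q true p t.+1 T p0).
  - move=> n G v T sG i; have [g gb] := tree_ball_of_iso sG i.
    rewrite /yedge (big_neighbours_root gb) //; apply: ler_sum => -[j jT] _.
    by have := @gibbs_edge_ge R q n p G b0 B0 sG v T _ g j gb jT; rewrite !rootmsg_hseq.
apply: filterS H => n h; lra.
Qed.

Lemma yedge_le p e : nonneg p -> 0 < e ->
  \forall n \near \oo, En (@yedge p n) <= Em (edS false p) + e.
Proof.
move=> p0 e0; have e2 : 0 < e / 2 by rewrite divr_gt0.
have [t Ht] := cvg_lt e2 (@edseq_Em_cvg R q P mu rP bc us false p p0).2.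
have /andP[b0 B0] := p0.
have H : \forall n \near \oo, En (@yedge p n) <= Em (edseq false p t.+1) + e / 2.
  apply: (@transfer_le R P mu rP bc us t.+2 _ _ 1) => //.
  - move=> n G v; rewrite mul1r; apply: (@le_trans _ _ (\sum_(y | (v, y) \in G) 1)).
      by apply: ler_sum => y _; case/andP: (gibbs_itv G p (fun s => s v == s y)).
    have dE : deg G v = #|fun y => (v, y) \in G|.
      by apply: eq_card => y; apply/idP/idP => [/set_mem|h]; last exact/mem_set.
    by rewrite sumr_const -dE lerDr.
  - exact: edseq_intg.
  - move=> T; case/andP: (@edseq_itv R q false p t.+1 T p0) => _ h.
    by apply: le_trans h _; rewrite mul1r lerDr.
  - move=> n G v T sG i; have [g gb] := tree_ball_of_iso sG i.
    rewrite /yedge (big_neighbours_root gb) //; apply: ler_sum => -[j jT] _.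
    by have := @gibbs_edge_le R q n p G b0 B0 sG v T _ g j gb jT; rewrite !rootmsg_hseq.
apply: filterS H => n h; lra.
Qed.

Definition le2 p p' := (p.1 <= p'.1) && (p.2 <= p'.2).
Local Notation slope := (@slope R q mu).

Lemma lin_le (x y a b a' b' d e : R) : 0 <= x -> 0 <= y -> a' - d <= a -> b' - d <= b ->
  (x + y) * d <= e -> 0 <= d -> x * a' + y * (2^-1 * b') - e <= x * a + y * (2^-1 * b).
Proof.
move=> x0 y0 h1 h2 h3 d0.
have k1 := ler_wpM2l x0 h1; have k2 := ler_wpM2l y0 h2.
have k3 : 0 <= y * d by rewrite mulr_ge0.
lra.
Qed.

Lemma increment_ge p p' e : nonneg p -> le2 p p' -> 0 < e ->
  \forall n \near \oo, slope true p p' - e <= phin p'.1 p'.2 n - phin p.1 p.2 n.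
Proof.
move=> p0 /andP[h1 h2] e0.
pose c := (p'.2 - p.2) + (p'.1 - p.1); have c0 : 0 <= c by rewrite addr_ge0 ?subr_ge0.
(* An accuracy [d] for both marginals costs [c * d <= e]; adding 1 covers a step of length 0. *)
pose d := e / (c + 1); have c1 : 0 < c + 1 by rewrite ltr_wpDl.
have d0 : 0 < d by rewrite divr_gt0.
have cd : c * d <= e by rewrite /d mulrCA -[leRHS]mulr1 ler_pM2l // ler_pdivrMr // mul1r lerDl.
apply: filterS (filterI (yroot_ge p0 d0) (yedge_ge p0 d0)) => n [k1 k2].
apply: le_trans (phin_ge p p' n); rewrite /BetheFunctional.slope /slopen.
by apply: (lin_le _ _ k1 k2 cd (ltW d0)); rewrite subr_ge0.
Qed.

Lemma increment_le p p' e : nonneg p' -> le2 p p' -> 0 < e ->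
  \forall n \near \oo, phin p'.1 p'.2 n - phin p.1 p.2 n <= - slope false p' p + e.
Proof.
move=> p0 /andP[h1 h2] e0.
pose c := (p'.2 - p.2) + (p'.1 - p.1); have c0 : 0 <= c by rewrite addr_ge0 ?subr_ge0.
pose d := e / (c + 1); have c1 : 0 < c + 1 by rewrite ltr_wpDl.
have d0 : 0 < d by rewrite divr_gt0.
have cd : c * d <= e by rewrite /d mulrCA -[leRHS]mulr1 ler_pM2l // ler_pdivrMr // mul1r lerDl.
apply: filterS (filterI (yroot_le p0 d0) (yedge_le p0 d0)) => n [k1 k2].
apply: le_trans (phin_le p p' n) _; rewrite /BetheFunctional.slope /slopen.
have h1' : 0 <= p'.1 - p.1 by rewrite subr_ge0.
have h2' : 0 <= p'.2 - p.2 by rewrite subr_ge0.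
have k1' : En (@yroot p' n) - d <= Em (hlim false p') by rewrite lerBlDr.
have k2' : En (@yedge p' n) - d <= Em (edS false p') by rewrite lerBlDr.
have := lin_le h2' h1' k1' k2' cd (ltW d0).
move: (En _) (En _) (Em _) (Em _) => y1 y2 y3 y4 {k1 k2 k1' k2' h1 h2 h1' h2' cd c0 c1 d0}; lra.
Qed.
End FreeEnergy.

Module ParameterBoundary.

(** * Boundary of the parameter region *)

Section MessageBounds.
Variables (R : realType) (q : nat).
Local Notation k1 := (q.+1%:R : R).
Local Notation Q := (q.+2%:R : R).
Local Notation bb := (@bb R q).
Local Notation bp := (@bp R q).
Local Notation zz := (@zz R q).
Local Notation nn1 := (@nn1 R q).
Local Notation msgdom := (@msgdom R q).
Local Notation hlim := (@hlim R q).
Local Notation hseq := (@hseq R q).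
Local Notation msg := (@msg R q).
Implicit Types (p : R * R) (up : bool) (T : ptree) (x : nat -> R).

Let k0 : 0 < k1 := k1_gt0 R q.
Local Notation mdom D x := (forall j, (j < D)%N -> msgdom (x j)).

(** Odds against colour 0. At a vertex they are a product over the field and the children, so the
    effect of each can be estimated separately. *)
Definition odds (a : R) : R := (1 - a) / a.

Lemma dom_gt0 a : msgdom a -> 0 < a.
Proof. by move=> /andP[h _]; apply: lt_le_trans h; apply: qi_gt0. Qed.

Lemma odds_ge a : msgdom a -> 1 - a <= odds a.
Proof.
move=> da; have a0 := dom_gt0 da; have /andP[_ a1] := da.
by rewrite /odds ler_pdivlMr // ler_piMr // subr_ge0.
Qed.

Lemma odds_le_k1 a : msgdom a -> odds a <= k1.
Proof.
move=> da; have a0 := dom_gt0 da; rewrite /odds ler_pdivrMr //.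
have := bb_le (proj1 (andP da)); rewrite /MessageAlgebra.bb ler_pdivrMr //; lra.
Qed.

Lemma odds_bp p D x : nonneg p -> mdom D x ->
  odds (bp p D x) = k1 * nn1 p.1 D x / nn0 p.1 p.2 D x.
Proof.
move=> /andP[b0 B0] mx; have dx : forall j, (j < D)%N -> 0 <= x j <= 1 by move=> j /mx /dom01.
have z0 := zz_gt0 q p.2 b0 dx.
have n0 : 0 < nn0 p.1 p.2 D x by apply: nn0_gt0 => // j /dx /andP[].
have zn := lt0r_neq0 z0; have nn := lt0r_neq0 n0.
rewrite /odds /MessageAlgebra.bp -[X in (X - _) / _](divff zn) -mulrBl.
have -> : zz p.1 p.2 D x - nn0 p.1 p.2 D x = k1 * nn1 p.1 D x by rewrite /MessageAlgebra.zz; ring.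
by move: (zz _ _ _ _) zn => z zn; field; rewrite zn nn.
Qed.

Lemma prod_bb_le p D x : nonneg p -> mdom D x ->
  0 < nn1 p.1 D x <= \prod_(j < D) (1 + wgt p.1 * x j).
Proof.
move=> /andP[b0 B0] mx; apply/andP; split.
  by apply: nn1_gt0 => // j /mx /andP[].
apply: ler_prod => j _; have mj := mx j (ltn_ord j).
have /andP[h0 h1] := dombb mj.
rewrite ltW ?fac_gt0 //= lerD2l ler_wpM2l ?wgt_ge0 // bb_le //; by case/andP: mj.
Qed.

(** Children only help colour 0, so the field alone bounds the odds. *)
Lemma odds_bp_le p D x : nonneg p -> mdom D x -> odds (bp p D x) <= k1 * expR (- p.2).
Proof.
move=> p0 mx; rewrite odds_bp // -mulrA ler_wpM2l ?(ltW k0) //.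
have /andP[h1 h2] := prod_bb_le p0 mx.
have h3 := lt_le_trans h1 h2.
rewrite ler_pdivrMr; last by rewrite /nn0 mulr_gt0 // expR_gt0.
by rewrite /nn0 mulrA expRN mulVf ?mul1r // lt0r_neq0 // expR_gt0.
Qed.

Lemma hlim_ge p up T : nonneg p -> 1 - k1 * expR (- p.2) <= hlim up p T.
Proof.
move=> p0; rewrite hlim_fix //; set a := bp _ _ _.
have mx : mdom (T [::]) (fun j => hlim up p (shift T j)) by move=> j _; apply: hlim_dom.
have := odds_ge (bp_dom p0 mx); have := odds_bp_le p0 mx; rewrite -/a; lra.
Qed.

Lemma odds_child p D x i : nonneg p -> 0 < wgt p.1 -> (i < D)%N -> mdom D x ->
  odds (bp p D x) <= expR (- p.2) * odds (x i) + k1 * Q / wgt p.1.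
Proof.
move=> p0 w0 iD mx; have /andP[b0 B0] := p0.
have mx' : mdom D.-1 (skip i x).
  move=> j jD; have jD' : (j.+1 < D)%N by rewrite -(ltn_predK iD) ltnS.
  by apply: mx; case: ifP => // _; apply: ltnW.
rewrite odds_bp // /MessageAlgebra.nn1 /nn0.
rewrite (prod_skip (fun j => 1 + wgt p.1 * bb (x j)) iD) (prod_skip (fun j => 1 + wgt p.1 * x j) iD).
have /andP[h1 h2] := prod_bb_le p0 mx'; have h3 := lt_le_trans h1 h2.
have mi := mx i iD; have x0 := dom_gt0 mi; have /andP[xq x1] := mi.
set A := \prod_(j < D.-1) _; set C := \prod_(j < D.-1) _ in h2 h3 *.
have AC : A <= C by exact: h2.
have E0 : 0 < expR p.2 by exact: expR_gt0.
have F0 : 0 < 1 + wgt p.1 * x i by rewrite fac_gt0 // ltW.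
have B1 : 0 < 1 + wgt p.1 * bb (x i) by rewrite fac_gt0 // bb_ge0.
apply: (@le_trans _ _ (expR (- p.2) * (k1 * (1 + wgt p.1 * bb (x i)) / (1 + wgt p.1 * x i)))).
  rewrite ler_pdivrMr ?mulr_gt0 // expRN.
  have -> : (expR p.2)^-1 * (k1 * (1 + wgt p.1 * bb (x i)) / (1 + wgt p.1 * x i)) *
     (expR p.2 * ((1 + wgt p.1 * x i) * C)) = k1 * ((1 + wgt p.1 * bb (x i)) * C).
    by move: (1 + wgt p.1 * x i) (expR p.2) E0 F0 => f e /lt0r_neq0 e0 /lt0r_neq0 f0; field; rewrite e0 f0.
  by rewrite ler_wpM2l ?(ltW k0) // ler_wpM2l // ltW.
have S : k1 * (1 + wgt p.1 * bb (x i)) / (1 + wgt p.1 * x i) <= odds (x i) + k1 * Q / wgt p.1.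
  have -> : k1 * (1 + wgt p.1 * bb (x i)) = k1 + wgt p.1 * (1 - x i).
    have kb : k1 * bb (x i) = 1 - x i by rewrite /MessageAlgebra.bb mulrC divfK // gt_eqF.
    by rewrite mulrDr mulr1 mulrCA kb.
  apply: (@le_trans _ _ ((k1 + wgt p.1 * (1 - x i)) / (wgt p.1 * x i))).
    apply: ler_wpM2l; first by apply: addr_ge0; [exact: ltW|apply: mulr_ge0; [exact: ltW|rewrite subr_ge0]].
    by rewrite lef_pV2 ?posrE ?mulr_gt0 // lerDr.
  have -> : (k1 + wgt p.1 * (1 - x i)) / (wgt p.1 * x i) = odds (x i) + k1 / wgt p.1 * (x i)^-1.
    by rewrite /odds; move: (wgt p.1) (x i) w0 x0 => w y /lt0r_neq0 w0 /lt0r_neq0 y0; field; rewrite w0 y0.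
  rewrite lerD2l [leRHS]mulrAC ler_wpM2l //; first by rewrite divr_ge0 // ltW.
  by rewrite -[Q]invrK lef_pV2 ?posrE // invr_gt0 ltr0n.
apply: (@le_trans _ _ (expR (- p.2) * (odds (x i) + k1 * Q / wgt p.1))).
  by rewrite ler_wpM2l ?expR_ge0.
rewrite mulrDr lerD2l ler_piMl ?divr_ge0 ?mulr_ge0 ?(ltW w0) ?(ltW k0) //.
by rewrite -[leRHS]expR0 ler_expR oppr_le0.
Qed.

(* A vertex at depth [size u] forces the root magnetization close to 1 as the coupling grows. *)
Lemma deep_odds p u T : nonneg p -> 0 < wgt p.1 -> valid T u ->
  odds (hseq true p (size u).+1 T) <= k1 * expR (- p.2) ^+ (size u) + (size u)%:R * (k1 * Q / wgt p.1).
Proof.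
move=> p0 w0; elim: u T => [|i u IH] T.
  by move=> _; rewrite /= expr0 mulr1 mul0r addr0; apply: odds_le_k1; apply: hseq_dom.
move=> /andP[iT vu].
have mx : mdom (T [::]) (fun j => hseq true p (size u).+1 (shift T j)).
  by move=> j _; apply: hseq_dom.
apply: le_trans (odds_child p0 w0 iT mx) _.
have e1 : 0 <= expR (- p.2) <= 1.
  by rewrite expR_ge0 -[leRHS]expR0 ler_expR oppr_le0; case/andP: p0.
have /andP[e0 e1'] := e1.
have c0 : 0 <= k1 * Q / wgt p.1 by rewrite divr_ge0 ?mulr_ge0 ?(ltW k0) // ltW.
have h := ler_wpM2l e0 (IH _ vu); rewrite mulrDr in h.
have h2 : expR (- p.2) * ((size u)%:R * (k1 * Q / wgt p.1)) <= (size u)%:R * (k1 * Q / wgt p.1).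
  by rewrite ler_piMl // mulr_ge0.
rewrite /= exprS -[(size u).+1%:R]natr1 [(_ + 1) * _]mulrDl mul1r.
rewrite [k1 * (_ * _)]mulrCA.
by apply: le_trans (lerD h (lexx _)) _; rewrite -addrA lerD2l lerD2r.
Qed.

(** A tree of depth below [t] has no vertex at which the boundary value would enter. *)
Lemma msg_shallow a0 a0' p t T : (forall u, valid T u -> (size u < t)%N) ->
  msg a0 (nseq t p) T = msg a0' (nseq t p) T.
Proof.
elim: t T => [|t IH] T H; first by have := H [::] isT.
rewrite /=.
have E (F : R -> R) : \prod_(j < T [::]) F (msg a0 (nseq t p) (shift T j)) =
    \prod_(j < T [::]) F (msg a0' (nseq t p) (shift T j)).
  apply: eq_bigr => j _; congr F; apply: IH => u vu.
  by have := H (nat_of_ord j :: u); rewrite /= ltn_ord vu => /(_ isT).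
rewrite /MessageAlgebra.bp /MessageAlgebra.zz /nn0 /MessageAlgebra.nn1.
by rewrite (E (fun y : R => 1 + wgt p.1 * y)) (E (fun y : R => 1 + wgt p.1 * bb y)).
Qed.

Lemma hlim_shallow p t T : nonneg p -> (forall u, valid T u -> (size u < t)%N) ->
  hlim true p T = hlim false p T.
Proof.
move=> p0 H; apply: (@cvg_uniq _ (fun s => hseq true p (s + t) T)).
  by rewrite (cvg_shiftn t (fun s => hseq true p s T)); apply: hseq_cvg.
rewrite (_ : (fun s => _) = fun s => hseq false p (s + t) T).
  by rewrite (cvg_shiftn t (fun s => hseq false p s T)); apply: hseq_cvg.
apply/funext => s; apply: msg_shallow => u /H h; apply: leq_trans h _; exact: leq_addl.
Qed.
End MessageBounds.

Section Boundary.
Variables (R : realType) (q : nat) (P : forall n, graphn n -> R) (mu : probability ptree_mt R).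
Hypotheses (rP : random_graphs P) (bc : ball_conv P mu) (us : uniformly_sparse P).
Local Notation Em := (@Em R mu).
Local Notation En := (@En R P).
Local Notation degT := (@degT R).
Local Notation k1 := (q.+1%:R : R).
Local Notation Q := (q.+2%:R : R).
Local Notation hlim := (@hlim R q).
Local Notation hseq := (@hseq R q).
Local Notation phin := (@phin R q.+2 P).
Local Notation Phi := (@Phi R q mu).
Implicit Types (p : R * R) (up : bool).

Let k0 : 0 < k1 := k1_gt0 R q.

Lemma ln_expR_k1 (B : R) : ln (expR B + k1) <= B + k1 * expR (- B).
Proof.
have e0 := expR_gt0 B.
rewrite -{2}(expRK B) -lerBlDl; apply: le_trans (lnB_le _ e0) _; first by rewrite addr_gt0.
by rewrite addrC addKr expRN.
Qed.

Definition mdeg n : R := 2^-1 * En (fun (G : graphn n) v => (deg G v)%:R).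

Lemma sum_prod_psib n (B : R) :
  \sum_(s : {ffun 'I_n -> 'I_q.+2}) \prod_(i : 'I_n) psib B (s i) = (expR B + k1) ^+ n.
Proof.
rewrite -(bigA_distr_bigA (fun (i : 'I_n) s => psib B s)) /=.
rewrite (eq_bigr (fun=> expR B + k1)) => [|_ _]; first by rewrite prodr_const card_ord.
rewrite (bigD1 ord0) //= psibE eqxx; congr (_ + _).
rewrite (eq_bigr (fun=> 1)) => [|s /negPf s0]; last by rewrite psibE s0.
by rewrite sumr_const cardC1 card_ord.
Qed.

(** Below, keep only the constant colouring 0. Above, each edge contributes at most [expR p.1],
    after which the vertices decouple. *)
Lemma lnZG_itv n (G : graphn n) p : simple_graph G -> 0 <= p.1 ->
  p.1 * (2^-1 * \sum_v (deg G v)%:R) + n%:R * p.2 <= ln (ZG q.+2 p.1 p.2 G) <=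
  p.1 * (2^-1 * \sum_v (deg G v)%:R) + n%:R * ln (expR p.2 + k1).
Proof.
move=> sG b0.
have edges : \sum_(e in G | (e.1 < e.2)%N) 1 = 2^-1 * \sum_v (deg G v)%:R :> R.
  rewrite (sum_edges_half sG (h := fun _ _ => 1)) //; congr (_ * _); apply: eq_bigr => v _.
  rewrite sumr_const; congr (_%:R); apply: eq_card => y.
  by apply/idP/idP => [h|/set_mem]; first exact/mem_set.
have S0 : 0 < expR p.2 + k1 by rewrite addr_gt0 ?expR_gt0.
apply/andP; split.
  rewrite -[leLHS](@expRK R); apply: ln_le; first exact: expR_gt0.
  rewrite ZG_gibbs (bigD1 [ffun=> ord0]) //= -[leLHS]addr0; apply: lerD; last first.
    by apply: sumr_ge0 => s _; rewrite ltW // gibbs_weight_gt0.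
  rewrite -edges mulr_sumr expRD expR_sum /gibbs_weight le_eqVlt; apply/orP; left; apply/eqP.
  congr (_ * _); first by apply: eq_bigr => e _; rewrite /psi !ffunE eqxx.
  rewrite mulrC expRM_natr -[X in _ ^+ X]card_ord -prodr_const.
  by apply: eq_bigr => v _; rewrite ffunE psibE eqxx.
have -> : n%:R * ln (expR p.2 + k1) = ln ((expR p.2 + k1) ^+ n).
  by rewrite lnXn // mulr_natl.
rewrite -[X in X + _](@expRK R) -lnM ?posrE ?expR_gt0 ?exprn_gt0 //.
apply: ln_le; first exact: ZG_gt0.
rewrite -sum_prod_psib.
rewrite ZG_gibbs mulr_sumr; apply: ler_sum => s _; apply: ler_wpM2r.
  by apply: prodr_ge0 => i _; apply: expR_ge0.
rewrite -edges mulr_sumr expR_sum; apply: ler_prod => e _.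
rewrite expR_ge0 /psi ler_expR ler_wpM2l // lern1 leq_b1 //.
Qed.

Lemma phin_itv n p : (0 < n)%N -> 0 <= p.1 ->
  p.1 * mdeg n + p.2 <= phin p.1 p.2 n <= p.1 * mdeg n + ln (expR p.2 + k1).
Proof.
move=> n0 b0; have [P0 [P1 sP]] := rP n.
have nn : (n%:R : R) != 0 by rewrite pnatr_eq0 -lt0n.
have F (c : R) : p.1 * mdeg n + c = n%:R^-1 * \sum_(G : graphn n) P G *
    (p.1 * (2^-1 * \sum_v (deg G v)%:R) + n%:R * c).
  rewrite (eq_bigr (fun G : graphn n => p.1 * (2^-1 * (P G * \sum_v (deg G v)%:R)) + P G * (n%:R * c))); last first.
    by move=> G _; ring.
  rewrite big_split /= -mulr_suml P1 mul1r mulrDr mulKf // -!mulr_sumr; congr (_ + _).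
  rewrite /mdeg /Defs.En [in RHS]mulrCA [n%:R^-1 * (2^-1 * _)]mulrCA; congr (_ * (_ * _)).
  by rewrite mulr_sumr; apply: eq_bigr => G _; rewrite mulrCA.
have n1 : 0 <= (n%:R^-1 : R) by rewrite invr_ge0 ler0n.
rewrite !F /Defs.phin; apply/andP; split; apply: ler_wpM2l => //; apply: ler_sum => G _.
  have [->|/sP sG] := eqVneq (P G) 0; first by rewrite !mul0r.
  by apply: ler_wpM2l => //; case/andP: (lnZG_itv sG b0).
have [->|/sP sG] := eqVneq (P G) 0; first by rewrite !mul0r.
by apply: ler_wpM2l => //; case/andP: (lnZG_itv sG b0).
Qed.

Lemma mdeg_cvg : mdeg @ \oo --> 2^-1 * Em degT.
Proof. by apply: cvgMr; apply: (degT_cvg rP bc us). Qed.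

(** All messages give colour 0 a mass of at least [1 - k1 * expR (- p.2)], so the logarithm of each
    edge or child factor is [p.1] up to a multiple of [d]. The weight [wgt p.1] inside [d] makes
    this bound poor for a large coupling. *)
Lemma phiS_itv up p T : nonneg p ->
  let d := wgt p.1 * (k1 * expR (- p.2)) in
  p.2 + (p.1 / 2 - d) * degT T <= phiS q p (hlim up p) T <=
  ln (expR p.2 + k1) + (p.1 / 2 + d) * degT T.
Proof.
move=> p0; cbv zeta; set d := wgt _ * _; have /andP[b0 B0] := p0; have w0 := wgt_ge0 b0.
have dh U := dom01 (@hlim_dom R q up p U p0).
have hb U := @hlim_ge R q p up U p0.
have F1 c : 0 <= c <= 1 -> p.1 - wgt p.1 * (1 - c) <= ln (1 + wgt p.1 * c).
  move=> /andP[c0 c1]; have f0 := fac_gt0 b0 c0; have E0 := expR_gt0 p.1.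
  rewrite -{1}(expRK p.1) lerBlDr -lerBlDl; apply: le_trans (lnB_le E0 f0) _.
  rewrite [expR p.1 - _](_ : _ = wgt p.1 * (1 - c)); last by rewrite /wgt; ring.
  rewrite ler_pdivrMr // ler_peMr ?mulr_ge0 ?subr_ge0 //; first by rewrite -[leLHS](expR0 R) ler_expR.
  by rewrite lerDl mulr_ge0.
have V : p.2 + (p.1 - d) * degT T <= ln (zz q p.1 p.2 (T [::]) (fun j => hlim up p (shift T j))).
  have h0 : 0 < nn0 p.1 p.2 (T [::]) (fun j => hlim up p (shift T j)).
    by apply: nn0_gt0 => // j _; case/andP: (dh (shift T j)).
  apply: (@le_trans _ _ (ln (nn0 p.1 p.2 (T [::]) (fun j => hlim up p (shift T j))))); last first.
    by apply: ln_le => //; rewrite lerDl mulr_ge0 ?(ltW k0) // ltW // nn1_gt0 // => j _;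
      case/andP: (dh (shift T j)).
  rewrite /nn0 lnM ?posrE ?expR_gt0 //; last first.
    by apply: prodr_gt0 => j _; apply: fac_gt0 => //; case/andP: (dh (shift T j)).
  rewrite expRK lerD2l (@ln_prod R (T [::]) (fun j => 1 + wgt p.1 * hlim up p (shift T j))); last first.
    by move=> j _; apply: fac_gt0 => //; case/andP: (dh (shift T j)).
  rewrite /GraphLimits.degT mulr_natr -[X in _ *+ X]card_ord -sumr_const; apply: ler_sum => j _.
  apply: le_trans (F1 _ (dh _)); rewrite lerB // /d ler_wpM2l // lerBlDr -lerBlDl; exact: hb.
have /andP[_ V2] := @zz_itv R q p (T [::]) (fun j => hlim up p (shift T j)) b0 B0 (fun j _ => dh _).
have lo : (p.1 - 2 * d) * degT T <= eS q p.1 (hlim up p) (hlim up p) T.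
  rewrite /GraphLimits.degT mulr_natr -[X in _ *+ X]card_ord -sumr_const; apply: ler_sum => j _.
  have a1 := dh (shift T j); have a2 := dh (remove_child T j).
  apply: le_trans (F1 _ (agree01 q a1 a2)); rewrite lerB // /d.
  rewrite mulrCA ler_wpM2l //.
  have ag : hlim up p (shift T j) * hlim up p (remove_child T j) <=
     agree q (hlim up p (shift T j)) (hlim up p (remove_child T j)).
    rewrite /agree lerDl mulr_ge0 ?(ltW k0) // mulr_ge0 // bb_ge0 //.
      by case/andP: a1.
    by case/andP: a2.
  have h1 := hb (shift T j); have h2 := hb (remove_child T j).
  move/andP: a1 => [x0 x1]; move/andP: a2 => [y0 y1].
  move: (hlim up p (shift T j)) (hlim up p (remove_child T j)) x0 x1 y0 y1 h1 h2 ag => x y x0 x1 y0 y1.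
  move: (agree _ _ _) (k1 * _) => g c h1 h2 ag.
  have : 0 <= (1 - x) * (1 - y) by rewrite mulr_ge0 // subr_ge0.
  clear -h1 h2 ag; lra.
have /andP[_ hi] := @eS_itv R q up p.1 _ _ T b0 (@lim_msg_hlim R q up p p0) (@lim_msg_hlim R q up p p0).
rewrite phiSE /vS.
clear -V V2 lo hi; move: (ln _) (ln _) (eS _ _ _ _ _) V V2 lo hi => z1 z2 e.
rewrite -/(GraphLimits.degT R T); move: (degT T) => D V V2 lo hi.
by apply/andP; split; lra.
Qed.

Lemma Phi_itv up p : nonneg p ->
  let d := wgt p.1 * (k1 * expR (- p.2)) in
  p.2 + (p.1 / 2 - d) * Em degT <= Phi up p <= ln (expR p.2 + k1) + (p.1 / 2 + d) * Em degT.
Proof.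
move=> p0; cbv zeta; set d := wgt _ * _; have id := degT_intg rP bc us.
have ip := phiS_intg rP bc us p0 (@lim_msg_hlim R q up p p0).
have E (c e : R) : c + e * Em degT = Em (fun T => c + e * degT T).
  by rewrite (EmD (intg_cst mu c) (intgZ e id)) Em_cst (EmZ _ id).
have iE (c e : R) : LocalFunctions.intg mu (fun T => c + e * degT T).
  by apply: intgD; [exact: intg_cst|exact: intgZ].
rewrite !E; apply/andP; split; apply: Em_le => // T.
  by case/andP: (phiS_itv up T p0).
by case/andP: (phiS_itv up T p0).
Qed.

Lemma Em_degT_ge0 : 0 <= Em degT.
Proof.
rewrite -[leLHS](Em_cst mu 0); apply: Em_le; [exact: intg_cst|exact: (degT_intg rP bc us)|].
by move=> T; apply: ler0n.
Qed.

Lemma expRN_nat_small (c e : R) : 0 <= c -> 0 < e -> exists m : nat, c * expR (- m%:R) <= e.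
Proof.
move=> c0 e0; exists (Num.bound (c / e)).
have h := archi_boundP (divr_ge0 c0 (ltW e0)).
rewrite expRN ler_pdivrMr ?expR_gt0 // -ler_pdivrMl // mulrC.
by apply: le_trans (ltW h) _; apply: le_trans (expR_ge1Dx _); rewrite lerDr.
Qed.

(** Unit steps of the field, for which [Phi_ge] has no quadratic error. Each step gains at least
    [1 - k1 * expR (- B)], and the losses form a geometric series of ratio [expR (- 1)], at most
    1/2; hence the factor 2. *)
Lemma Phi_true_shift (beta : R) m B : 0 <= beta -> 0 <= B ->
  m%:R - 2 * k1 * expR (- B) <= Phi true (beta, B + m%:R) - Phi true (beta, B).
Proof.
move=> b0; elim: m B => [|m IH] B B0.
  by rewrite addr0 subrr sub0r oppr_le0 mulr_ge0 ?expR_ge0 // mulr_ge0 // ltW.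
have B1 : 0 <= B + 1 by rewrite addr_ge0.
have p0 : nonneg (beta, B) by rewrite /nonneg /= b0 B0.
have p1 : nonneg (beta, B + 1) by rewrite /nonneg /= b0 B1.
have pp : cmp2 true (beta, B) (beta, B + 1) by rewrite /cmp2 /comparable_step /= lexx lerDl ler01.
have d0 : `|(beta, B + 1).1 - (beta, B).1| <= 2^-1 :> R by rewrite /= subrr normr0 invr_ge0 ler0n.
have := Phi_ge q rP bc us p0 p1 pp d0; rewrite /BetheFunctional.slope /= subrr expr0n /= !mul0r addr0 subr0.
rewrite [B + 1 - B]addrC addKr mul1r.
have h : 1 - k1 * expR (- B) <= Em (hlim true (beta, B)).
  rewrite -[leLHS](Em_cst mu); apply: Em_le => [||T]; [exact: intg_cst|exact: hlim_intg|].
  exact: (@hlim_ge R q (beta, B) true T p0).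
have g := IH _ B1; rewrite -addrA [1 + _]addrC in g.
have x : 2 * k1 * expR (- (B + 1)) <= k1 * expR (- B).
  rewrite opprD expRD (_ : _ * _ = k1 * expR (- B) * (2 * expR (- 1))); last by ring.
  rewrite ler_piMr ?mulr_ge0 ?expR_ge0 ?(ltW k0) //.
  rewrite expRN ler_pdivrMr ?expR_gt0 // mul1r.
  by apply: le_trans (expR_ge1Dx _); rewrite -natr1 mulr1n.
rewrite -natr1; move: h g x; clear; rewrite -!mulrA.
move: (Phi _ _) (Phi _ _) (Phi _ _) (k1 * _) (k1 * _) (Em _) => *; lra.
Qed.

Lemma Phi_false_shift (beta : R) B M : 0 <= beta -> 0 <= B -> 0 <= M ->
  Phi false (beta, B + M) - Phi false (beta, B) <= M.
Proof.
move=> b0 B0 M0.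
have p0 : nonneg (beta, B) by rewrite /nonneg /= b0 B0.
have p1 : nonneg (beta, B + M) by rewrite /nonneg /= b0 addr_ge0.
have pp : cmp2 false (beta, B + M) (beta, B) by rewrite /cmp2 /comparable_step /= lexx lerDl.
have d0 : `|(beta, B).1 - (beta, B + M).1| <= 2^-1 :> R by rewrite /= subrr normr0 invr_ge0 ler0n.
have := Phi_ge q rP bc us p1 p0 pp d0; rewrite /BetheFunctional.slope /= subrr expr0n /= !mul0r addr0 subr0.
rewrite opprD addrA subrr sub0r.
have h : Em (hlim false (beta, B + M)) <= 1.
  rewrite -[leRHS](Em_cst mu); apply: Em_le => [||T]; [exact: hlim_intg|exact: intg_cst|].
  by case/andP: (@hlim_dom R q false (beta, B + M) T p1).
have := ler_wpM2l M0 h; rewrite mulr1 mulNr; move: (M * _) (Phi _ _) (Phi _ _) => *; lra.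
Qed.

(* Going out to a large field [B + m] first makes the bounds uniform in the coupling. *)
Lemma Phi_large_field p : nonneg p ->
  p.2 + p.1 / 2 * Em degT <= Phi false p /\
  Phi true p <= p.2 + p.1 / 2 * Em degT + 2 * k1 * expR (- p.2).
Proof.
case: p => beta B p0; have /andP[/= b0 B0] := p0.
(* Collects the errors of order [expR (- (B + m%:R))]: the one of [ln_expR_k1] and the one
   multiplied by the mean degree. *)
pose K := k1 + wgt beta * k1 * Em degT.
have K0 : 0 <= K by rewrite addr_ge0 ?(ltW k0) // mulr_ge0 ?Em_degT_ge0 // mulr_ge0 ?wgt_ge0 // ltW.
have H e : 0 < e -> exists2 m : nat, K * expR (- (B + m%:R)) <= e & nonneg (beta, B + m%:R).
  move=> e0; have [m hm] := expRN_nat_small K0 e0; exists m; last by rewrite /nonneg /= b0 addr_ge0.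
  by apply: le_trans hm; rewrite ler_wpM2l // ler_expR lerN2 lerDr.
split; apply/ler_addgt0Pr => e /H [m hm pm].
  have /andP[h _] := Phi_itv false pm; have g := Phi_false_shift b0 B0 (ler0n R m).
  rewrite /= in h.
  have E : (beta / 2 - wgt beta * (k1 * expR (- (B + m%:R)))) * Em degT =
    beta / 2 * Em degT - K * expR (- (B + m%:R)) + k1 * expR (- (B + m%:R)) by rewrite /K; ring.
  have kk : 0 <= k1 * expR (- (B + m%:R)) by rewrite mulr_ge0 ?expR_ge0 // ltW.
  rewrite E in h; move: h g hm kk; clear.
  move: (K * _) (k1 * _) (Phi _ _) (Phi _ _) (_ * Em _) => *; lra.
have /andP[_ h] := Phi_itv true pm; have g := Phi_true_shift m b0 B0; have l := ln_expR_k1 (B + m%:R).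
rewrite /= in h.
have E : (beta / 2 + wgt beta * (k1 * expR (- (B + m%:R)))) * Em degT =
  beta / 2 * Em degT + K * expR (- (B + m%:R)) - k1 * expR (- (B + m%:R)) by rewrite /K; ring.
rewrite E in h; move: h g hm l; clear.
move: (K * _) (k1 * expR (- (_ + _))) (2 * k1 * _) (Phi _ _) (Phi _ _) (_ * Em _) (ln _) => *; lra.
Qed.

(* Free energy up to [e], bracketed in the order that survives when the two messages differ. *)
Definition bracketed p e :=
  \forall n \near \oo, Phi true p - e <= phin p.1 p.2 n <= Phi false p + e.

(** The threshold is chosen before [p]: the loss in [Phi_large_field] does not depend on the
    coupling. The coupling ray needs this, as its column is placed at an arbitrarily large
    coupling. *)
Lemma bracketed_large_field e : 0 < e -> exists2 B0, 0 <= B0 &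
  forall p, nonneg p -> B0 <= p.2 -> bracketed p e.
Proof.
move=> e0; have [m hm] := @expRN_nat_small (2 * k1) (e / 2) (mulr_ge0 (ler0n _ _) (ltW k0)) (divr_gt0 e0 (ltr0n _ 2)).
exists m%:R => // -[beta B] p0 /= hB; have /andP[/= b0 B0] := p0.
have dK : 2 * k1 * expR (- B) <= e / 2.
  by apply: le_trans hm; rewrite ler_wpM2l ?mulr_ge0 ?(ltW k0) // ler_expR lerN2.
have c0 : 0 < e / (2 * (beta + 1)) by rewrite divr_gt0 // mulr_gt0 // ltr_wpDl.
have /cvgrPdist_le/(_ _ c0) H := mdeg_cvg.
have [/= L1 L2] := Phi_large_field p0; have lk := ln_expR_k1 B.
near=> n; have n0 : (0 < n)%N by near: n; exists 1%N.
have h1 : `|2^-1 * Em degT - mdeg n| <= e / (2 * (beta + 1)) by near: n.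
have : beta * `|2^-1 * Em degT - mdeg n| <= e / 2.
  apply: (@le_trans _ _ (beta * (e / (2 * (beta + 1))))); first exact: ler_wpM2l.
  have b1 : 0 < beta + 1 by rewrite ltr_wpDl.
  rewrite mulrA ler_pdivrMr ?mulr_gt0 //.
  have -> : e / 2 * (2 * (beta + 1)) = e * (beta + 1) by field.
  by rewrite mulrC ler_pM2l // lerDl.
rewrite -{1}(ger0_norm b0) -normrM ler_norml => /andP[h3 h4].
have /andP[/= M1 M2] := @phin_itv n (beta, B) n0 b0.
have kk : 0 <= k1 * expR (- B) by rewrite mulr_ge0 ?expR_ge0 // ltW.
have dm : beta * (2^-1 * Em degT - mdeg n) = beta / 2 * Em degT - beta * mdeg n by ring.
rewrite dm in h3 h4; rewrite -mulrA in dK L2.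
clear -M1 M2 L1 L2 lk dK h3 h4 kk.
move: (Phi _ _) (Phi _ _) (phin _ _ _) (k1 * _) (ln _) (_ * mdeg _) (_ * Em _) M1 M2 L1 L2 lk dK h3 h4 kk.
by move=> *; apply/andP; split; lra.
Unshelve. all: by end_near.
Qed.

Lemma Phi_beta0 up B : 0 <= B -> Phi up (0, B) = ln (expR B + k1).
Proof.
move=> B0; have p0 : nonneg (0 : R, B) by rewrite /nonneg /= lexx.
have w0 : wgt (0 : R) = 0 by rewrite /wgt expR0 subrr.
rewrite -[RHS](Em_cst mu); rewrite /BetheFunctional.Phi; congr (LocalFunctions.Em mu _); apply/funext => T.
rewrite phiSE /vS /eS /= [X in 2^-1 * X]big1 => [|j _]; last by rewrite /eterm w0 mul0r addr0 ln1.
rewrite mulr0 subr0; congr ln; rewrite /MessageAlgebra.zz /nn0 /MessageAlgebra.nn1.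
by rewrite !big1 ?mulr1 // => j _; rewrite w0 mul0r addr0.
Qed.

Lemma phin_beta0 n B : (0 < n)%N -> phin 0 B n = ln (expR B + k1).
Proof.
move=> n0; have [P0 [P1 sP]] := rP n.
have nn : (n%:R : R) != 0 by rewrite pnatr_eq0 -lt0n.
have S0 : 0 < expR B + k1 by rewrite addr_gt0 ?expR_gt0.
rewrite /Defs.phin (eq_bigr (fun G => P G * (n%:R * ln (expR B + k1)))) => [|G _].
  by rewrite -mulr_suml P1 mul1r mulKf.
congr (_ * _); rewrite /ZG (eq_bigr (fun s : {ffun 'I_n -> 'I_q.+2} => \prod_i psib B (s i))).
  by rewrite sum_prod_psib lnXn // mulr_natl.
by move=> s _; rewrite big1 ?mul1r // => e0 _; rewrite /psi mul0r expR0.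
Qed.

Section StrongCoupling.
Variable B : R.
Hypothesis B0 : 0 < B.

(** A tree of bounded depth has no gap. Otherwise a vertex is chosen deep enough for the contracted
    odds in [deep_odds] to be small, the field being positive, and only then is the coupling made
    large enough for the second term. *)
Lemma hlim_gap_cvg T :
  (fun n : nat => hlim false (n%:R, B) T - hlim true (n%:R, B) T) @ \oo --> (0 : R).
Proof.
have pn n : nonneg (n%:R : R, B) by rewrite /nonneg /= ler0n ltW.
have [[t H]|deep] := pselect (exists t, forall u, valid T u -> (size u < t)%N).
  rewrite (_ : (fun n : nat => _) = fun=> 0); first exact: cvg_cst.
  by apply/funext => n; rewrite (@hlim_shallow R q _ _ _ (pn n) H) subrr.
apply/cvgrPdist_le => e e0.
have lt1 : `|expR (- B)| < 1 by rewrite ger0_norm ?expR_ge0 // expR_lt1 oppr_lt0.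
have e2 : 0 < e / 2 / k1 by rewrite divr_gt0 // divr_gt0.
have [s _ Hs] := (cvgrPdist_le _ _).1 (cvg_expr lt1) _ e2.
have [u vu us'] : exists2 u, valid T u & (s <= size u)%N.
  apply: contrapT => H; apply: deep; exists s => u vu; rewrite ltnNge; apply/negP => su.
  by apply: H; exists u.
have hu : k1 * expR (- B) ^+ size u <= e / 2.
  have := Hs _ us'; rewrite /= sub0r normrN ger0_norm ?exprn_ge0 ?expR_ge0 //.
  by rewrite ler_pdivlMr // mulrC.
pose c : R := (size u)%:R * (k1 * Q); have c0 : 0 <= c by rewrite mulr_ge0 // mulr_ge0 // ltW.
near=> n.
have n1 : 2 * c / e + 1 <= n%:R.
  by near: n; exists (Num.bound (2 * c / e + 1)) => // n /= hn; apply: ltW; apply: lt_le_trans (_ : _ <= n%:R) ;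
    [apply: archi_boundP; rewrite addr_ge0 // divr_ge0 ?mulr_ge0 // ltW|rewrite ler_nat].
have n0 : 0 < n%:R :> R by apply: lt_le_trans n1; rewrite ltr_wpDl // divr_ge0 ?mulr_ge0 // ltW.
have wn : n%:R <= wgt (n%:R : R) by rewrite /wgt lerBrDl; exact: expR_ge1Dx.
have w0 : 0 < wgt (n%:R : R) := lt_le_trans n0 wn.
have h1 : c / wgt (n%:R : R) <= e / 2.
  rewrite ler_pdivrMr //; apply: (@le_trans _ _ (e / 2 * n%:R)); last by rewrite ler_wpM2l // divr_ge0 // ltW.
  apply: (@le_trans _ _ (e / 2 * (2 * c / e + 1))); last by rewrite ler_wpM2l // divr_ge0 // ltW.
  rewrite mulrDr (_ : e / 2 * (2 * c / e) = c); last by field; rewrite lt0r_neq0.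
  by rewrite lerDl mulr1 divr_ge0 // ltW.
have d := @deep_odds R q (n%:R, B) u T (pn n) w0 vu.
have g := odds_ge (@hseq_dom R q true (n%:R, B) (size u).+1 T (pn n)).
have m : hseq true (n%:R, B) (size u).+1 T <= hlim true (n%:R, B) T := @hseq_hlim R q true _ _ T (pn n).
have f := @hlim_f1 R q (n%:R, B) T (pn n).
have /andP[_ o] := dom01 (@hlim_dom R q false (n%:R, B) T (pn n)).
rewrite /= mulrA -/c in d.
rewrite sub0r normrN ger0_norm ?subr_ge0 //.
move: d g m f o hu h1; move: (hseq _ _ _ _) (hlim _ _ _) (hlim _ _ _) (odds _) (k1 * _ ^+ _) (c / _) => *; lra.
Unshelve. all: by end_near.
Qed.

Lemma Em_hlim_gap_cvg :
  (fun n : nat => Em (hlim false (n%:R, B)) - Em (hlim true (n%:R, B))) @ \oo --> (0 : R).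
Proof.
have pn n : nonneg (n%:R : R, B) by rewrite /nonneg /= ler0n ltW.
have ih up n := @hlim_intg R q mu up (n%:R, B) (pn n).
have gap (n : nat) T : `|hlim false (n%:R, B) T - hlim true (n%:R, B) T| <= 1.
  have := @hlim_f1 R q (n%:R, B) T (pn n).
  have /andP[_ o] := dom01 (@hlim_dom R q false (n%:R, B) T (pn n)).
  have /andP[lo _] := dom01 (@hlim_dom R q true (n%:R, B) T (pn n)).
  by move=> h; rewrite ger0_norm ?subr_ge0 // lerBlDr ler_wpDr.
have [_ +] := @Em_cvg R mu (fun n T => hlim false (n%:R, B) T - hlim true (n%:R, B) T)
  (fun=> 0) (fun=> 1) (fun n => intg_mfun (intgB (ih false n) (ih true n))) hlim_gap_cvg (intg_cst mu 1) gap.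
rewrite Em_cst; apply: cvg_trans; apply: near_eq_cvg; apply: nearW => n.
by rewrite EmB.
Qed.
End StrongCoupling.
End Boundary.

End ParameterBoundary.
Import ParameterBoundary.

(** * Grid sums along segments and propagation of closeness *)

Module GridInterpolation.

Section Interpolation.
Variables (R : realType) (q : nat) (P : forall n, graphn n -> R) (mu : probability ptree_mt R).
Hypotheses (rP : random_graphs P) (bc : ball_conv P mu) (us : uniformly_sparse P).
Local Notation Em := (@Em R mu).
Local Notation degT := (@degT R).
Local Notation hlim := (@hlim R q).
Local Notation phin := (@phin R q.+2 P).
Local Notation Phi := (@Phi R q mu).
Local Notation slope := (@slope R q mu).
Local Notation bracketed := (@bracketed R q P mu).
Implicit Types (p a b : R * R) (up : bool) (N k : nat).

Definition grid a b N k : R * R := seg a b (k%:R / N.+1%:R).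

Lemma grid0 a b N : grid a b N 0 = a.
Proof. by rewrite /grid /seg mul0r !mul0r !addr0; case: a. Qed.

Lemma grid1 a b N : grid a b N N.+1 = b.
Proof. by rewrite /grid /seg divff ?pnatr_eq0 // !mul1r ![_ + (_ - _)]addrC !subrK; case: b. Qed.

Lemma grid_diff1 a b N k : (grid a b N k.+1).1 - (grid a b N k).1 = (b.1 - a.1) / N.+1%:R.
Proof. by rewrite /= -natr1; ring. Qed.

Lemma grid_diff2 a b N k : (grid a b N k.+1).2 - (grid a b N k).2 = (b.2 - a.2) / N.+1%:R.
Proof. by rewrite /= -natr1; ring. Qed.

Definition lower_sum a b N : R := \sum_(0 <= k < N.+1) slope true (grid a b N k) (grid a b N k.+1).
(** [slope] is based at its first argument, here the right end of the step, so the direction and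
    with it the sign are reversed. *)
Definition upper_sum a b N : R := \sum_(0 <= k < N.+1) - slope false (grid a b N k.+1) (grid a b N k).

Section Segment.
Variables a b : R * R.
Hypotheses (a0 : nonneg a) (ab : le2 a b).

Lemma seg_nonneg (s : R) : 0 <= s -> nonneg (seg a b s).
Proof.
move=> s0; have /andP[h1 h2] := a0; have /andP[g1 g2] := ab.
by rewrite /nonneg /= !addr_ge0 // mulr_ge0 // subr_ge0.
Qed.

Lemma seg_le2 (s t : R) : s <= t -> le2 (seg a b s) (seg a b t).
Proof.
by move=> st; have /andP[g1 g2] := ab; rewrite /le2 /= !lerD2l !ler_wpM2r ?subr_ge0.
Qed.

Lemma grid_nonneg N k : nonneg (grid a b N k).
Proof. by apply: seg_nonneg; rewrite divr_ge0. Qed.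

Lemma grid_le2 N k : le2 (grid a b N k) (grid a b N k.+1).
Proof. by apply: seg_le2; rewrite ler_wpM2r ?invr_ge0 // ler_nat. Qed.

Lemma endpoint_nonneg : nonneg b.
Proof. by rewrite -(grid1 a b 0); apply: grid_nonneg. Qed.

Lemma near_sum_ge (x : nat -> nat -> R) (c : nat -> R) M :
  (forall k e, 0 < e -> \forall n \near \oo, c k - e <= x k n) ->
  forall e, 0 < e -> \forall n \near \oo, \sum_(0 <= k < M) c k - e <= \sum_(0 <= k < M) x k n.
Proof.
move=> H; elim: M => [|M IH] e e0.
  by apply: nearW => n; rewrite !big_nil sub0r oppr_le0 ltW.
have e2 : 0 < e / 2 by rewrite divr_gt0.
apply: filterS2 (IH _ e2) (H M _ e2) => n h1 h2; rewrite !big_nat_recr //=.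
move: h1 h2; move: (\sum_(_ <= _ < _) _) (\sum_(_ <= _ < _) _) (c M) (x M n) => *; lra.
Qed.

Lemma increment_ge_lower_sum N e : 0 < e ->
  \forall n \near \oo, lower_sum a b N - e <= phin b.1 b.2 n - phin a.1 a.2 n.
Proof.
move=> e0; have := near_sum_ge (x := fun k n => phin (grid a b N k.+1).1 (grid a b N k.+1).2 n -
  phin (grid a b N k).1 (grid a b N k).2 n) (c := fun k => slope true (grid a b N k) (grid a b N k.+1))
  N.+1 (fun k e e0 => increment_ge q rP bc us (grid_nonneg N k) (grid_le2 N k) e0) e0.
apply: filterS => n.
by rewrite (telescope_sumr (fun k => phin (grid a b N k).1 (grid a b N k).2 n)) // grid0 grid1.
Qed.

Lemma increment_le_upper_sum N e : 0 < e ->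
  \forall n \near \oo, phin b.1 b.2 n - phin a.1 a.2 n <= upper_sum a b N + e.
Proof.
move=> e0; have H k e' : 0 < e' -> \forall n \near \oo, slope false (grid a b N k.+1) (grid a b N k) - e' <=
    - (phin (grid a b N k.+1).1 (grid a b N k.+1).2 n - phin (grid a b N k).1 (grid a b N k).2 n).
  move=> e1; apply: filterS (increment_le q rP bc us (grid_nonneg N k.+1) (grid_le2 N k) e1) => n h.
  by rewrite lerNr opprB [e' + _]addrC.
apply: filterS (near_sum_ge N.+1 H e0) => n.
rewrite sumrN (telescope_sumr (fun k => phin (grid a b N k).1 (grid a b N k).2 n)) // grid0 grid1.
by rewrite lerNr opprB [e + _]addrC /upper_sum sumrN.
Qed.

Section Fine.
Variable N : nat.
Hypothesis fine_grid : 2 * (b.1 - a.1) <= N.+1%:R.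

Let step_small : 0 <= (b.1 - a.1) / N.+1%:R <= 2^-1.
Proof.
have /andP[g1 g2] := ab; rewrite divr_ge0 ?subr_ge0 //=.
by rewrite ler_pdivrMr // mulrC ler_pdivlMr // mulrC.
Qed.

Let quad : \sum_(0 <= k < N.+1) ((b.1 - a.1) / N.+1%:R) ^+ 2 * Em degT =
  (b.1 - a.1) ^+ 2 * Em degT / N.+1%:R.
Proof.
rewrite sumr_const_nat subn0 -[LHS]mulr_natr.
have : N.+1%:R != 0 :> R by rewrite pnatr_eq0.
by move: N.+1%:R => M M0; field.
Qed.

(** [Phi_ge] has no error in the messages, so only the quadratic parameter errors of the steps
    remain; together they are of order [N.+1%:R^-1]. *)
Lemma Phi_true_ge_lower_sum :
  lower_sum a b N - (b.1 - a.1) ^+ 2 * Em degT / N.+1%:R <= Phi true b - Phi true a.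
Proof.
rewrite -[X in Phi true X - _](grid1 a b N) -[X in _ - Phi true X](grid0 a b N).
rewrite -(telescope_sumr (fun k => Phi true (grid a b N k))) // -quad -sumrB.
apply: ler_sum => k _; rewrite -(grid_diff1 a b N k).
apply: (Phi_ge q rP bc us (grid_nonneg N k) (grid_nonneg N k.+1)); first exact: grid_le2.
by rewrite grid_diff1; have /andP[h1 h2] := step_small; rewrite ger0_norm.
Qed.

Lemma Phi_false_le_upper_sum :
  Phi false b - Phi false a <= upper_sum a b N + (b.1 - a.1) ^+ 2 * Em degT / N.+1%:R.
Proof.
rewrite -[X in Phi false X - _](grid1 a b N) -[X in _ - Phi false X](grid0 a b N).
rewrite -(telescope_sumr (fun k => Phi false (grid a b N k))) // -quad -big_split /=.
apply: ler_sum => k _; rewrite -(grid_diff1 a b N k).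
have D : `|(grid a b N k).1 - (grid a b N k.+1).1| <= 2^-1.
  by rewrite distrC grid_diff1; have /andP[h1 h2] := step_small; rewrite ger0_norm.
have := Phi_ge q rP bc us (up := false) (grid_nonneg N k.+1) (grid_nonneg N k) (grid_le2 N k) D.
rewrite -[in X in X -> _](opprB (grid a b N k.+1).1) sqrrN.
move: (_ * Em _) (slope _ _ _) (Phi _ _) (Phi _ _) => *; lra.
Qed.
End Fine.

(** Backwards the two halves of the bracket propagate separately: [Phi true] drops by at least the
    lower sum while [phin] drops by at most the upper one, and the opposite holds against
    [Phi false]. Only the gap between the sums enters, so the bracket survives where the two
    messages differ. *)
Lemma bracketed_back N (e e' : R) : 2 * (b.1 - a.1) <= N.+1%:R -> 0 < e -> bracketed b e' ->
  bracketed a (e' + (upper_sum a b N - lower_sum a b N) + (b.1 - a.1) ^+ 2 * Em degT / N.+1%:R + e).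
Proof.
move=> fN e0 Hb.
have h1 := Phi_true_ge_lower_sum fN; have h2 := Phi_false_le_upper_sum fN.
apply: filterS (filterI Hb (filterI (increment_ge_lower_sum N e0) (increment_le_upper_sum N e0))).
move=> n [/andP[g1 g2] [l1 l2]].
move: (phin _ _ _) (phin _ _ _) (_ / _) (Phi _ _) (Phi _ _) (Phi _ _) (Phi _ _) (lower_sum _ _ _) (upper_sum _ _ _) h1 h2 g1 g2 l1 l2.
clear; move=> *; apply/andP; split; lra.
Qed.
End Segment.

Section Uniqueness.
Variable p : R * R.
Hypothesis Rp : inRmu q.+2 mu p.

Lemma unique_nonneg : nonneg p.
Proof. by case: Rp => h1 [h2 _]; apply/andP. Qed.

Let p0 := unique_nonneg.

Lemma hlim_unique_ae :
  {ae mu, forall T : ptree_mt, forall j, (j < T [::])%N -> hlim true p (shift T j) = hlim false p (shift T j)}.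
Proof.
case: Rp => _ [_]; apply: filterS => T H j /H /(_ ord0).
by rewrite hlim_hf // hlim_h1 // /vecm eqxx.
Qed.

Let eq_children D (x y : nat -> R) : (forall j, (j < D)%N -> x j = y j) ->
  zz q p.1 p.2 D x = zz q p.1 p.2 D y /\ bp q p D x = bp q p D y.
Proof.
move=> xy; have E (F : R -> R) : \prod_(j < D) F (x j) = \prod_(j < D) F (y j).
  by apply: eq_bigr => j _; rewrite xy.
rewrite /bp /zz /nn0 /nn1 (E (fun z => 1 + wgt p.1 * z)) (E (fun z => 1 + wgt p.1 * bb q z)).
by split.
Qed.

Let hlim_root T : (forall j, (j < T [::])%N -> hlim true p (shift T j) = hlim false p (shift T j)) ->
  hlim true p T = hlim false p T.
Proof.
move=> H; rewrite (@hlim_fix R q true p T p0) (@hlim_fix R q false p T p0).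
exact: (eq_children H).2.
Qed.

Lemma Em_hlim_unique : Em (hlim true p) = Em (hlim false p).
Proof.
apply: Em_ae; [exact: hlim_mfun|exact: hlim_mfun|].
by apply: filterS hlim_unique_ae => T; apply: hlim_root.
Qed.

Lemma Em_edS_unique : Em (@edS R q true p) = Em (@edS R q false p).
Proof.
have [i1 _] := @edseq_Em_cvg R q P mu rP bc us true p p0.
have [i2 _] := @edseq_Em_cvg R q P mu rP bc us false p p0.
apply: Em_ae; [exact: intg_mfun i1|exact: intg_mfun i2|].
apply: filterS hlim_unique_ae => T H; rewrite /edS (hlim_root H).
by apply: eq_bigr => j _; rewrite H.
Qed.

Lemma Phi_unique : Phi true p = Phi false p.
Proof.
have i1 := phiS_intg rP bc us p0 (@lim_msg_hlim R q true p p0).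
have i2 := phiS_intg rP bc us p0 (@lim_msg_hlim R q false p p0).
apply: Em_ae; [exact: intg_mfun i1|exact: intg_mfun i2|].
apply: filterS hlim_unique_ae => T H; rewrite /phiS; congr (ln _ - _ * _); first exact: (eq_children H).1.
apply: eq_bigr => j _; rewrite H //; congr (eterm _ _ _).
rewrite (@hlim_fix R q true p _ p0) (@hlim_fix R q false p _ p0).
(* The message to a child is rebuilt from the remaining children, at which the two limits agree. *)
have E i : (i < (T [::]).-1)%N -> hlim true p (shift (remove_child T j) i) = hlim false p (shift (remove_child T j) i).
  move=> iD; apply: H; case: ifP => _; first exact: leq_trans iD (leq_pred _).
  by move: iD; case: (T [::]).
exact: (eq_children E).2.
Qed.
End Uniqueness.

Lemma fine_grid_ex (c d e : R) : 0 < e -> exists2 N, d <= N.+1%:R & c / N.+1%:R <= e.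
Proof.
move=> e0; pose m := Num.max d (c / e).
exists (Num.bound `|m|).
  apply: le_trans (_ : m <= _); first by rewrite le_max lexx.
  apply: le_trans (ler_norm m) _; apply: le_trans (ltW (archi_boundP (normr_ge0 m))) _.
  by rewrite ler_nat.
rewrite ler_pdivrMr // mulrC -ler_pdivrMr //.
apply: le_trans (_ : m <= _); first by rewrite le_max lexx orbT.
apply: le_trans (ler_norm m) _; apply: le_trans (ltW (archi_boundP (normr_ge0 m))) _.
by rewrite ler_nat.
Qed.

Section UniqueSegment.
Variables a b : R * R.
Hypotheses (ab : le2 a b) (Rab : forall s : R, 0 <= s <= 1 -> inRmu q.+2 mu (seg a b s)).

Let Rgrid N k : (k <= N.+1)%N -> inRmu q.+2 mu (grid a b N k).
Proof. by move=> kN; apply: Rab; rewrite divr_ge0 //= ler_pdivrMr // mul1r ler_nat. Qed.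

Let a0 : nonneg a.
Proof. by have := unique_nonneg (@Rgrid 0 0 (leq0n _)); rewrite grid0. Qed.

Let gap_arith (x y h0 h1 d0 d1 D : R) : 0 <= x -> 0 <= y -> 0 <= h0 -> h1 <= 1 ->
  0 <= d0 -> 0 <= d1 -> d1 <= D ->
  x * h1 + y * (2^-1 * d1) - (x * h0 + y * (2^-1 * d0)) <= x + y * D.
Proof.
clear; move=> x0 y0 l1 u2 m1 v1 v2.
have k1 := ler_wpM2l x0 u2; have k2 := mulr_ge0 x0 l1.
have k3 := ler_wpM2l y0 v2; have k4 := mulr_ge0 y0 m1; have k5 := mulr_ge0 y0 v1.
rewrite ![y * (2^-1 * _)]mulrCA; move: k1 k2 k3 k4 k5; rewrite mulr1.
by move: (x * h1) (x * h0) (y * d1) (y * d0) (y * D); clear => *; lra.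
Qed.

Lemma upper_lower_gap N :
  upper_sum a b N - lower_sum a b N <= ((b.2 - a.2) + (b.1 - a.1) * Em degT) / N.+1%:R.
Proof.
(* [F k] is the contribution of grid point [k]: the lower sum runs over left ends and the upper one
   over right ends of the steps. *)
pose F k := (b.2 - a.2) / N.+1%:R * Em (hlim true (grid a b N k)) +
  (b.1 - a.1) / N.+1%:R * (2^-1 * Em (@edS R q true (grid a b N k))).
rewrite -sumrB (eq_big_nat _ _ (F2 := fun k => F k.+1 - F k)); last first.
  move=> k /andP[_ kN]; have Rk := @Rgrid N k.+1 kN.
  rewrite /F /BetheFunctional.slope -(Em_hlim_unique Rk) -(Em_edS_unique Rk) -!(grid_diff1 a b N k) -!(grid_diff2 a b N k).
  by congr (_ - _); rewrite opprD -!mulNr !opprB.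
rewrite telescope_sumr //.
have /andP[h1 h2] := ab.
have iN : 0 <= N.+1%:R^-1 :> R by rewrite invr_ge0.
have hE k : 0 <= Em (hlim true (grid a b N k)) <= 1.
  have ih := @hlim_intg R q mu true _ (grid_nonneg a0 ab N k).
  have d T := dom01 (@hlim_dom R q true _ T (grid_nonneg a0 ab N k)).
  apply/andP; split; [rewrite -[leLHS](Em_cst mu)|rewrite -[leRHS](Em_cst mu)].
    by apply: Em_le => [||T]; [exact: intg_cst|exact: ih|case/andP: (d T)].
  by apply: Em_le => [||T]; [exact: ih|exact: intg_cst|case/andP: (d T)].
have hD k : 0 <= Em (@edS R q true (grid a b N k)) <= Em degT.
  have g0 := grid_nonneg a0 ab N k.
  have [i1 c1] := @edseq_Em_cvg R q P mu rP bc us true _ g0.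
  have id := degT_intg rP bc us.
  have d T : 0 <= @edS R q true (grid a b N k) T <= degT T.
    rewrite -[degT T]mul1r.
    apply: (@edge_sum_itv R T (fun j => @edgep R q (grid a b N k).1 (hlim true (grid a b N k) T) (hlim true (grid a b N k) (shift T j)))) => j _.
    by apply: edgep_itv; [case/andP: g0|exact: hlim_dom|exact: hlim_dom].
  apply/andP; split; first rewrite -[leLHS](Em_cst mu).
    by apply: Em_le => [||T]; [exact: intg_cst|exact: i1|case/andP: (d T)].
  by apply: Em_le => // T; case/andP: (d T).
have /andP[l1 l2] := hE 0; have /andP[u1 u2] := hE N.+1.
have /andP[m1 m2] := hD 0; have /andP[v1 v2] := hD N.+1.
have x0 : 0 <= (b.2 - a.2) / N.+1%:R by rewrite divr_ge0 // subr_ge0.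
have y0 : 0 <= (b.1 - a.1) / N.+1%:R by rewrite divr_ge0 // subr_ge0.
rewrite /F [leRHS]mulrDl [_ * Em degT / _]mulrAC.
exact: gap_arith x0 y0 l1 u2 m1 v1 v2.
Qed.

Let pick_grid e : 0 < e -> exists2 N, 2 * (b.1 - a.1) <= N.+1%:R &
  upper_sum a b N - lower_sum a b N + (b.1 - a.1) ^+ 2 * Em degT / N.+1%:R <= e.
Proof.
move=> e0; have [N hN cN] := @fine_grid_ex ((b.2 - a.2) + (b.1 - a.1) * Em degT + (b.1 - a.1) ^+ 2 * Em degT)
  (2 * (b.1 - a.1)) e e0.
exists N => //; apply: le_trans cN; rewrite [leRHS]mulrDl lerD2r; exact: upper_lower_gap.
Qed.

Lemma bracketed_unique_back e e' : 0 < e' -> bracketed b e -> bracketed a (e + e').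
Proof.
move=> e0 Hb; have e2 : 0 < e' / 2 by rewrite divr_gt0.
have [N hN gN] := pick_grid e2.
apply: filterS (bracketed_back a0 ab hN e2 Hb) => n /andP[h1 h2].
move: h1 h2 gN; move: (upper_sum _ _ _ - _) (_ / _) (Phi _ _) (Phi _ _) (phin _ _ _) => *.
by apply/andP; split; lra.
Qed.

Let fwd_arith (fa fb c F G L U e e' : R) : U - L + c <= e' / 2 -> L - c <= G - F -> G - F <= U + c ->
  F - e <= fa -> fa <= F + e -> L - e' / 2 <= fb - fa -> fb - fa <= U + e' / 2 ->
  G - (e + e') <= fb <= G + (e + e').
Proof. clear; move=> h1 h2 h3 h4 h5 h6 h7; apply/andP; split; lra. Qed.

(** Forwards the two one-sided bounds for the Bethe functional point the wrong way for a bracket;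
    equality of [Phi true] and [Phi false] at both ends lets each be used for the other. *)
Lemma bracketed_unique_fwd e e' : 0 < e' -> bracketed a e -> bracketed b (e + e').
Proof.
move=> e0 Ha; have e2 : 0 < e' / 2 by rewrite divr_gt0.
have [N hN gN] := pick_grid e2.
have h1 := Phi_true_ge_lower_sum a0 ab hN; have h2 := Phi_false_le_upper_sum a0 ab hN.
have Ea := Phi_unique (@Rgrid 0 0 (leq0n _)); have Eb := Phi_unique (@Rgrid 0 1 (leqnn _)).
rewrite grid0 in Ea; rewrite grid1 in Eb.
apply: filterS (filterI Ha (filterI (increment_ge_lower_sum a0 ab N e2) (increment_le_upper_sum a0 ab N e2))).
move=> n [/andP[g1 g2] [l1 l2]]; rewrite -Ea in h2 g2; rewrite -Eb in h2 *.
exact: fwd_arith gN h1 h2 g1 g2 l1 l2.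
Qed.
End UniqueSegment.

Lemma bracketed_le p e e' : e <= e' -> bracketed p e -> bracketed p e'.
Proof.
move=> ee; apply: filterS => n /andP[h1 h2]; apply/andP; split.
  by apply: le_trans h1; rewrite lerB.
by apply: le_trans h2 _; rewrite lerD.
Qed.

Lemma istep_le2 a b : istep a b -> le2 a b.
Proof. by rewrite /istep /le2 => /orP[] /andP[]; [move=> -> /eqP ->|move=> /eqP -> ->]; rewrite lexx. Qed.

Lemma bracketed_path_back p0 ps e e' : 0 < e' -> ipath p0 ps -> path_in (inRmu q.+2 mu) p0 ps ->
  bracketed (last p0 ps) e -> bracketed p0 (e + e').
Proof.
move=> e0 ip [_]; elim: ps p0 e' e0 ip => [|p1 ps IH] p0 e' e0 /=.
  by move=> _ _; apply: bracketed_le; rewrite lerDl ltW.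
move=> /andP[i1 ip] H Hl; have e2 : 0 < e' / 2 by rewrite divr_gt0.
rewrite (splitr e') addrA.
apply: (@bracketed_unique_back p0 p1 (istep_le2 i1)) => //.
  by move=> s; apply: (H (p0, p1)); rewrite /segs /= in_cons eqxx.
by apply: IH => // ab h; apply: H; rewrite /segs /= in_cons; apply/orP; right.
Qed.

Lemma bracketed_path_fwd p0 ps e e' : 0 < e' -> ipath p0 ps -> path_in (inRmu q.+2 mu) p0 ps ->
  bracketed p0 e -> bracketed (last p0 ps) (e + e').
Proof.
move=> e0 ip [_]; elim: ps p0 e e' e0 ip => [|p1 ps IH] p0 e e' e0 /=.
  by move=> _ _; apply: bracketed_le; rewrite lerDl ltW.
move=> /andP[i1 ip] H Hl; have e2 : 0 < e' / 2 by rewrite divr_gt0.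
rewrite (splitr e') addrA.
apply: IH => //; first by move=> ab h; apply: H; rewrite /segs /= in_cons; apply/orP; right.
apply: (@bracketed_unique_fwd p0 p1 (istep_le2 i1)) => //.
by move=> s; apply: (H (p0, p1)); rewrite /segs /= in_cons eqxx.
Qed.

Lemma bracketed_beta0 B e : 0 <= B -> 0 < e -> bracketed (0, B) e.
Proof.
move=> B0 e0; near=> n; have n0 : (0 < n)%N by near: n; exists 1%N.
rewrite (phin_beta0 q rP B n0) !(Phi_beta0 q mu _ B0) lerBlDr lerDl ltW.
Unshelve. all: by end_near.
Qed.

Lemma bracketed_field_ray p e : (forall B : R, p.2 <= B -> inRmu q.+2 mu (p.1, B)) -> 0 < e ->
  bracketed p e.
Proof.
move=> H e0; have e2 : 0 < e / 2 by rewrite divr_gt0.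
have p0 : nonneg p by have := unique_nonneg (H _ (lexx _)); case: (p).
have [B0 B00 HB] := bracketed_large_field q rP bc us e2.
pose B1 := Num.max B0 p.2; have hB : p.2 <= B1 by rewrite le_max lexx orbT.
have pp : le2 p (p.1, B1) by rewrite /le2 /= lexx.
rewrite (splitr e).
apply: (@bracketed_unique_back p (p.1, B1) pp) => //.
  move=> s /andP[s0 _]; rewrite /seg /= subrr mulr0 addr0; apply: H.
  by rewrite lerDl mulr_ge0 // subr_ge0.
apply: HB; last by rewrite /= le_max lexx.
by move: p0 => /andP[h1 h2]; rewrite /nonneg /= h1 (le_trans h2).
Qed.

End Interpolation.

End GridInterpolation.
Import GridInterpolation.

(** * The strong-coupling ray and existence of the limit *)

Section Coupling.
Variables (R : realType) (q : nat) (P : forall n, graphn n -> R) (mu : probability ptree_mt R).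
Hypotheses (rP : random_graphs P) (bc : ball_conv P mu) (us : uniformly_sparse P).
Local Notation Em := (@Em R mu).
Local Notation hlim := (@hlim R q).
Local Notation phin := (@phin R q.+2 P).
Local Notation Phi := (@Phi R q mu).
Local Notation bracketed := (@bracketed R q P mu).
Local Notation lower_sum := (@lower_sum R q mu).
Local Notation upper_sum := (@upper_sum R q mu).
Implicit Types (p a b : R * R) (up : bool) (N k : nat).

Lemma Em_hlim_itv up p : nonneg p -> 0 <= Em (hlim up p) <= 1.
Proof.
move=> p0; have ih := @hlim_intg R q mu up _ p0.
have d T := dom01 (@hlim_dom R q up _ T p0).
apply/andP; split; [rewrite -[leLHS](Em_cst mu)|rewrite -[leRHS](Em_cst mu)].
  by apply: Em_le => [||T]; [exact: intg_cst|exact: ih|case/andP: (d T)].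
by apply: Em_le => [||T]; [exact: ih|exact: intg_cst|case/andP: (d T)].
Qed.

(** Brings [u] and [v] to the same grid point; shifting the index of [v] costs only its two end
    values. *)
Lemma shifted_sum (d : R) (u v : nat -> R) N : \sum_(0 <= k < N.+1) (d * u k.+1 - d * v k) =
  d * (\sum_(k < N.+1) (u k.+1 - v k.+1) + (v N.+1 - v 0)).
Proof.
rewrite -(telescope_sumr v) // !big_mkord -big_split mulr_sumr; apply: eq_bigr => k _ /=.
by rewrite addrA subrK mulrBr.
Qed.

Section FieldSegment.
Variables (beta B C : R) (N : nat).
Hypotheses (b0 : 0 <= beta) (B0 : 0 <= B) (BC : B <= C).
Let Bk k : R := B + k%:R / N.+1%:R * (C - B).

Let gridE k : grid (beta, B) (beta, C) N k = (beta, Bk k).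
Proof. by rewrite /grid /seg /= subrr mulr0 addr0. Qed.

Lemma upper_lower_field : upper_sum (beta, B) (beta, C) N - lower_sum (beta, B) (beta, C) N <=
  (C - B) / N.+1%:R *
    (\sum_(k < N.+1) (Em (hlim false (beta, Bk k.+1)) - Em (hlim true (beta, Bk k.+1))) + 1).
Proof.
pose d := (C - B) / N.+1%:R; have d0 : 0 <= d by rewrite divr_ge0 // subr_ge0.
have nn k : nonneg (beta, Bk k).
  by rewrite /nonneg /= b0 addr_ge0 // mulr_ge0 ?divr_ge0 // subr_ge0.
have dB k : Bk k.+1 - Bk k = d.
  by have := grid_diff2 (beta, B) (beta, C) N k; rewrite !gridE.
have -> : upper_sum (beta, B) (beta, C) N - lower_sum (beta, B) (beta, C) N =
    \sum_(0 <= k < N.+1) (d * Em (hlim false (beta, Bk k.+1)) - d * Em (hlim true (beta, Bk k))).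
  rewrite -sumrB; apply: eq_bigr => k _.
  by rewrite !gridE /BetheFunctional.slope [(_, _).1]/= [(_, _).1]/= [(_, _).2]/= [(_, _).2]/= subrr !mul0r !addr0
    dB -mulNr opprB dB.
rewrite (shifted_sum d (fun k => Em (hlim false (beta, Bk k))) (fun k => Em (hlim true (beta, Bk k)))).
rewrite ler_wpM2l // lerD2l.
have /andP[_ h1] := Em_hlim_itv true (nn N.+1); have /andP[h2 _] := Em_hlim_itv true (nn 0).
by rewrite lerBlDr ler_wpDr.
Qed.
End FieldSegment.

Lemma bracketed_coupling_ray p e : 0 < p.2 ->
  (forall beta : R, p.1 <= beta -> inRmu q.+2 mu (beta, p.2)) -> 0 < e -> bracketed p e.
Proof.
(* Five shares: one for the bracket at the top of the column, two for the gap between the sums on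
   it, and one each for descending the column and for returning along the ray. *)
case: p => beta B /= B0 H e0; have d0 : 0 < e / 5 by rewrite divr_gt0.
have /andP[/= b0 _] := unique_nonneg (H _ (lexx _)).
have [C0 _ HC] := bracketed_large_field q rP bc us d0.
pose C := Num.max C0 B; have BC : B <= C by rewrite le_max lexx orbT.
(* The grid on the column is fixed before the coupling, so only finitely many field values are
   involved when the message gaps are made small. *)
have [N _ hN] := fine_grid_ex (C - B) 0 d0.
pose Bk k : R := B + k%:R / N.+1%:R * (C - B).
have Bk0 k : 0 < Bk k by rewrite ltr_wpDr // mulr_ge0 ?divr_ge0 // subr_ge0.
have := @cvg_sum R N.+1 (fun n k => Em (hlim false (n%:R, Bk k.+1)) - Em (hlim true (n%:R, Bk k.+1)))
  (fun=> 0) (fun k _ => @Em_hlim_gap_cvg R q mu (Bk k.+1) (Bk0 k.+1)).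
rewrite big1 // => /cvgrPdist_le /(_ _ ltr01) gap.
have big : \forall n \near \oo, beta <= n%:R.
  exists (Num.bound `|beta|) => // n /= hn; apply: le_trans (ler_norm beta) _.
  by apply: le_trans (ltW (archi_boundP (normr_ge0 beta))) _; rewrite ler_nat.
have [n [g bn]] := eventually_ex (filterI gap big).
have n0 : 0 <= n%:R :> R by [].
have := @upper_lower_field n%:R B C N n0 (ltW B0) BC; rewrite -/Bk => UL.
rewrite /= sub0r normrN ler_norml in g; move/andP: g => [_ g2].
have gs : upper_sum (n%:R, B) (n%:R, C) N - lower_sum (n%:R, B) (n%:R, C) N <= e / 5 * 2.
  apply: le_trans UL _; apply: (@le_trans _ _ ((C - B) / N.+1%:R * 2)).
    by rewrite ler_wpM2l ?divr_ge0 ?subr_ge0 // -[2]/(1 + 1) lerD2r.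
  by rewrite ler_wpM2r.
have p0 : nonneg (n%:R, B) by rewrite /nonneg /= n0 ltW.
have pC : le2 (n%:R, B) (n%:R, C) by rewrite /le2 /= lexx.
have f0 : 2 * ((n%:R, C).1 - (n%:R, B).1) <= N.+1%:R :> R by rewrite /= subrr mulr0.
have bC : bracketed (n%:R, C) (e / 5).
  by apply: HC; rewrite /nonneg /= ?n0 ?le_max ?lexx // orbC ltW.
have := bracketed_back rP bc us p0 pC f0 d0 bC; rewrite /= subrr expr0n /= !mul0r addr0 => h.
have ab : le2 (beta, B) (n%:R, B) by rewrite /le2 /= bn lexx.
have Rab (s : R) : 0 <= s <= 1 -> inRmu q.+2 mu (seg (beta, B) (n%:R, B) s).
  move=> /andP[s0 _]; rewrite /seg /= subrr mulr0 addr0; apply: H.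
  by rewrite lerDl mulr_ge0 // subr_ge0.
apply: bracketed_le (bracketed_unique_back rP bc us ab Rab d0 h).
apply: (@le_trans _ _ (e / 5 + e / 5 * 2 + e / 5 + e / 5)); first by rewrite !lerD2r lerD2l.
by rewrite le_eqVlt; apply/orP; left; apply/eqP; field.
Qed.

Lemma Phimu_hf p : nonneg p -> Phimu mu p.1 p.2 (@hf R q.+2 p.1 p.2) = (Phi true p)%:E.
Proof.
move=> p0; rewrite (EmE (phiS_intg rP bc us p0 (@lim_msg_hlim R q true p p0))).
apply: eq_integral => T _; congr (_%:E); apply: PhiTE => U s; exact: hlim_hf.
Qed.

Lemma Phimu_h1 p : nonneg p -> Phimu mu p.1 p.2 (@h1 R q.+2 p.1 p.2) = (Phi false p)%:E.
Proof.
move=> p0; rewrite (EmE (phiS_intg rP bc us p0 (@lim_msg_hlim R q false p p0))).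
apply: eq_integral => T _; congr (_%:E); apply: PhiTE => U s; exact: hlim_h1.
Qed.

Lemma unique_limit p : inRmu q.+2 mu p -> (forall e, 0 < e -> bracketed p e) ->
  exists l : R, phin p.1 p.2 @ \oo --> l /\
  l%:E = Phimu mu p.1 p.2 (@hf R q.+2 p.1 p.2) /\ l%:E = Phimu mu p.1 p.2 (@h1 R q.+2 p.1 p.2).
Proof.
move=> Rp H; have E := Phi_unique rP bc us Rp; have p0 := unique_nonneg Rp.
exists (Phi true p); split; last first.
  split; first exact: esym (Phimu_hf p0).
  by apply: esym; have := Phimu_h1 p0; rewrite -E.
by apply/cvgrPdist_le => e /H; rewrite /ParameterBoundary.bracketed -E; apply: filterS => n; rewrite distrC ler_distl.
Qed.

Lemma interpolation_limit (beta B : R) :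
  (exists B' : R, 0 <= B' /\ exists ps : seq (R * R),
      ipath (0, B') ps /\ last (0, B') ps = (beta, B) /\ path_in (inRmu q.+2 mu) (0, B') ps) \/
  (exists (p' : R * R) (ps : seq (R * R)),
      ipath (beta, B) ps /\ last (beta, B) ps = p' /\ path_in (inRmu q.+2 mu) (beta, B) ps /\
      ((forall b : R, p'.2 <= b -> inRmu q.+2 mu (p'.1, b)) \/
       (0 < p'.2 /\ forall b : R, p'.1 <= b -> inRmu q.+2 mu (b, p'.2)))) ->
  exists l : R, phin beta B @ \oo --> l /\
    l%:E = Phimu mu beta B (@hf R q.+2 beta B) /\ l%:E = Phimu mu beta B (@h1 R q.+2 beta B).
Proof.
case=> [[B' [B0 [ps [ip [lE Rps]]]]]|[p' [ps [ip [lE [Rps ray]]]]]].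
  apply: (@unique_limit (beta, B)) => [|e e0]; last first.
    rewrite -lE (splitr e); have e2 : 0 < e / 2 by rewrite divr_gt0.
    by apply: (bracketed_path_fwd rP bc us e2 ip Rps); apply: bracketed_beta0.
  (* The end point lies in the region: it is the value at parameter 1 of the last segment, or the
     starting point of an empty path. *)
  rewrite -lE; case: Rps => R0 Rs; case/lastP: ps {ip lE} Rs => // ps x Rs; rewrite last_rcons.
  have h : (last (0, B') ps, x) \in segs (0, B') (rcons ps x).
    elim: ps (0, B') {Rs R0} => [|y ps IH] p0; first by rewrite /segs /= in_cons eqxx.
    by rewrite rcons_cons /segs /= in_cons IH orbT.
  have := Rs _ h 1; rewrite ler01 lexx => /(_ isT).
  by rewrite /seg /= !mul1r ![_ + (_ - _)]addrC !subrK -surjective_pairing.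
apply: (@unique_limit (beta, B)) => [|e e0]; first by case: Rps.
rewrite (splitr e); have e2 : 0 < e / 2 by rewrite divr_gt0.
apply: (bracketed_path_back rP bc us e2 ip Rps); rewrite lE.
case: ray => [r|[B0 r]]; first by apply: (bracketed_field_ray rP bc us).
exact: bracketed_coupling_ray.
Qed.
End Coupling.

(** * Vanishing of the second-order errors under continuity *)

Section UniformContinuity.
Variable R : realType.

(* Heine's theorem along the uniform grids of [0, 1]. *)
Lemma grid_uniform (f : R -> R) e : {within [set s : R | 0 <= s <= 1], continuous f} -> 0 < e ->
  \forall N \near \oo, forall k, (k <= N)%N -> `|f (k.+1%:R / N.+1%:R) - f (k%:R / N.+1%:R)| <= e.
Proof.
move=> /subspace_continuousP cf e0; have e2 : 0 < e / 2 by rewrite divr_gt0.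
pose K := [set s : R | 0 <= s <= 1].
have cK : compact K by rewrite /K -set_itvcc; exact: segment_compact.
have /compact_near_coveringP/near_covering_withinP nc := cK.
pose Q N x := forall y, 0 <= y <= 1 -> `|y - x| <= N.+1%:R^-1 -> `|f y - f x| <= e.
have main : \forall N \near \oo, K `<=` Q N.
  apply: nc => x Kx; have /cvgrPdist_le /(_ _ e2) := cf x Kx.
  rewrite near_withinE => /nbhs_ballP[d /= d0 xd].
  near=> z N => /= Kz y Ky yz.
  have zd : `|x - z| < d / 2 by near: z; apply: nbhsx_ballx; rewrite divr_gt0.
  have Nd : N.+1%:R^-1 < d / 2 by near: N; apply: near_infty_natSinv_lt (PosNum (divr_gt0 d0 (ltr0n R 2))).
  have fz : `|f x - f z| <= e / 2.
    by apply: xd => //; apply: lt_trans zd _; rewrite ltr_pdivrMr // ltr_pMr // ltr1n.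
  have fy : `|f x - f y| <= e / 2.
    apply: xd => //; suff : `|x - y| < d by [].
    rewrite (splitr d) -(subrKA z); apply: le_lt_trans (ler_normD _ _) _.
    by rewrite ltrD // [`|z - y|]distrC (le_lt_trans yz).
  rewrite (splitr e) -(subrKA (f x)); apply: le_trans (ler_normD _ _) _.
  by rewrite lerD // distrC.
apply: filterS main => N H k kN; apply: H.
- by rewrite /K /= divr_ge0 // ler_pdivrMr // mul1r ler_nat leqW.
- by rewrite divr_ge0 // ler_pdivrMr // mul1r ler_nat ltnS.
- by rewrite -mulrBl -natr1 [_ + 1]addrC addrK mul1r ger0_norm // invr_ge0.
Unshelve. all: by end_near.
Qed.
End UniformContinuity.

Section ScalarError.
Variable R : realType.

(** In a product of two jumps one factor is at most [eta], and the other ones sum to at most 1. *)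
Lemma sum_err_le M D (x : nat -> R) (y : nat -> nat -> R) (C d1 d2 eta : R) :
  0 <= C -> 0 <= d1 -> 0 <= d2 -> 0 <= eta -> (forall k, 0 <= x k) -> \sum_(0 <= k < M) x k <= 1 ->
  (forall k j, (k < M)%N -> (j < D)%N -> y k j <= eta) ->
  \sum_(0 <= k < M) (d2 * x k + \sum_(j < D) (C * (x k * y k j) + (d1 * x k + 2 * d1 ^+ 2))) <=
  d2 + D%:R * (C * eta + d1 + M%:R * (2 * d1 ^+ 2)).
Proof.
move=> C0 d10 d20 e0 x0 xs ye.
apply: (@le_trans _ _ (\sum_(0 <= k < M) ((d2 + D%:R * (C * eta + d1)) * x k + D%:R * (2 * d1 ^+ 2)))).
  apply: ler_sum_nat => k /andP[_ kM].
  rewrite [leRHS](_ : _ = d2 * x k + (D%:R * (C * eta + d1) * x k + D%:R * (2 * d1 ^+ 2))); last by ring.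
  rewrite lerD2l.
  have -> : D%:R * (C * eta + d1) * x k + D%:R * (2 * d1 ^+ 2) =
     \sum_(j < D) (C * (x k * eta) + (d1 * x k + 2 * d1 ^+ 2)).
    by rewrite sumr_const card_ord -[RHS]mulr_natl; ring.
  by apply: ler_sum => j _; rewrite lerD2r ler_wpM2l // ler_wpM2l // ye.
rewrite big_split /= -mulr_sumr sumr_const_nat subn0 -[X in _ + X]mulr_natl.
have h : 0 <= d2 + D%:R * (C * eta + d1) by rewrite addr_ge0 // mulr_ge0 // addr_ge0 // mulr_ge0.
have := ler_wpM2l h xs; rewrite mulr1 => h1.
have -> : d2 + D%:R * (C * eta + d1 + M%:R * (2 * d1 ^+ 2)) =
  d2 + D%:R * (C * eta + d1) + M%:R * (D%:R * (2 * d1 ^+ 2)) by ring.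
by rewrite lerD2r.
Qed.
End ScalarError.

Section StepErrors.
Variables (R : realType) (q : nat) (P : forall n, graphn n -> R) (mu : probability ptree_mt R).
Hypotheses (rP : random_graphs P) (bc : ball_conv P mu) (us : uniformly_sparse P).
Local Notation Em := (@Em R mu).
Local Notation degT := (@degT R).
Local Notation hlim := (@hlim R q).
Local Notation hseq := (@hseq R q).
Local Notation Phi := (@Phi R q mu).
Local Notation slope := (@slope R q mu).
Local Notation step_error := (@step_error R q).
Local Notation lower_sum := (@lower_sum R q mu).
Local Notation upper_sum := (@upper_sum R q mu).
Implicit Types (p a b : R * R) (up : bool) (N k : nat) (T : ptree).

Let step_error_at up p p' (C : R) s t T : R :=
  `|p'.2 - p.2| * `|hseq up p' s T - hseq up p s T| +
  \sum_(j < T [::]) (C * (`|hseq up p' s T - hseq up p s T| * `|hseq up p' t (shift T j) - hseq up p t (shift T j)|) +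
      (`|p'.1 - p.1| * `|hseq up p' s T - hseq up p s T| + 2 * (p'.1 - p.1) ^+ 2)).

Lemma step_error_mfun up p p' C : nonneg p -> nonneg p' -> mfun (step_error up p p' C).
Proof.
move=> p0 p0'; apply: (@mfun_cvg R (fun t => step_error_at up p p' C t.+1 t)) => [t|T].
  apply: (@local_mfun _ t.+1) => T T' TT'; have E : T [::] = T' [::] by apply: TT'.
  have L r : hseq up r t.+1 T = hseq up r t.+1 T'.
    by have := @msg_local R q (@start R q up) (nseq t.+1 r) T T'; rewrite size_nseq => h; apply: h.
  rewrite /step_error_at -E !L; congr (_ + _); apply: eq_bigr => j _.
  have L' r : hseq up r t (shift T j) = hseq up r t (shift T' j).
    have := @msg_local R q (@start R q up) (nseq t r) (shift T j) (shift T' j).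
    by rewrite size_nseq; apply; apply: agree_shift (ltn_ord j) TT'.
  by rewrite !L'.
have cr r : nonneg r -> (fun t => hseq up r t.+1 T) @ \oo --> hlim up r T.
  by move=> r0; rewrite (cvg_shiftS (fun t => hseq up r t T)); apply: hseq_cvg.
have cD : (fun t => `|hseq up p' t.+1 T - hseq up p t.+1 T|) @ \oo --> `|hlim up p' T - hlim up p T|.
  by apply: cvg_norm; apply: cvgB; apply: cr.
apply: cvgD; first exact: cvgMr.
apply: (@cvg_sum R (T [::]) (fun t j => C * (`|hseq up p' t.+1 T - hseq up p t.+1 T| *
    `|hseq up p' t (shift T j) - hseq up p t (shift T j)|) +
    (`|p'.1 - p.1| * `|hseq up p' t.+1 T - hseq up p t.+1 T| + 2 * (p'.1 - p.1) ^+ 2))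
  (fun j => C * (`|hlim up p' T - hlim up p T| * `|hlim up p' (shift T j) - hlim up p (shift T j)|) +
      (`|p'.1 - p.1| * `|hlim up p' T - hlim up p T| + 2 * (p'.1 - p.1) ^+ 2))) => j _.
apply: cvgD; last by apply: cvgD; [exact: cvgMr|exact: cvg_cst].
apply: cvgMr; apply: cvgM => //; apply: cvg_norm; apply: cvgB; exact: hseq_cvg.
Qed.

Lemma hlim_diff up p p' T : nonneg p -> nonneg p' -> `|hlim up p' T - hlim up p T| <= 1.
Proof.
move=> p0 p0'; have /andP[l1 l2] := dom01 (@hlim_dom R q up p T p0).
have /andP[m1 m2] := dom01 (@hlim_dom R q up p' T p0').
by rewrite ler_norml; apply/andP; split; lra.
Qed.

Section Segment.
Variables (a b : R * R) (up : bool).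
Hypotheses (a0 : nonneg a) (ab : le2 a b).

Let C := 2 * wgt b.1.
Let b0 : nonneg b := endpoint_nonneg a0 ab.
Let C0 : 0 <= C.
Proof. by rewrite mulr_ge0 // wgt_ge0 //; case/andP: b0. Qed.

(** For the pinned boundary the step is read downwards, the direction in which its messages
    advance. *)
Definition grid_error N k : ptree -> R :=
  if up then step_error true (grid a b N k) (grid a b N k.+1) C
  else step_error false (grid a b N k.+1) (grid a b N k) C.

Let jump N k T := `|hlim up (grid a b N k.+1) T - hlim up (grid a b N k) T|.
Let d1 N : R := (b.1 - a.1) / N.+1%:R.
Let d2 N : R := (b.2 - a.2) / N.+1%:R.
Let d1_ge0 N : 0 <= d1 N.
Proof. by have /andP[h1 h2] := ab; rewrite divr_ge0 // subr_ge0. Qed.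
Let d2_ge0 N : 0 <= d2 N.
Proof. by have /andP[h1 h2] := ab; rewrite divr_ge0 // subr_ge0. Qed.

Lemma grid_errorE N k T : grid_error N k T = d2 N * jump N k T +
  \sum_(j < T [::]) (C * (jump N k T * jump N k (shift T j)) + (d1 N * jump N k T + 2 * d1 N ^+ 2)).
Proof.
rewrite /grid_error /jump; case: up.
  by rewrite /step_error !grid_diff1 !grid_diff2 -/(d1 N) -/(d2 N) (ger0_norm (d1_ge0 N)) (ger0_norm (d2_ge0 N)).
have e1 : (grid a b N k).1 - (grid a b N k.+1).1 = - d1 N by rewrite -opprB grid_diff1.
have e2 : (grid a b N k).2 - (grid a b N k.+1).2 = - d2 N by rewrite -opprB grid_diff2.
rewrite /step_error e1 e2 !normrN sqrrN (ger0_norm (d1_ge0 N)) (ger0_norm (d2_ge0 N)) distrC.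
by congr (_ + _); apply: eq_bigr => j _; rewrite [`|hlim false (grid a b N k.+1) (shift T j) - _|]distrC.
Qed.

Lemma grid_error_mfun N k : mfun (grid_error N k).
Proof. by rewrite /grid_error; case: up; apply: step_error_mfun; exact: grid_nonneg. Qed.

Lemma jump_sum N T : \sum_(0 <= k < N.+1) jump N k T <= 1.
Proof.
have mono k : hlim up (grid a b N k) T <= hlim up (grid a b N k.+1) T.
  have g k' := grid_nonneg a0 ab N k'.
  case: up; first exact: (@hlim_cmp2 R q true _ _ T (g k) (g k.+1) (grid_le2 ab N k)).
  exact: (@hlim_cmp2 R q false _ _ T (g k.+1) (g k) (grid_le2 ab N k)).
rewrite (eq_bigr (fun k => hlim up (grid a b N k.+1) T - hlim up (grid a b N k) T)) => [|k _].
  rewrite (telescope_sumr (fun k => hlim up (grid a b N k) T)) // grid0 grid1.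
  by apply: le_trans (ler_norm _) _; apply: hlim_diff.
by rewrite /jump ger0_norm // subr_ge0.
Qed.

Definition total_error N T : R := \sum_(0 <= k < N.+1) grid_error N k T.

Lemma grid_error_ge0 N k T : 0 <= grid_error N k T.
Proof.
have jp U : 0 <= jump N k U by exact: normr_ge0.
rewrite grid_errorE; apply: addr_ge0; first exact: mulr_ge0 (d2_ge0 N) (jp T).
apply: sumr_ge0 => j _; apply: addr_ge0; first exact: mulr_ge0 C0 (mulr_ge0 (jp _) (jp _)).
by apply: addr_ge0; [exact: mulr_ge0 (d1_ge0 N) (jp T)|apply: mulr_ge0; rewrite ?sqr_ge0].
Qed.

Lemma total_error_le N T eta : 0 <= eta ->
  (forall k j, (k < N.+1)%N -> (j < T [::])%N -> jump N k (shift T j) <= eta) ->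
  total_error N T <= C * eta * degT T + (d2 0 + (d1 0 + 2 * d1 0 ^+ 2) * degT T) / N.+1%:R.
Proof.
move=> e0 H.
rewrite /total_error; under eq_bigr do rewrite grid_errorE.
have h := @sum_err_le R N.+1 (T [::]) (fun k => jump N k T) (fun k j => jump N k (shift T j)) C (d1 N) (d2 N) eta
  C0 (d1_ge0 N) (d2_ge0 N) e0 (fun k => normr_ge0 _) (jump_sum N T) H.
apply: le_trans h _; rewrite /d1 /d2 /GraphLimits.degT divr1 le_eqVlt; apply/orP; left; apply/eqP.
have : N.+1%:R != 0 :> R by rewrite pnatr_eq0.
move: N.+1%:R (T [::])%:R => M D; rewrite !divr1 => M0; field; exact: M0.
Qed.

(** A bound uniform in [N], with every jump at a child estimated by 1; it serves as the dominating
    function. *)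
Lemma total_error_dom N T : `|total_error N T| <= d2 0 + (C + d1 0 + 2 * d1 0 ^+ 2) * degT T.
Proof.
have D0 : 0 <= degT T by [].
rewrite ger0_norm; last by apply: sumr_ge0 => k _; apply: grid_error_ge0.
apply: le_trans (@total_error_le N T 1 ler01 _) _.
  by move=> k j _ _; apply: hlim_diff; apply: grid_nonneg.
have x0 : 0 <= d2 0 + (d1 0 + 2 * d1 0 ^+ 2) * degT T.
  by rewrite addr_ge0 ?d2_ge0 // mulr_ge0 // addr_ge0 ?d1_ge0 // mulr_ge0 // sqr_ge0.
by rewrite mulr1 -[C + _ + _]addrA [(C + _) * _]mulrDl addrCA lerD2l ler_pdivrMr // ler_peMr // ler1n.
Qed.

Lemma dom_intg : LocalFunctions.intg mu (fun T => d2 0 + (C + d1 0 + 2 * d1 0 ^+ 2) * degT T).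
Proof. by apply: intgD; [exact: intg_cst|apply: intgZ; exact: (degT_intg rP bc us)]. Qed.

Lemma grid_error_intg N k : (k < N.+1)%N -> LocalFunctions.intg mu (grid_error N k).
Proof.
move=> kN; apply: (intg_dom (@grid_error_mfun N k) dom_intg) => T.
apply: le_trans (total_error_dom N T).
rewrite !ger0_norm ?grid_error_ge0 //; last by apply: sumr_ge0 => *; apply: grid_error_ge0.
rewrite /total_error (big_cat_nat _ (n := k)) //= ?(ltnW kN) // [X in _ + X]big_ltn // addrCA lerDl.
by rewrite addr_ge0 // sumr_ge0 // => *; apply: grid_error_ge0.
Qed.

Hypothesis cont : {ae mu, forall T : ptree_mt, forall j, (j < T [::])%N ->
  {within [set s : R | 0 <= s <= 1], continuous (fun s => hlim up (seg a b s) (shift T j))}}.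

(** Continuity on the compact interval makes the jumps at the finitely many children of the root
    small together; for the root itself the total variation bound [jump_sum] is enough. *)
Lemma total_error_ae : {ae mu, forall T : ptree_mt, (fun N => total_error N T) @ \oo --> (0 : R)}.
Proof.
apply: filterS cont => T cT; apply/cvgrPdist_le => e e0.
have D0 : 0 <= degT T by [].
pose c := C * degT T + 1; have c0 : 0 < c by rewrite ltr_wpDl // mulr_ge0.
pose eta := e / 2 / c; have eta0 : 0 < eta by rewrite !divr_gt0.
have near_jump : \forall N \near \oo, forall k j, (k < N.+1)%N -> (j < T [::])%N -> jump N k (shift T j) <= eta.
  have : \forall N \near \oo, forall j, (j < T [::])%N -> forall k, (k <= N)%N -> jump N k (shift T j) <= eta.
    elim: (T [::]) cT => [|D IH] cT; first by apply: nearW.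
    have cT' j : (j < D)%N -> _ := fun jD => cT j (ltnW jD).
    apply: filterS2 (IH cT') (grid_uniform (cT D (ltnSn D)) eta0) => N H1 H2 j.
    by rewrite ltnS leq_eqVlt => /orP[/eqP -> k kN|]; [exact: H2|exact: H1].
  by apply: filterS => N H k j kN jT; apply: H.
pose K := d2 0 + (d1 0 + 2 * d1 0 ^+ 2) * degT T.
have near_K : \forall N \near \oo, K / N.+1%:R <= e / 2.
  exists (Num.bound `|K / (e / 2)|) => // N /= hN.
  rewrite ler_pdivrMr // mulrC -ler_pdivrMr ?divr_gt0 //.
  apply: le_trans (ler_norm _) _; apply: le_trans (ltW (archi_boundP (normr_ge0 _))) _.
  by rewrite ler_nat leqW.
apply: filterS2 near_jump near_K => N h1 h2.
rewrite sub0r normrN ger0_norm; last by apply: sumr_ge0 => k _; apply: grid_error_ge0.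
apply: le_trans (total_error_le (ltW eta0) h1) _; rewrite (splitr e) lerD //.
have -> : C * eta * degT T = e / 2 * (C * degT T / c) by rewrite /eta; ring.
by rewrite ler_piMr ?divr_ge0 ?(ltW e0) // ler_pdivrMr // mul1r lerDl.
Qed.

Lemma grid_error_cvg : (fun N => \sum_(0 <= k < N.+1) Em (grid_error N k)) @ \oo --> (0 : R).
Proof.
have E N : intg mu (total_error N) /\ \sum_(0 <= k < N.+1) Em (grid_error N k) = Em (total_error N).
  have H k : LocalFunctions.intg mu (if (k < N.+1)%N then grid_error N k else fun=> 0).
    by case: ifP => kN; [exact: grid_error_intg|exact: intg_cst].
  have [i1 i2] := Em_sum (index_iota 0 N.+1) H.
  have F : total_error N = fun T => \sum_(0 <= k < N.+1) (if (k < N.+1)%N then grid_error N k else fun=> 0) T.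
    by apply/funext => T; apply: eq_big_nat => k /andP[_ kN]; rewrite kN.
  by rewrite F i2; split=> //; apply: eq_big_nat => k /andP[_ kN]; rewrite kN.
have [_ c] := @Em_cvg_ae R mu total_error (fun=> 0) _ (fun N => intg_mfun (E N).1)
  (intg_mfun (intg_cst mu 0)) total_error_ae dom_intg total_error_dom.
rewrite Em_cst in c; apply: cvg_trans c; apply: near_eq_cvg; apply: nearW => N.
by have [_ ->] := E N.
Qed.

Section Fine.
Variable N : nat.
Hypothesis fine_grid : 2 * (b.1 - a.1) <= N.+1%:R.

Let step_small k : `|(grid a b N k.+1).1 - (grid a b N k).1| <= 2^-1.
Proof.
have /andP[g1 g2] := ab; rewrite grid_diff1 ger0_norm ?divr_ge0 ?subr_ge0 //.
by rewrite ler_pdivrMr // mulrC ler_pdivlMr // mulrC.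
Qed.

Let wgt_le k : (k <= N.+1)%N -> 2 * wgt (grid a b N k).1 <= C.
Proof.
move=> kN; rewrite ler_wpM2l // /wgt lerD2r ler_expR.
suff : le2 (seg a b (k%:R / N.+1%:R)) (seg a b 1).
  by case/andP=> + _; rewrite {2}/seg /= mul1r [_ + (_ - _)]addrC subrK.
by apply: seg_le2 => //; rewrite ler_pdivrMr // mul1r ler_nat.
Qed.

(** The reverse of the bounds by lower and upper sums: with [Phi_le] at each step, the functional
    departs from its sum by at most the accumulated second-order error. *)
Lemma Phi_diff_grid_error : if up
  then Phi true b - Phi true a <= lower_sum a b N + \sum_(0 <= k < N.+1) Em (grid_error N k)
  else upper_sum a b N - \sum_(0 <= k < N.+1) Em (grid_error N k) <= Phi false b - Phi false a.
Proof.
have g k := grid_nonneg a0 ab N k.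
have iE k (kN : (k < N.+1)%N) := grid_error_intg kN; rewrite /grid_error in iE *.
case: up iE => iE.
  rewrite -[X in Phi true X - _ <= _](grid1 a b N) -[X in _ - Phi true X <= _](grid0 a b N) -(telescope_sumr (fun k => Phi true (grid a b N k))) //.
  rewrite /GridInterpolation.lower_sum -big_split /=; apply: ler_sum_nat => k /andP[_ kN].
  by apply: (@Phi_le R q P mu rP bc us true _ _ _ (g k) (g k.+1) (grid_le2 ab N k) (step_small k) (wgt_le kN) (iE k kN)).
rewrite -[X in _ <= Phi false X - _](grid1 a b N) -[X in _ <= _ - Phi false X](grid0 a b N) -(telescope_sumr (fun k => Phi false (grid a b N k))) //.
rewrite /GridInterpolation.upper_sum -sumrB; apply: ler_sum_nat => k /andP[_ kN].
have st : `|(grid a b N k).1 - (grid a b N k.+1).1| <= 2^-1 by rewrite distrC.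
have := @Phi_le R q P mu rP bc us false _ _ _ (g k.+1) (g k) (grid_le2 ab N k) st (wgt_le (ltnW kN)) (iE k kN).
by move: (Phi _ _) (Phi _ _) (slope _ _ _) (Em _) => *; lra.
Qed.
End Fine.
End Segment.
End StepErrors.

Lemma telescope_halves_add (R : realFieldType) (x y z e : R) :
  x - y + e / 2 + (y - z + e / 2) = x - z + e.
Proof. by field. Qed.

Lemma telescope_halves_sub (R : realFieldType) (x y z e : R) :
  x - y - e / 2 + (y - z - e / 2) = x - z - e.
Proof. by field. Qed.

(** * Increments of the free energy along continuous paths *)

Section PathIncrements.
Variables (R : realType) (q : nat) (P : forall n, graphn n -> R) (mu : probability ptree_mt R).
Hypotheses (rP : random_graphs P) (bc : ball_conv P mu) (us : uniformly_sparse P).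
Local Notation Em := (@Em R mu).
Local Notation hlim := (@hlim R q).
Local Notation phin := (@phin R q.+2 P).
Local Notation Phi := (@Phi R q mu).
Implicit Types (p a b : R * R) (up : bool) (N k : nat) (T : ptree).

Let continuous_seg up a b := {ae mu, forall T : ptree_mt, forall j, (j < T [::])%N ->
  {within [set s : R | 0 <= s <= 1], continuous (fun s => hlim up (seg a b s) (shift T j))}}.

Lemma continuous_hlim up a b (h : R -> R -> ptree -> 'I_q.+2 -> R) : nonneg a -> le2 a b ->
  (forall p T, nonneg p -> h p.1 p.2 T ord0 = hlim up p T) ->
  {ae mu, forall T : ptree_mt, forall j, (j < T [::])%N -> forall c : 'I_q.+2,
     {within [set s : R | 0 <= s <= 1],
        continuous (fun s => h (seg a b s).1 (seg a b s).2 (shift T j) c)}} -> continuous_seg up a b.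
Proof.
move=> a0 ab hE; apply: filterS => T H j /H /(_ ord0).
apply: subspace_eq_continuous => s /set_mem /= /andP[s0 _].
exact: hE (shift T j) (seg_nonneg a0 ab s0).
Qed.

Let good_grid up a b e : nonneg a -> le2 a b -> continuous_seg up a b -> 0 < e ->
  exists2 N, 2 * (b.1 - a.1) <= N.+1%:R & \sum_(0 <= k < N.+1) Em (grid_error q a b up N k) <= e.
Proof.
move=> a0 ab cab e0.
have /cvgrPdist_le/(_ _ e0) c := grid_error_cvg rP bc us a0 ab cab.
have big : \forall N \near \oo, 2 * (b.1 - a.1) <= N.+1%:R.
  exists (Num.bound `|2 * (b.1 - a.1)|) => // N /= hN.
  apply: le_trans (ler_norm _) _; apply: le_trans (ltW (archi_boundP (normr_ge0 _))) _.
  by rewrite ler_nat leqW.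
have [N [h1 h2]] := eventually_ex (filterI c big); exists N => //.
by move: h1; rewrite /= sub0r normrN; apply: le_trans; exact: ler_norm.
Qed.

Lemma segment_increment_ge a b e : nonneg a -> le2 a b -> continuous_seg true a b -> 0 < e ->
  \forall n \near \oo, Phi true b - Phi true a - e <= phin b.1 b.2 n - phin a.1 a.2 n.
Proof.
move=> a0 ab cab e0; have e2 : 0 < e / 2 by rewrite divr_gt0.
have [N hN eN] := good_grid a0 ab cab e2.
have := @Phi_diff_grid_error R q P mu rP bc us a b true a0 ab N hN; rewrite /= => h.
apply: filterS (@increment_ge_lower_sum R q P mu rP bc us a b a0 ab N _ e2) => n; apply: le_trans.
by rewrite {1}(splitr e) opprD addrA lerD2r lerBlDr; apply: le_trans h _; rewrite lerD2l.
Qed.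

Lemma segment_increment_le a b e : nonneg a -> le2 a b -> continuous_seg false a b -> 0 < e ->
  \forall n \near \oo, phin b.1 b.2 n - phin a.1 a.2 n <= Phi false b - Phi false a + e.
Proof.
move=> a0 ab cab e0; have e2 : 0 < e / 2 by rewrite divr_gt0.
have [N hN eN] := good_grid a0 ab cab e2.
have := @Phi_diff_grid_error R q P mu rP bc us a b false a0 ab N hN; rewrite /= => h.
apply: filterS (@increment_le_upper_sum R q P mu rP bc us a b a0 ab N _ e2) => n h'; apply: le_trans h' _.
rewrite [X in _ <= _ + X](splitr e) addrA lerD2r -lerBlDr.
by apply: le_trans h; rewrite lerD2l lerN2.
Qed.

Lemma path_increment_ge p0 ps e : nonneg p0 -> ipath p0 ps -> cont_along mu (@hf R q.+2) p0 ps -> 0 < e ->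
  let p1 := last p0 ps in
  \forall n \near \oo, Phi true p1 - Phi true p0 - e <= phin p1.1 p1.2 n - phin p0.1 p0.2 n.
Proof.
move=> + + + + /=; elim: ps p0 e => [|x ps IH] p0 e p00.
  by move=> _ _ e0; apply: nearW => n; rewrite /= !subrr sub0r oppr_le0 ltW.
move=> /= /andP[/istep_le2 px ip] H e0; have e2 : 0 < e / 2 by rewrite divr_gt0.
have Hx : (p0, x) \in segs p0 (x :: ps) by rewrite /segs /= in_cons eqxx.
have cx := @continuous_hlim true _ _ _ p00 px (fun p T h0 => @hlim_hf R q p T ord0 h0) (H _ Hx).
have IHx := IH x (e / 2) (endpoint_nonneg p00 px) ip _ e2.
have Hps : cont_along mu (@hf R q.+2) x ps.
  by move=> ab h; apply: H; rewrite /segs /= in_cons; apply/orP; right.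
apply: filterS2 (IHx Hps) (segment_increment_ge p00 px cx e2) => n h1 h2.
rewrite -[X in _ <= X](subrKA (phin x.1 x.2 n)); apply: le_trans (lerD h1 h2).
by rewrite telescope_halves_sub.
Qed.

Lemma path_increment_le p0 ps e : nonneg p0 -> ipath p0 ps -> cont_along mu (@h1 R q.+2) p0 ps -> 0 < e ->
  let p1 := last p0 ps in
  \forall n \near \oo, phin p1.1 p1.2 n - phin p0.1 p0.2 n <= Phi false p1 - Phi false p0 + e.
Proof.
move=> + + + + /=; elim: ps p0 e => [|x ps IH] p0 e p00.
  by move=> _ _ e0; apply: nearW => n; rewrite /= !subrr add0r ltW.
move=> /= /andP[/istep_le2 px ip] H e0; have e2 : 0 < e / 2 by rewrite divr_gt0.
have Hx : (p0, x) \in segs p0 (x :: ps) by rewrite /segs /= in_cons eqxx.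
have cx := @continuous_hlim false _ _ _ p00 px (fun p T h0 => @hlim_h1 R q p T ord0 h0) (H _ Hx).
have IHx := IH x (e / 2) (endpoint_nonneg p00 px) ip _ e2.
have Hps : cont_along mu (@h1 R q.+2) x ps.
  by move=> ab h; apply: H; rewrite /segs /= in_cons; apply/orP; right.
apply: filterS2 (IHx Hps) (segment_increment_le p00 px cx e2) => n h1 h2.
rewrite -[X in X <= _](subrKA (phin x.1 x.2 n)); apply: le_trans (lerD h1 h2) _.
by rewrite telescope_halves_add.
Qed.

Lemma path_increment p0 ps : nonneg p0 -> ipath p0 ps -> let p1 := last p0 ps in
  (cont_along mu (@hf R q.+2) p0 ps ->
     (Phimu mu p1.1 p1.2 (@hf R q.+2 p1.1 p1.2) - Phimu mu p0.1 p0.2 (@hf R q.+2 p0.1 p0.2) <=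
      limn_einf (fun n => (phin p1.1 p1.2 n - phin p0.1 p0.2 n)%:E))%E) /\
  (cont_along mu (@h1 R q.+2) p0 ps ->
     (limn_esup (fun n => (phin p1.1 p1.2 n - phin p0.1 p0.2 n)%:E) <=
      Phimu mu p1.1 p1.2 (@h1 R q.+2 p1.1 p1.2) - Phimu mu p0.1 p0.2 (@h1 R q.+2 p0.1 p0.2))%E).
Proof.
move=> p00 ip p1; have p10 : nonneg p1.
  rewrite /p1; elim: ps p0 {p1} p00 ip => [|x ps IH] p0 p00 //= /andP[/istep_le2 px]; apply: IH.
  exact: endpoint_nonneg px.
split=> c.
  rewrite (@Phimu_hf R q P mu rP bc us _ p10) (@Phimu_hf R q P mu rP bc us _ p00) -EFinB.
  apply/lee_subgt0Pr => e e0; rewrite -EFinB; apply: einf_ge.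
  by apply: filterS (path_increment_ge p00 ip c e0) => n; rewrite lee_fin.
rewrite (@Phimu_h1 R q P mu rP bc us _ p10) (@Phimu_h1 R q P mu rP bc us _ p00) -EFinB.
apply/lee_addgt0Pr => e e0; rewrite -EFinD; apply: esup_le.
by apply: filterS (path_increment_le p00 ip c e0) => n; rewrite lee_fin.
Qed.
End PathIncrements.

Theorem mainTheorem2 (R : realType) (q : nat) (P : forall n, graphn n -> R)
  (mu : probability ptree_mt R) :
  (2 < q)%N -> random_graphs P -> lwc P mu ->
  (* (a) *)
  (forall beta B : R, 0 <= beta -> 0 <= B ->
    ((exists B' : R, 0 <= B' /\ exists ps : seq (R * R),
        ipath (0, B') ps /\ last (0, B') ps = (beta, B) /\ path_in (inRmu q mu) (0, B') ps)
     \/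
     (exists (p' : R * R) (ps : seq (R * R)),
        ipath (beta, B) ps /\ last (beta, B) ps = p' /\ path_in (inRmu q mu) (beta, B) ps /\
        ((forall b : R, p'.2 <= b -> inRmu q mu (p'.1, b)) \/
         (0 < p'.2 /\ forall b : R, p'.1 <= b -> inRmu q mu (b, p'.2))))) ->
    exists l : R, phin q P beta B @ \oo --> l /\
      l%:E = Phimu mu beta B (@hf R q beta B) /\ l%:E = Phimu mu beta B (@h1 R q beta B))
  /\
  (* (b) *)
  (forall (p0 : R * R) (ps : seq (R * R)), 0 <= p0.1 -> 0 <= p0.2 -> ipath p0 ps ->
    let p1 := last p0 ps in
    (cont_along mu (@hf R q) p0 ps ->
       (Phimu mu p1.1 p1.2 (@hf R q p1.1 p1.2) - Phimu mu p0.1 p0.2 (@hf R q p0.1 p0.2) <=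
        limn_einf (fun n => (phin q P p1.1 p1.2 n - phin q P p0.1 p0.2 n)%:E))%E)
    /\
    (cont_along mu (@h1 R q) p0 ps ->
       (limn_esup (fun n => (phin q P p1.1 p1.2 n - phin q P p0.1 p0.2 n)%:E) <=
        Phimu mu p1.1 p1.2 (@h1 R q p1.1 p1.2) - Phimu mu p0.1 p0.2 (@h1 R q p0.1 p0.2))%E)).
Proof.
(* The lemmas are stated for [q.+2] colours; at least three colours is the case where that [q] is
   itself a successor. *)
case: q => [|[|[|q]]] // _ rP [us [bc _]]; split=> [beta B _ _|p0 ps b0 B0 ip].
  exact: interpolation_limit.
by apply: path_increment; rewrite ?/nonneg ?b0.
Qed.
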